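(* Let $\alpha\in(0,1]$, $C>0$, $C'>0$, and suppose that $\gamma_n=\left(\frac{C}{C'+n}\right)^{\alpha}$ for all sufficiently large $n$. Then the two-armed bandit algorithm $(X_n)_{n\ge 0}$ described in the context behaves as follows. (1) If $\alpha\in(0,1)$, or if $\alpha=1$ and $Cp_B>1$, then the algorithm is fallible from every $x\in[0,1)$, i.e. $\mathbb{P}_x(X_\infty=0)>0$; moreover $\mathbb{P}_x(X_\infty=0)<1$ for every $x\in(0,1)$. On the event $\{X_\infty=0\}$ one has $\sum_n X_n<+\infty$ $\mathbb{P}_x$-a.s. for every $x\in[0,1)$, and if $\alpha=1$ and $x\in(0,1)$, then $n^{Cp_B}X_n$ converges $\mathbb{P}_x$-a.s. on $\{X_\infty=0\}$ to a finite positive (random) limit. (2) If $\alpha=1$ and $C\le \frac1{p_B}$, then the algorithm is infallible from every $x\in(0,1]$, i.e. $\mathbb{P}_x(X_\infty=1)=1$. (3) If $\alpha=1$ and $C\ge\frac1\pi$, then for every $x\in(0,1)$, $\mathbb{P}_x$-a.s. on $\{X_\infty=1\}$, $n^{Cp_A}(1-X_n)$ converges to a finite positive (random) limit. (4) If $\alpha=1$ and $\frac1{p_A}<C<\frac1\pi$, then for every $x\in(0,1)$ the event $\{X_\infty=1\}$ is, up to a $\mathbb{P}_x$-null set, the disjoint union of two events, each of positive $\mathbb{P}_x$-probability, such that almost surely on the first one $n^{C\pi}(1-X_n)$ converges to a finite positive (random) limit, and almost surely on the second one $n^{Cp_A}(1-X_n)$ converges to a finite positive (random) limit. (5) If $\alpha=1$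 and $C\le\frac1{p_A}$, then the algorithm is infallible from every $x\in(0,1]$ and, for every $x\in(0,1)$, $\mathbb{P}_x$-a.s. on $\{X_\infty=1\}$, $n^{C\pi}(1-X_n)$ converges to a finite positive (random) limit.
   Context: Let $0<p_B<p_A<1$ and $\pi=p_A-p_B>0$. Let $(\gamma_n)_{n\ge1}$ be a deterministic sequence in $(0,1)$. Let $(U_n)_{n\ge1}$ be i.i.d. uniform random variables on $[0,1]$, and let $(A_n)_{n\ge1}$, $(B_n)_{n\ge1}$ be events with $\mathbb{P}(A_n)=p_A$, $\mathbb{P}(B_n)=p_B$ for all $n$; the pairs $(\mathbf 1_{A_n},\mathbf 1_{B_n})_{n\ge1}$ are independent in $n$ (no assumption is made on the dependence between $A_n$ and $B_n$), and the sequence $(\mathbf 1_{A_n},\mathbf 1_{B_n})_{n\ge1}$ is independent of $(U_n)_{n\ge1}$. The two-armed bandit algorithm is defined by $X_0=x\in[0,1]$ and $$X_{n+1}=X_n+\gamma_{n+1}\left(\mathbf 1_{\{U_{n+1}\le X_n\}\cap A_{n+1}}(1-X_n)-\mathbf 1_{\{U_{n+1}>X_n\}\cap B_{n+1}}X_n\right),\quad n\ge0.$$ The notation $\mathbb{P}_x$ refers to $X_0=x$. When $\sum_n\gamma_n=+\infty$ (which holds here), $(X_n)$ converges a.s. to a random variable $X_\infty$ with values in $\{0,1\}$ a.s. *)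

(* Defs.v *)
(* Written with MathComp and MathComp-Analysis. *)
From HB Require Import structures.
From mathcomp Require Export all_boot all_order all_algebra finmap.
From mathcomp Require Export all_classical all_reals all_analysis.

Set Implicit Arguments.
Unset Strict Implicit.
Unset Printing Implicit Defensive.

Import Order.TTheory GRing.Theory Num.Theory.
Import numFieldNormedType.Exports.

Local Open Scope classical_set_scope.
Local Open Scope ring_scope.

Definition independent_family d d' (T : measurableType d)
    (T' : measurableType d') (R : realType) (P : probability T R)
    (I : choiceType) (Y : I -> T -> T') : Prop :=
  forall (J : {fset I}) (E : I -> set T'),
    (forall i, i \in J -> measurable (E i)) ->
    P (\bigcap_(i in [set` J]) (Y i @^-1` E i)) =
    (\prod_(i <- J) P (Y i @^-1` E i))%E.

(* sigma(Y_i, i in I) *)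
Definition sigma_family d d' (T : measurableType d) (T' : measurableType d')
    (I : Type) (Y : I -> T -> T') : set (set T) :=
  <<s \bigcup_i preimage_set_system setT (Y i) measurable >>.

Definition independent_classes d (T : measurableType d) (R : realType)
    (P : probability T R) (F G : set (set T)) : Prop :=
  forall E E', F E -> G E' -> P (E `&` E') = (P E * P E')%E.

Definition iid_uniform01 d (T : measurableType d) (R : realType)
    (P : probability T R) (U : nat -> {RV P >-> R}) : Prop :=
  (forall n (S : set R), measurable S ->
     distribution P (U n) S = uniform_prob (@ltr01 R) S) /\
  independent_family P (fun n => U n : T -> R).

Definition indic_pair (T : Type) (R : realType) (A B : set T) : T -> R * R :=
  fun w => (\1_A w, \1_B w).

(* Entry 0 of gamma, U, A and B is never used: the step n -> n + 1 uses
   entry n + 1. *)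
Fixpoint bandit (T : Type) (R : realType) (gamma : nat -> R)
    (U : nat -> T -> R) (A B : nat -> set T) (x : R) (n : nat) : T -> R :=
  if n is m.+1 then
    let X := bandit gamma U A B x m in
    fun w => X w + gamma m.+1 *
      (\1_([set v | U m.+1 v <= X v] `&` A m.+1) w * (1 - X w)
       - \1_([set v | U m.+1 v > X v] `&` B m.+1) w * X w)
  else fun=> x.

Definition cvg_to_pos (R : realType) (u : nat -> R) : Prop :=
  exists2 l : R, 0 < l & u n @[n --> \oo] --> l.

(* Main.v *)
Require Import Defs.
From mathcomp Require Import measurable_realfun ring lra.

(* Along a fixed history of wins and losses X_n takes an explicit value, so the
   law of the history up to time n is a finite product and conditional
   expectations are finite sums over the next letter. Nonnegative
   supermartingales then give the convergence of X_n to 0 or 1, that of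
   (1 - X_n) / prod (1 - gamma_k (pA - pB) X_(k-1)), and the size of the
   products of the factors 1 - gamma_k over the losses (or over the wins).

   The heart of the matter is that exp (- lambda X) is a supermartingale for
   lambda = c / gamma_n, whence P (X_oo = 0 | F_n) <= exp (- c X_n / gamma_n);
   a zero-one argument upgrades this to X_n / gamma_n -> 0 on {X_oo = 0}. As
   each win makes X_n at least gamma_n, wins eventually stop on this event and
   X_n behaves like a product of the 1 - gamma_k over the losses, of order
   n ^ (- C pB) if alpha = 1. This contradicts X_n / gamma_n -> 0 when
   C pB <= 1 and yields the rate otherwise. Near 1 the drift goes the other way:
   if C (pA - pB) < 1, the same supermartingale with lambda growing like
   n ^ (C (pA - pB)) controls the event
   {n ^ (C (pA - pB)) (1 - X_n) -> 0}, on which losses eventually stop; if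
   C (pA - pB) >= 1, a loss would make the convergent sequence
   n ^ (C (pA - pB)) (1 - X_n) jump. *)

Set Implicit Arguments.
Unset Strict Implicit.
Unset Printing Implicit Defensive.

Import Order.TTheory GRing.Theory Num.Theory.
Import numFieldNormedType.Exports.

Local Open Scope classical_set_scope.
Local Open Scope ring_scope.

(** * Histories *)

(** The two ends differ as follows. Put pi = pA - pB. In the exponent of exp (- lambda X), one step
    adds at most X (1 - X) times - lambda gamma pi + 3 (lambda gamma)^2. Near 0 the linear term
    helps, so a lambda frozen at c / gamma_n works. Near 1 its sign is reversed: lambda must grow
    like 1 / prod (1 - pi gamma_k), starting from c / gamma_n, and lambda gamma stays small because
    gamma_n / prod (1 - pi gamma_k) decreases, which is where C pi < 1 enters. Positive
    probabilities need another construction. A run of losses has positive weight and brings X_m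
    below delta gamma_m. From there 1 - X_n / (delta gamma_n), set to 0 at the first win, is a
    submartingale as soon as 1 / gamma_(n+1) - 1 / gamma_n <= pB - delta and the steps are small; so
    with positive probability no win ever follows. The increments of 1 / gamma tend to 0 if alpha <
    1 and equal 1 / C if alpha = 1, whence the conditions alpha < 1 or C pB > 1, and C pA > 1 for
    the mirror event near 1. *)

Lemma negb_eqF s : (~~ s == s) = false. Proof. by case: s. Qed.

Lemma eq_negF s : (s == ~~ s) = false. Proof. by case: s. Qed.

Section Words.
Variables (R : realType) (gamma : nat -> R) (q : bool -> R) (x : R).

(* A history is a list of letters [(u, h)], newest first: [u] records whether
   [U (n + 1) <= X n], and [h] records [A (n + 1)] if [u] holds and [B (n + 1)]
   otherwise. [state true] is [X] and [state false] is [1 - X], so that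
   exchanging the two sides exchanges the two arms; the letter [(s, true)]
   pushes [state s] up. [q true] and [q false] stand for [pA] and [pB]. *)
Fixpoint state (s : bool) (w : seq (bool * bool)) : R :=
  if w is l :: w' then
    let z := state s w' in let g := gamma (size w').+1 in
    if l.2 then if l.1 == s then z + g * (1 - z) else z - g * z else z
  else if s then x else 1 - x.

(* Conditional expectation of [f] at the next history, given the history [w]. *)
Definition step (f : seq (bool * bool) -> R) (w : seq (bool * bool)) : R :=
  state true w *
    (q true * f ((true, true) :: w) + (1 - q true) * f ((true, false) :: w)) +
  state false w *
    (q false * f ((false, true) :: w) + (1 - q false) * f ((false, false) :: w)).

Fixpoint weight (w : seq (bool * bool)) : R :=
  if w is l :: w' then
    weight w' * (state l.1 w' * (if l.2 then q l.1 else 1 - q l.1))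
  else 1.

Hypothesis x01 : 0 <= x <= 1.
Hypothesis gamma01 : forall n, 0 < gamma n.+1 < 1.
Hypothesis q01 : forall s, 0 < q s < 1.

Lemma stateN s w : state (~~ s) w = 1 - state s w.
Proof.
elim: w s => [|[u h] w IH] s /=; first by case: s => //=; ring.
by rewrite IH; case: h => //; case: u; case: s => /=; ring.
Qed.

Lemma state01 s w : 0 <= state s w <= 1.
Proof.
elim: w => [|[u h] w /andP[z0 z1]] /=.
  by move: x01 => /andP[? ?]; case: s; apply/andP; split; lra.
have /andP[g0 g1] := gamma01 (size w).
case: h; last by rewrite z0 z1.
case: (u == s).
  by apply/andP; split; nra.
by apply/andP; split; nra.
Qed.

Lemma state_gt0 s w : 0 < state s [::] -> 0 < state s w.
Proof.
move=> z0; elim: w => [//|[u h] w IH] /=.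
have /andP[g0 g1] := gamma01 (size w).
have /andP[_ z1] := state01 s w.
case: h => //; case: (u == s).
  by rewrite ltr_wpDr // mulr_ge0 ?subr_ge0 // ltW.
by rewrite -[X in X - _]mul1r -mulrBl mulr_gt0 // subr_gt0.
Qed.

(** Lists the side [s] first, so that an identity computed once serves both ends of the interval. *)
Lemma step_side s f w : step f w =
  state s w * (q s * f ((s, true) :: w) + (1 - q s) * f ((s, false) :: w)) +
  state (~~ s) w * (q (~~ s) * f ((~~ s, true) :: w) +
    (1 - q (~~ s)) * f ((~~ s, false) :: w)).
Proof. by rewrite /step; case: s => //=; rewrite addrC. Qed.

Lemma ler_step f g w : (forall l, f (l :: w) <= g (l :: w)) ->
  step f w <= step g w.
Proof.
move=> fg; rewrite /step.
have /andP[? ?] := state01 true w; have /andP[? ?] := state01 false w.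
have /andP[? ?] := q01 true; have /andP[? ?] := q01 false.
have ? := fg (true, true); have ? := fg (true, false).
have ? := fg (false, true); have ? := fg (false, false).
by apply: lerD; apply: ler_wpM2l => //; apply: lerD; apply: ler_wpM2l => //; lra.
Qed.

Lemma eq_step f g w : (forall l, f (l :: w) = g (l :: w)) ->
  step f w = step g w.
Proof. by move=> fg; rewrite /step !fg. Qed.

Lemma step_cst c w : step (fun=> c) w = c.
Proof. by rewrite (step_side true) (stateN true); ring. Qed.

Lemma stepD f g w : step (fun v => f v + g v) w = step f w + step g w.
Proof. by rewrite /step; ring. Qed.

Lemma stepZ c f w : step (fun v => c * f v) w = c * step f w.
Proof. by rewrite /step; ring. Qed.

Lemma iter_stepZ k c f w :
  iter k step (fun v => c * f v) w = c * iter k step f w.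
Proof.
elim: k w => [//|k IH] w /=.
by rewrite -stepZ; apply: eq_step => l; rewrite IH.
Qed.

Lemma ler_iter_step k f g w : (forall v, size v = (size w + k)%N -> f v <= g v) ->
  iter k step f w <= iter k step g w.
Proof.
elim: k w => [|k IH] w fg /=; first by apply: fg; rewrite addn0.
by apply: ler_step => l; apply: IH => v vs; apply: fg; rewrite vs addnS.
Qed.

Lemma iter_step_super n k f w :
  (forall v, (n <= size v)%N -> step f v <= f v) ->
  (n <= size w)%N -> iter k step f w <= f w.
Proof.
move=> fs; elim: k w => [//|k IH] w nw /=.
apply: le_trans (fs w nw); apply: ler_step => l.
by apply: IH => /=; rewrite leqW.
Qed.

Lemma iter_step_sub n k f w :
  (forall v, (n <= size v)%N -> f v <= step f v) ->
  (n <= size w)%N -> f w <= iter k step f w.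
Proof.
move=> fs; elim: k w => [//|k IH] w nw /=.
apply: (le_trans (fs w nw)); apply: ler_step => l.
by apply: IH => /=; rewrite leqW.
Qed.

Lemma step_state s w : step (state s) w = state s w +
  gamma (size w).+1 * (q s - q (~~ s)) * (state s w * state (~~ s) w).
Proof.
rewrite (step_side s) /= eqxx negb_eqF stateN.
by ring.
Qed.

(* [downfall s] is the factor applied to [state s] by the letters that push it
   down; [shrink] and [swell] are the compensators which make
   [downfall / shrink] and [1 / (downfall * swell)] martingales. *)
Fixpoint downfall (s : bool) (w : seq (bool * bool)) : R :=
  if w is l :: w' then downfall s w' *
    (if l == (~~ s, true) then 1 - gamma (size w').+1 else 1)
  else 1.

Fixpoint shrink (a : R) (s : bool) (w : seq (bool * bool)) : R :=
  if w is _ :: w' then shrink a s w' * (1 - a * gamma (size w').+1 * state s w')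
  else 1.

Fixpoint swell (a : R) (s : bool) (w : seq (bool * bool)) : R :=
  if w is _ :: w' then swell a s w' *
    (1 + a * (gamma (size w').+1 / (1 - gamma (size w').+1)) * state s w')
  else 1.

Lemma downfall_gt0 s w : 0 < downfall s w.
Proof.
elim: w => [|l w IH] //=; have /andP[g0 g1] := gamma01 (size w).
by case: ifP => _; rewrite mulr_gt0 // subr_gt0.
Qed.

Lemma shrink_gt0 a s w : 0 <= a <= 1 -> 0 < shrink a s w.
Proof.
move=> /andP[a0 a1]; elim: w => [|l w IH] //=.
have /andP[g0 g1] := gamma01 (size w); have /andP[z0 z1] := state01 s w.
rewrite mulr_gt0 // subr_gt0.
have : a * gamma (size w).+1 <= gamma (size w).+1 by nra.
have : 0 <= a * gamma (size w).+1 by nra.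
by nra.
Qed.

Lemma swell_gt0 a s w : 0 <= a -> 0 < swell a s w.
Proof.
move=> a0; elim: w => [|l w IH] //=.
have /andP[g0 g1] := gamma01 (size w); have /andP[z0 z1] := state01 s w.
rewrite mulr_gt0 // ltr_wpDr // mulr_ge0 // mulr_ge0 // divr_ge0 //; lra.
Qed.

Lemma q01W s : 0 <= q s <= 1.
Proof. by have /andP[? ?] := q01 s; rewrite !ltW. Qed.

(** The letter [(~~ s, true)] has conditional probability [state (~~ s) w * q (~~ s)], so the mean
    of the new factor of [downfall] is exactly the new factor of [shrink]. *)
Lemma step_downfall_shrink s w :
  step (fun v => downfall s v / shrink (q (~~ s)) (~~ s) v) w =
  downfall s w / shrink (q (~~ s)) (~~ s) w.
Proof.
have := lt0r_neq0 (shrink_gt0 (~~ s) ((true, true) :: w) (q01W (~~ s))).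
have := lt0r_neq0 (shrink_gt0 (~~ s) w (q01W (~~ s))).
rewrite (step_side s) /= !eqxx !xpair_eqE !andbF !andbT eq_negF.
rewrite stateN mulf_eq0 negb_or => h /andP[_ h'].
by field; rewrite h h'.
Qed.

Lemma step_downfall_swell s w :
  step (fun v => (downfall s v * swell (q (~~ s)) (~~ s) v)^-1) w =
  (downfall s w * swell (q (~~ s)) (~~ s) w)^-1.
Proof.
have /andP[q0 q1] := q01W (~~ s).
have /andP[g0 g1] := gamma01 (size w).
have := lt0r_neq0 (swell_gt0 (~~ s) ((true, true) :: w) q0).
have := lt0r_neq0 (swell_gt0 (~~ s) w q0).
have := lt0r_neq0 (downfall_gt0 s w).
rewrite (step_side s) /= !eqxx !xpair_eqE !andbF !andbT eq_negF.
rewrite stateN mulf_eq0 negb_or => d0 h /andP[_ h'].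
have g1n : 1 - gamma (size w).+1 != 0 by rewrite subr_eq0 eq_sym lt_eqF.
(* This is [1 - gamma] times the new factor of [swell], the denominator that [field] meets once
   [1 - gamma] is cleared. *)
have h'' : 1 - gamma (size w).+1 + q (~~ s) * gamma (size w).+1 * (1 - state s w) != 0.
  apply: contraNneq h' => e; apply/eqP.
  transitivity ((1 - gamma (size w).+1 + q (~~ s) * gamma (size w).+1 * (1 - state s w)) / (1 - gamma (size w).+1)).
    by field.
  by rewrite e mul0r.
by field; rewrite d0 h g1n /=.
Qed.

(** By [step_state], one step multiplies [state s] on average by the new factor of [shrink]. *)
Lemma step_ratio_shrink s w : 0 <= q (~~ s) - q s <= 1 ->
  step (fun v => state s v / shrink (q (~~ s) - q s) (~~ s) v) w =
  state s w / shrink (q (~~ s) - q s) (~~ s) w.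
Proof.
move=> a01.
have := lt0r_neq0 (shrink_gt0 (~~ s) ((true, true) :: w) a01).
have := lt0r_neq0 (shrink_gt0 (~~ s) w a01).
rewrite (step_side s) /= !eqxx negb_eqF.
rewrite stateN mulf_eq0 negb_or => h /andP[_ h'].
by field; rewrite h h'.
Qed.

(** Follows from exp u >= 1 + u and (1 + u) (1 - u + u^2) = 1 + u^3. *)
Lemma expRN_le (u : R) : 0 <= u -> expR (- u) <= 1 - u + u ^+ 2.
Proof.
move=> u0; rewrite expRN -[leRHS]invrK lef_pV2 ?posrE ?expR_gt0 ?invr_gt0; try by nra.
apply: le_trans (expR_ge1Dx _); rewrite -[leLHS]mul1r ler_pdivrMr; last by nra.
rewrite [leRHS](_ : _ = 1 + u ^+ 3); first by rewrite lerDl exprn_ge0.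
by ring.
Qed.

Lemma expR_le (u : R) : 0 <= u <= 2^-1 -> expR u <= 1 + u + 2 * u ^+ 2.
Proof.
move=> /andP[u0 u1]; rewrite -[u in expR u]opprK expRN invf_ple ?posrE ?expR_gt0; try by nra.
apply: le_trans (expR_ge1Dx _); rewrite -[leLHS]mul1r ler_pdivrMr; last by nra.
rewrite [leRHS](_ : _ = 1 + u ^+ 2 * (1 - 2 * u)); last by ring.
by rewrite lerDl mulr_ge0 ?sqr_ge0 //; lra.
Qed.

(** The linear and the quadratic term of the expansion both carry the factor z (1 - z), so the sign
    of the correction depends on [lam * g] and not on the current state. The 3 is a crude bound for
    q s (1 - z) + 2 q (~~ s) z. *)
Lemma step_exp s lam w (g := gamma (size w).+1) (z := state s w) :
  0 <= lam -> lam * g <= 2^-1 ->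
  step (fun v => expR (- (lam * state s v))) w <=
  expR (- (lam * z) + z * (1 - z) *
    (lam * g * (q (~~ s) - q s) + 3 * (lam * g) ^+ 2)).
Proof.
move=> lam0 lamg; have /andP[g0 g1] := gamma01 (size w).
have /andP[z0 z1] := state01 s w.
rewrite (step_side s) /= !eqxx negb_eqF.
rewrite stateN -/g -/z; rewrite -/g in g0 g1; rewrite -/z in z0 z1.
set t := lam * g.
have t0 : 0 <= t by rewrite mulr_ge0 // ltW.
have -> : - (lam * (z + g * (1 - z))) = - (lam * z) + - (t * (1 - z)).
  by rewrite /t; ring.
have -> : - (lam * (z - g * z)) = - (lam * z) + t * z by rewrite /t; ring.
rewrite !expRD; set e := expR (- (lam * z)).
have e0 : 0 < e := expR_gt0 _.
have h1 : expR (- (t * (1 - z))) <= 1 - t * (1 - z) + (t * (1 - z)) ^+ 2.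
  by apply: expRN_le; nra.
have h2 : expR (t * z) <= 1 + t * z + 2 * (t * z) ^+ 2.
  apply: expR_le; rewrite mulr_ge0 //=; apply: le_trans lamg.
  by rewrite -/t ler_piMr.
have /andP[qs0 qs1] := q01 s; have /andP[qn0 qn1] := q01 (~~ s).
apply: (@le_trans _ _ (e * (1 + z * (1 - z) * (t * (q (~~ s) - q s) + 3 * t ^+ 2)))).
  rewrite [leLHS](_ : _ = e * (z * (q s * expR (- (t * (1 - z))) + (1 - q s)) +
     (1 - z) * (q (~~ s) * expR (t * z) + (1 - q (~~ s))))); last by ring.
  rewrite ler_pM2l //.
  apply: (@le_trans _ _ (z * (q s * (1 - t * (1 - z) + (t * (1 - z)) ^+ 2) + (1 - q s)) +
     (1 - z) * (q (~~ s) * (1 + t * z + 2 * (t * z) ^+ 2) + (1 - q (~~ s))))).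
    apply: lerD; apply: ler_wpM2l; rewrite ?subr_ge0 // lerD2r ler_pM2l //.
  rewrite -subr_ge0 [leRHS](_ : _ = z * (1 - z) * t ^+ 2 *
     (3 - q s * (1 - z) - 2 * q (~~ s) * z)); last by ring.
  apply: mulr_ge0; last by nra.
  by rewrite mulr_ge0 ?sqr_ge0 // mulr_ge0 // subr_ge0.
by rewrite ler_pM2l // expR_ge1Dx.
Qed.

Fixpoint no_up (s : bool) (m : nat) (w : seq (bool * bool)) : bool :=
  if w is l :: w' then
    ((size w' < m)%N || (l != (s, true))) && no_up s m w' else true.

Lemma no_up_ge s m w : (size w <= m)%N -> no_up s m w.
Proof. by elim: w => //= l w IH lm; rewrite lm IH // ltnW. Qed.

(* [1 - sigma n * state s] is a submartingale as long as no letter pushes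
   [state s] up, hence bounds the survival probability from below. *)
Lemma iter_step_no_up s (sigma : nat -> R) m k w :
  (forall n, (m <= n)%N -> 0 <= sigma n) ->
  (forall n, (m <= n)%N ->
     1 + (1 - gamma n.+1 * q (~~ s)) * sigma n.+1 <= sigma n) ->
  (forall n, (m <= n)%N -> gamma n.+1 * q (~~ s) <= q s) ->
  size w = m ->
  1 - sigma m * state s w <= iter k step (fun v => (no_up s m v)%:R) w.
Proof.
move=> sigma0 sigmaS gq wm.
pose f v := (no_up s m v)%:R * (1 - sigma (size v) * state s v).
apply: (@le_trans _ _ (iter k step f w)); last first.
  apply: ler_iter_step => v vs; rewrite /f ler_piMr // ?ler0n //.
  rewrite gerBl mulr_ge0 //; last by have /andP[] := state01 s v.
  by apply: sigma0; rewrite vs -wm leq_addr.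
rewrite [leLHS](_ : _ = f w); last by rewrite /f no_up_ge wm // mul1r.
apply: (iter_step_sub (n := m)) => [v mv|]; last by rewrite wm.
rewrite (step_side s) /f /= !eqxx /= !xpair_eqE /= !andbF !orbT /=.
rewrite negb_eqF !orbT ltnNge mv /= mul0r mulr0 add0r stateN.
have /andP[g0 g1] := gamma01 (size v).
have /andP[z0 z1] := state01 s v.
have /andP[qs0 qs1] := q01 s; have /andP[qn0 qn1] := q01 (~~ s).
have := sigmaS _ mv; have := sigma0 _ (leqW mv).
case: (no_up s m v); rewrite ?mul0r; last by rewrite ?mulr0 ?mul0r ?addr0 ?mulr0.
set z := state s v in z0 z1 *; set g := gamma _ in g0 g1 *.
set S := sigma _.+1; set S' := sigma _ => S0 SS.
rewrite !mul1r.
have := gq _ mv; rewrite -/g => gq'.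
(* The one-step increment is the sum of three nonnegative terms: z times the slack in [sigmaS], a
   quadratic term whose sign is [gq], and z (1 - q s). *)
have : z * (S' - (1 + (1 - g * q (~~ s)) * S)) >= 0 by rewrite mulr_ge0 // subr_ge0.
have : 0 <= (z ^+ 2 * S) * (q s - g * q (~~ s)).
  by rewrite mulr_ge0 ?subr_ge0 // mulr_ge0 // sqr_ge0.
have : 0 <= z * (1 - q s) by rewrite mulr_ge0 // subr_ge0 ltW.
by lra.
Qed.

End Words.

(** * Asymptotics of the step sizes *)

Section Asymptotics.
Variable R : realType.
Implicit Types (u v e b : nat -> R) (a c : R).

Lemma cvg_to_posM u v : cvg_to_pos u -> cvg_to_pos v ->
  cvg_to_pos (fun n => u n * v n).
Proof.
move=> [l l0 ul] [m m0 vm]; exists (l * m); first exact: mulr_gt0.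
exact: cvgM.
Qed.

Lemma cvg_to_posV u : cvg_to_pos u -> cvg_to_pos (fun n => (u n)^-1).
Proof.
move=> [l l0 ul]; exists l^-1; first by rewrite invr_gt0.
by apply: cvgV => //; rewrite gt_eqF.
Qed.

Lemma cvg_to_pos_cst c : 0 < c -> cvg_to_pos (fun=> c).
Proof. by move=> c0; exists c => //; exact: cvg_cst. Qed.

Lemma cvg_to_pos_near u v : (\forall n \near \oo, u n = v n) ->
  cvg_to_pos u -> cvg_to_pos v.
Proof.
move=> uv [l l0 ul]; exists l => //; apply: cvg_trans ul.
by apply: near_eq_cvg; apply: filterS uv => n ->.
Qed.

Lemma cvg_to_pos_ge u : cvg_to_pos u -> exists2 c, 0 < c & \forall n \near \oo, c <= u n.
Proof.
move=> [l l0 ul]; exists (l / 2); first by rewrite divr_gt0.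
by apply: (cvgr_ge l ul); rewrite ltr_pdivrMr // ltr_pMr // ltr1n.
Qed.

Lemma prod_le_expR e n : (forall k, 0 <= e k) ->
  \prod_(k < n) (1 + e k) <= expR (\sum_(k < n) e k).
Proof.
move=> e0; elim: n => [|n IH]; first by rewrite !big_ord0 expR0.
rewrite !big_ord_recr /= expRD ler_pM //.
- by rewrite prodr_ge0 // => k _; rewrite addr_ge0.
- by rewrite addr_ge0.
- exact: expR_ge1Dx.
Qed.

Lemma prod_cvg_to_pos e M : (forall k, 0 <= e k) ->
  (forall n, \sum_(k < n) e k <= M) ->
  cvg_to_pos (fun n => \prod_(k < n) (1 + e k)).
Proof.
move=> e0 eM; set u := (fun n => _).
have u1 n : 1 <= u n.
  rewrite /u; elim: n => [|n IH]; first by rewrite big_ord0.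
  by rewrite big_ord_recr /= (le_trans IH) // ler_peMr ?lerDl // (le_trans _ IH).
have uh : {homo u : n m / (n <= m)%N >-> n <= m}.
  apply: homo_leq => // [y x z|n]; first exact: le_trans.
  by rewrite /u big_ord_recr /= ler_peMr ?lerDl // (le_trans _ (u1 n)).
have uc : cvgn u.
  apply: nondecreasing_is_cvgn => //; exists (expR M) => _ [n _ <-].
  by rewrite (le_trans (prod_le_expR n e0)) // ler_expR.
exists (limn u) => //; apply: (lt_le_trans ltr01).
by apply: (le_trans (u1 0%N)); exact: nondecreasing_cvgn_le.
Qed.

(** From [N] on, [e] and [u + e] decrease while [u - e] increases and bounds [u + e] from below; so
    [u] is a difference of two convergent sequences. *)
Lemma telescoped_variation_cvg u e N :
  (forall n, (N <= n)%N -> `|u n.+1 - u n| <= e n - e n.+1) ->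
  (forall n, 0 <= e n) -> cvgn u.
Proof.
move=> ue e0.
have h n : u (n.+1 + N)%N - u (n + N)%N <= e (n + N)%N - e (n.+1 + N)%N /\
    e (n.+1 + N)%N - e (n + N)%N <= u (n.+1 + N)%N - u (n + N)%N.
  have := ue (n + N)%N (leq_addl _ _); rewrite ler_norml addSn => /andP[h1 h2].
  by split => //; lra.
have e_cvg : cvgn (fun n => e (n + N)%N).
  apply: nonincreasing_is_cvgn; last by exists 0 => _ [n _ <-].
  move=> i j ij; rewrite -(subnK ij); elim: (j - i)%N => // k IH.
  by apply: le_trans IH; have [h1 h2] := h (k + i)%N; rewrite addSn; lra.
have v_cvg : cvgn (fun n => u (n + N)%N + e (n + N)%N).
  apply: nonincreasing_is_cvgn.
    move=> i j ij; rewrite -(subnK ij); elim: (j - i)%N => // k IH.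
    by apply: le_trans IH; have [h1 h2] := h (k + i)%N; rewrite addSn; lra.
  exists (u N - e N) => _ [n _ <-]; have := e0 (n + N)%N.
  have : u N - e N <= u (n + N)%N - e (n + N)%N.
    elim: n => [|n IH]; first by rewrite add0n.
    by apply: (le_trans IH); have [h1 h2] := h n; lra.
  by lra.
apply/cvg_ex; eexists; rewrite -(cvg_shiftn N).
apply: cvg_trans (cvgB v_cvg e_cvg); apply: near_eq_cvg; near=> n => /=.
by rewrite !fctE addrK.
Unshelve. all: by end_near. Qed.

Lemma ln1B_bounds (t : R) : 0 <= t <= 2^-1 -> - t - 2 * t ^+ 2 <= ln (1 - t) <= - t.
Proof.
move=> /andP[t0 t1]; have t1' : 0 < 1 - t by lra.
apply/andP; split; last by apply: le_ln1Dx; lra.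
rewrite -[1 - t]invrK lnV ?posrE ?invr_gt0 // lerNr opprB opprK.
rewrite [(1 - t)^-1](_ : _ = 1 + t / (1 - t)); last by field; rewrite gt_eqF.
apply: le_trans (le_ln1Dx _) _.
  by apply: (@lt_le_trans _ _ 0) => //; rewrite divr_ge0 // ltW.
rewrite ler_pdivrMr // -subr_ge0.
rewrite [leRHS](_ : _ = t ^+ 2 * (1 - 2 * t)); last by ring.
by rewrite mulr_ge0 ?sqr_ge0 //; lra.
Qed.

(* The Gamma-function asymptotics of the products, read off the logarithm,
   whose increments are of order [1 / n ^ 2]. *)
Lemma powR_prod_cvg_to_pos a C' b : 0 < a -> 0 < C' ->
  (forall k, 0 < b k < 1) ->
  (\forall k \near \oo, b k = a / (C' + k.+1%:R)) ->
  cvg_to_pos (fun n => n%:R `^ a * \prod_(k < n) (1 - b k)).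
Proof.
move=> a0 C0 b01 [N0 _ bE].
pose u n := a * ln n%:R + \sum_(k < n) ln (1 - b k).
have uc : cvgn u.
  (* With t = 1 / (n + 1), the terms a t of an increment of [u] cancel. The errors are 2 (a t)^2
     from ln (1 - b n), 2 a t^2 from ln (1 - t), and a C' t^2 from replacing b n by a t; finally t^2
     <= 1 / n - 1 / (n + 1) telescopes. *)
  pose K := 2 * a ^+ 2 + 2 * a + a * C'.
  have K0 : 0 <= K.
    by rewrite /K !addr_ge0 ?mulr_ge0 ?sqr_ge0 // ltW.
  pose N := (N0 + Num.trunc (2 * a) + 1)%N.
  apply: (@telescoped_variation_cvg _ (fun n => if n is 0%N then K else K / n%:R) N); last first.
    by case=> // n; rewrite divr_ge0.
  move=> n Nn; have n0 : (0 < n)%N by rewrite (leq_trans _ Nn) // /N addn1.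
  have nE : b n = a / (C' + n.+1%:R) by apply: bE; rewrite /= (leq_trans _ Nn) // /N -addnA leq_addr.
  have nR : 0 < n%:R :> R by rewrite ltr0n.
  have na : 2 * a <= n%:R.
    have : 2 * a < (Num.trunc (2 * a)).+1%:R by exact: truncnS_gt.
    move=> /ltW /le_trans; apply; rewrite ler_nat (leq_trans _ Nn) // /N addn1 ltnS leq_addl //.
  pose t : R := n.+1%:R^-1.
  have t0 : 0 < t by rewrite invr_gt0 ltr0n.
  have tn : t * (n%:R + 1) = 1 by rewrite natr1 mulVf.
  have n1 : 1 <= n%:R :> R by rewrite ler1n.
  have t12 : t <= 2^-1 by rewrite lef_pV2 ?posrE ?ltr0n // ler_nat.
  have -> : (if n is 0%N then K else K / n%:R) = K / n%:R by case: (n) n0.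
  have lnn : ln n%:R = ln n.+1%:R + ln (1 - t) :> R.
    rewrite -lnM ?posrE ?ltr0n //; last by lra.
    congr ln; rewrite -natr1 mulrBr mulr1; rewrite mulrC in tn; rewrite tn; ring.
  rewrite /u big_ord_recr /= lnn.
  have /andP[] := @ln1B_bounds t ltac:(by rewrite (ltW t0) t12).
  set L := ln (1 - t) => L1 L2.
  have Ct0 : 0 < C' + n.+1%:R by rewrite addr_gt0 // ltr0n.
  have bE' : b n * (C' + n.+1%:R) = a by rewrite nE divfK // gt_eqF.
  have /andP[bn0 bn1] := b01 n.
  have bt : b n <= a * t.
    rewrite nE /t ler_pM2l // lef_pV2 ?posrE ?ltr0n // lerDr ltW //.
  have bt' : a * t - a * C' * t ^+ 2 <= b n.
    have e1 : a * t - b n = b n * C' * t.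
      have -> : a * t = b n * C' * t + b n * (t * (n%:R + 1)).
        by rewrite -bE' -natr1; ring.
      by rewrite tn; ring.
    have : b n * C' * t <= (a * t) * C' * t by rewrite !ler_pM2r.
    rewrite -e1; rewrite [X in _ <= X -> _](_ : _ = a * C' * t ^+ 2); last by ring.
    by lra.
  have at12 : a * t <= 2^-1.
    have : 2 * a * t <= (n%:R + 1) * t by rewrite ler_pM2r //; lra.
    by rewrite [X in _ <= X -> _]mulrC tn; lra.
  have /andP[] := @ln1B_bounds (b n) ltac:(rewrite (ltW bn0) /=; exact: le_trans at12).
  set L' := ln (1 - b n) => L'1 L'2.
  have bb : b n ^+ 2 <= (a * t) ^+ 2 by rewrite ler_sqr ?nnegrE // ltW // mulr_gt0.
  have tt : t ^+ 2 <= n%:R^-1 - t.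
    have nV : n%:R^-1 * n%:R = 1 :> R by rewrite mulVf // gt_eqF.
    have -> : n%:R^-1 - t = n%:R^-1 * t.
      transitivity (n%:R^-1 * (1 - t * n%:R)); last by congr (_ * _); lra.
      by rewrite mulrBr mulr1 mulrCA nV mulr1.
    rewrite expr2 ler_pM2r // lef_pV2 ?posrE ?ltr0n // ler_nat; exact: leqnSn.
  have e0 : 0 <= t ^+ 2 by exact: sqr_ge0.
  have Kt : K * t ^+ 2 <= K / n%:R - K * t by rewrite -mulrBr ler_wpM2l.
  have aL1 : a * (- t - 2 * t ^+ 2) <= a * L by rewrite ler_pM2l.
  have aL2 : a * L <= a * - t by rewrite ler_pM2l.
  have KE : K * t ^+ 2 = 2 * (a * t) ^+ 2 + 2 * (a * t ^+ 2) + a * C' * t ^+ 2.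
    by rewrite /K; ring.
  have p1 : 0 <= a * t ^+ 2 by rewrite mulr_ge0 // ltW.
  have p2 : 0 <= a * C' * t ^+ 2 by rewrite mulr_ge0 // mulr_ge0 // ltW.
  have p3 : 0 <= (a * t) ^+ 2 by exact: sqr_ge0.
  rewrite -/t ler_norml; apply/andP; split; lra.
have prodE n : expR (\sum_(k < n) ln (1 - b k)) = \prod_(k < n) (1 - b k).
  elim: n => [|n IH]; first by rewrite !big_ord0 expR0.
  rewrite !big_ord_recr /= expRD IH lnK // posrE subr_gt0.
  by have /andP[] := b01 n.
exists (expR (limn u)); first exact: expR_gt0.
have ec : expR (u n) @[n --> \oo] --> expR (limn u).
  have ul : u @ \oo --> limn u := uc.
  have h := @continuous_cvg _ _ _ _ _ u expR (limn u) (@continuous_expR R (limn u)) ul.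
  exact: h.
apply: cvg_trans ec; apply: near_eq_cvg; near=> n.
have n0 : (0 < n)%N by near: n; exact: nbhs_infty_gt.
rewrite /= /u expRD -ln_powR lnK ?posrE ?powR_gt0 ?ltr0n //; congr (_ * _).
exact: prodE.
Unshelve. all: by end_near. Qed.

Lemma sum_telescope_bounded e f N : (forall k, 0 <= e k) -> (forall k, 0 <= f k) ->
  (forall k, (N <= k)%N -> e k <= f k - f k.+1) ->
  exists M, forall n, \sum_(k < n) e k <= M.
Proof.
move=> e0 f0 ef; exists (\sum_(k < N) e k + f N) => n.
have mono i j : \sum_(k < i) e k <= \sum_(k < j + i) e k.
  by elim: j => // j IH; rewrite addSn big_ord_recr /= (le_trans IH) // lerDl.
have h j : \sum_(k < j + N) e k <= \sum_(k < N) e k + f N - f (j + N)%N.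
  elim: j => [|j IH]; first by rewrite add0n addrK.
  by rewrite addSn big_ord_recr /=; have := ef (j + N)%N (leq_addl _ _); lra.
apply: (le_trans (mono n N)); rewrite addnC; apply: (le_trans (h n)).
by rewrite gerBl.
Qed.

Definition sum_unbounded u := forall K : R, exists n, K <= \sum_(k < n) u k.

Lemma sum_unbounded_scale u v c N : 0 < c -> (forall k, 0 <= u k) -> (forall k, 0 <= v k) ->
  (forall k, (N <= k)%N -> c * u k <= v k) -> sum_unbounded u -> sum_unbounded v.
Proof.
move=> c0 u0 v0 uv Su K.
have [n hn] := Su (K / c + \sum_(k < N) u k).
have h m : c * (\sum_(k < m) u k - \sum_(k < N) u k) <= \sum_(k < m) v k.
  elim: m => [|m IH].
    by rewrite !big_ord0 sub0r mulrN oppr_le0 mulr_ge0 ?sumr_ge0 // ltW.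
  have [mN|Nm] := leqP m.+1 N.
    apply: (@le_trans _ _ 0); last by rewrite sumr_ge0.
    rewrite pmulr_rle0 // subr_le0 -(subnK mN).
    elim: (N - m.+1)%N => // j IHj; rewrite addSn [leRHS]big_ord_recr /=.
    by rewrite (le_trans IHj) // lerDl.
  rewrite ltnS in Nm.
  by rewrite !big_ord_recr /=; have := uv _ Nm; move: IH; rewrite !mulrBr mulrDr; lra.
exists n; apply: le_trans (h n).
by rewrite mulrC -ler_pdivrMr // lerBrDr.
Qed.

Lemma harmonic_sum_unbounded : sum_unbounded (fun k => k.+1%:R^-1).
Proof.
move=> K; apply: contrapT => /forallNP h; apply: (@dvg_harmonic R).
apply: nondecreasing_is_cvgn.
  apply: homo_leq => // [y x z|n]; first exact: le_trans.
  by rewrite /series /= big_nat_recr //= lerDl invr_ge0.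
exists K => _ [n _ <-]; rewrite /series /= big_mkord ltW //.
by have /negP := h n; rewrite -ltNge.
Qed.

End Asymptotics.

(** * The step sizes (C / (C' + n)) ^ alpha *)

Section StepSizes.
Variables (R : realType) (gamma : nat -> R) (alpha C C' : R).
Hypothesis alpha01 : 0 < alpha <= 1.
Hypothesis C_gt0 : 0 < C.
Hypothesis C'_gt0 : 0 < C'.
Hypothesis gamma01 : forall n, 0 < gamma n.+1 < 1.
Hypothesis gammaE : \forall n \near \oo, gamma n = (C / (C' + n%:R)) `^ alpha.

Let alpha_gt0 : 0 < alpha. Proof. by case/andP: alpha01. Qed.

Let denom_gt0 (n : nat) : 0 < C' + n%:R.
Proof. by rewrite ltr_wpDr. Qed.

Lemma gammaSE : \forall n \near \oo, gamma n = (C / (C' + n%:R)) `^ alpha /\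
  gamma n.+1 = (C / (C' + n.+1%:R)) `^ alpha.
Proof.
case: gammaE => N _ h; exists N => // n /= Nn; split; apply: h => //=.
exact: leqW.
Qed.

Lemma gamma_small e : 0 < e -> \forall n \near \oo, gamma n < e.
Proof.
move=> e0; near=> n; rewrite (near gammaE n) //.
rewrite -[ltRHS]powRr1 ?ltW // -[in ltRHS](mulVf (lt0r_neq0 alpha_gt0)) powRrM.
apply: gt0_ltr_powR => //; rewrite ?nnegrE ?powR_ge0 ?divr_ge0 // ?ltW //.
set f := e `^ alpha^-1; have f0 : 0 < f by rewrite powR_gt0.
rewrite ltr_pdivrMr // mulrC -ltr_pdivrMr //.
have : C / f < n%:R.
  have : C / f < (Num.trunc (C / f)).+1%:R by exact: truncnS_gt.
  move=> /lt_le_trans; apply; rewrite ler_nat; near: n; exact: nbhs_infty_ge.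
by move=> /lt_le_trans; apply; rewrite lerDr ltW.
Unshelve. all: by end_near. Qed.

Lemma gamma_nonincreasing : \forall n \near \oo, 0 < gamma n.+1 <= gamma n.
Proof.
near=> n; have [-> ->] : gamma n = (C / (C' + n%:R)) `^ alpha /\
    gamma n.+1 = (C / (C' + n.+1%:R)) `^ alpha by near: n; exact: gammaSE.
rewrite powR_gt0 ?divr_gt0 //=; apply: ge0_ler_powR; rewrite ?nnegrE ?divr_ge0 // ?ltW //.
by rewrite ltr_pM2l // ltf_pV2 ?posrE // ltrD2l ltr_nat.
Unshelve. all: by end_near. Qed.

Lemma gamma_sum_unbounded : sum_unbounded (fun k => gamma k.+1).
Proof.
have [N _ hN] := gammaE.
have [N' hN'] : exists n : nat, C <= n%:R.
  by exists (Num.trunc C).+1; rewrite ltW //; exact: truncnS_gt.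
(* The constant comes from C' + k + 1 <= (C' + 1) (k + 1). Past [N'] the base C / (C' + k + 1) is at
   most 1, so the power [alpha] can only enlarge it. *)
apply: (@sum_unbounded_scale _ (fun k => k.+1%:R^-1) _ (C / (C' + 1)) (N + N')).
- by rewrite divr_gt0 // addr_gt0.
- by move=> k; rewrite invr_ge0.
- by move=> k; have /andP[/ltW] := gamma01 k.
- move=> k Nk; rewrite hN /=; last by rewrite leqW // (leq_trans _ Nk) // leq_addr.
  have d0 := denom_gt0 k.+1.
  apply: (@le_trans _ _ (C / (C' + k.+1%:R))).
    rewrite -mulrA -invfM ler_pM2l // lef_pV2 ?posrE // ?mulr_gt0 ?addr_gt0 //.
    by rewrite mulrDl mul1r lerD2r ler_peMr ?ler1n // ltW.
  apply: ger1_powR; last by case/andP: alpha01.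
  rewrite divr_gt0 //= ler_pdivrMr // mul1r (le_trans hN') //.
  by rewrite ler_wpDl ?ltW // ltr_nat ltnS (leq_trans _ Nk) // leq_addl.
- exact: harmonic_sum_unbounded.
Qed.

(** The increments of 1 / gamma are eventually below [c] with a uniform margin. For alpha = 1 they
    equal 1 / C, so this is C c > 1; for alpha < 1 they tend to 0 and any c > 0 will do. *)
Definition slow_growth c := exists2 delta, 0 < delta &
  \forall n \near \oo, (gamma n.+1)^-1 - (gamma n)^-1 <= c - delta.

(** Since (1 + 1 / y) ^ alpha <= 1 + 1 / y, the increment of y ^ alpha is at most y ^ (alpha - 1),
    which tends to 0. *)
Lemma slow_growth_lt1 c : alpha < 1 -> 0 < c -> slow_growth c.
Proof.
move=> a1 c0; exists (c / 2); first by rewrite divr_gt0.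
have [e e0 ec] : exists2 e, 0 < e & e = c / 2 * C `^ alpha.
  by exists (c / 2 * C `^ alpha) => //; rewrite mulr_gt0 ?divr_gt0 ?powR_gt0.
near=> n; have [-> ->] : gamma n = (C / (C' + n%:R)) `^ alpha /\
    gamma n.+1 = (C / (C' + n.+1%:R)) `^ alpha by near: n; exact: gammaSE.
have d0 := denom_gt0 n; have d1 := denom_gt0 n.+1.
have pE (m : R) : 0 < m -> ((C / m) `^ alpha)^-1 = m `^ alpha / C `^ alpha.
  move=> m0; rewrite powRM ?invr_ge0 ?ltW // invfM mulrC; congr (_ * _).
  by rewrite -powR_inv1 ?ltW // -powRrM mulN1r powRN invrK.
rewrite !pE // -mulrBl ler_pdivrMr ?powR_gt0 // [c - _](_ : _ = c / 2); last by field.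
rewrite -ec; set y := C' + n%:R in d0 *.
have -> : C' + n.+1%:R = y + 1 by rewrite /y -natr1 addrA.
have y1 : 1 <= 1 + y^-1 by rewrite lerDl invr_ge0 ltW.
have -> : y + 1 = y * (1 + y^-1) by rewrite mulrDr mulr1 divff // gt_eqF.
rewrite powRM ?(ltW d0) //; last by lra.
have h : (1 + y^-1) `^ alpha <= 1 + y^-1 by apply: ler1_powR => //; rewrite ltW.
have ya : 0 < y `^ alpha by rewrite powR_gt0.
apply: (@le_trans _ _ (y `^ alpha * (1 + y^-1) - y `^ alpha)).
  by rewrite lerD2r ler_pM2l.
rewrite mulrDr mulr1 addrC addKr.
have yE : y `^ alpha / y = (y `^ (1 - alpha))^-1.
  rewrite -powR_inv1 ?ltW // -powRD; last by rewrite (gt_eqF d0) implybT.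
  by rewrite -powRN opprB.
rewrite yE invf_ple ?posrE ?powR_gt0 //.
have a1' : 0 < 1 - alpha by rewrite subr_gt0.
rewrite -[leLHS]powRr1; last by rewrite invr_ge0 ltW.
rewrite -[in leLHS](mulVf (lt0r_neq0 a1')) powRrM.
apply: ge0_ler_powR; rewrite ?nnegrE ?powR_ge0 ?ltW //.
rewrite /y; set K := _ `^ _; have : K < (Num.trunc K).+1%:R by exact: truncnS_gt.
move=> /lt_le_trans; apply; apply: ler_wpDl; first exact: ltW.
by rewrite ler_nat; near: n; exact: nbhs_infty_ge.
Unshelve. all: by end_near. Qed.

Hypothesis alpha1 : alpha = 1.

Lemma gamma1E : \forall n \near \oo, gamma n = C / (C' + n%:R) /\
  gamma n.+1 = C / (C' + n.+1%:R).
Proof.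
apply: filterS gammaSE => n [-> ->].
by rewrite alpha1 !powRr1 // divr_ge0 // ltW.
Qed.

Lemma gamma1V : \forall n \near \oo, (gamma n.+1)^-1 - (gamma n)^-1 = C^-1.
Proof.
apply: filterS gamma1E => n [-> ->]; rewrite -natr1.
have := denom_gt0 n; have := denom_gt0 n.+1; rewrite -natr1 => d0 d1.
rewrite !invfM !invrK; field; by rewrite gt_eqF.
Qed.

Lemma slow_growth_eq1 c : 1 < C * c -> slow_growth c.
Proof.
move=> Cc; exists (c - C^-1).
  by rewrite subr_gt0 -[C^-1]mul1r ltr_pdivrMr // mulrC.
by apply: filterS gamma1V => n ->; rewrite opprB addrC subrK.
Qed.

Lemma gamma_sqr_bounded : exists M, forall n, \sum_(k < n) gamma k.+1 ^+ 2 <= M.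
Proof.
have [N _ hN] := gamma1E.
apply: (@sum_telescope_bounded R (fun k => gamma k.+1 ^+ 2)
  (fun k => C ^+ 2 / (C' + k%:R)) N) => k.
- exact: sqr_ge0.
- by rewrite divr_ge0 ?sqr_ge0 // ltW.
- move=> /hN [_ ->]; have := denom_gt0 k; have := denom_gt0 k.+1.
  rewrite -natr1; set m := k%:R => d1 d0.
  rewrite -subr_ge0.
  rewrite [leRHS](_ : _ = C ^+ 2 * ((C' + (m + 1)) ^+ 2 * (C' + m))^-1).
    by rewrite mulr_ge0 ?sqr_ge0 // invr_ge0 mulr_ge0 ?sqr_ge0 // ltW.
  by field; rewrite !gt_eqF.
Qed.

Lemma gamma_prod_cvg_to_pos c : 0 < c <= 1 ->
  cvg_to_pos (fun n => n%:R `^ (C * c) * \prod_(k < n) (1 - c * gamma k.+1)).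
Proof.
move=> /andP[c0 c1]; apply: (@powR_prod_cvg_to_pos R (C * c) C' (fun k => c * gamma k.+1)) => //.
    exact: mulr_gt0.
  move=> k; have /andP[g0 g1] := gamma01 k.
  by rewrite mulr_gt0 //= (le_lt_trans _ g1) // ler_piMl // ltW.
by apply: filterS gamma1E => n [_ ->]; rewrite mulrA [c * C]mulrC.
Qed.

(** The right-hand side equals [eta * (gamma n * gamma n.+1)]. The inequality says that gamma_n /
    prod (1 - c gamma_k) decreases, at a definite rate. *)
Lemma gamma1_decr c (eta := C^-1 - c) : C * c < 1 -> 0 < eta /\
  \forall n \near \oo, eta * gamma n.+1 ^+ 2 <= gamma n * (1 - c * gamma n.+1) - gamma n.+1.
Proof.
move=> Cc; have eta0 : 0 < eta.
  by rewrite subr_gt0 -[C^-1]mul1r ltr_pdivlMr // mulrC.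
split => //; near=> n.
have gV : (gamma n.+1)^-1 - (gamma n)^-1 = C^-1 by near: n; exact: gamma1V.
have /andP[g0 gg] : 0 < gamma n.+1 <= gamma n by near: n; exact: gamma_nonincreasing.
have g0' := lt_le_trans g0 gg.
have -> : gamma n * (1 - c * gamma n.+1) - gamma n.+1 = eta * (gamma n * gamma n.+1).
  by rewrite /eta -gV; field; rewrite !gt_eqF.
by rewrite expr2 ler_pM2l // ler_pM2r.
Unshelve. all: by end_near. Qed.

Lemma gamma1_lower : \forall n \near \oo, C / 2 <= n%:R * gamma n.+1.
Proof.
near=> n; have [_ ->] : gamma n = C / (C' + n%:R) /\ gamma n.+1 = C / (C' + n.+1%:R).
  by near: n; exact: gamma1E.
have Cn : C' + 1 <= n%:R.
  have : C' + 1 < (Num.trunc (C' + 1)).+1%:R by exact: truncnS_gt.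
  move=> /ltW /le_trans; apply; rewrite ler_nat; near: n; exact: nbhs_infty_ge.
have d0 := denom_gt0 n.+1.
rewrite mulrA ler_pdivlMr // -natr1.
rewrite [leLHS](_ : _ = C * ((C' + (n%:R + 1)) / 2)); last by ring.
by rewrite [leRHS]mulrC ler_pM2l // ler_pdivrMr //; lra.
Unshelve. all: by end_near. Qed.

Lemma gamma1_upper : \forall n \near \oo, n%:R * gamma n <= C.
Proof.
near=> n; have [-> _] : gamma n = C / (C' + n%:R) /\ gamma n.+1 = C / (C' + n.+1%:R).
  by near: n; exact: gamma1E.
have d0 := denom_gt0 n; rewrite mulrA ler_pdivrMr // mulrC ler_pM2l // lerDr ltW //.
Unshelve. all: by end_near. Qed.

(** As 1 / gamma grows linearly, the exponential decays geometrically, whereas the product has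
    factors tending to 1. *)
Lemma expR_lt_prod kappa e N : 0 < kappa -> 0 < e ->
  exists2 m, (N <= m)%N & expR (- (kappa / gamma m)) < e * \prod_(k < m) (1 - gamma k.+1).
Proof.
move=> k0 e0.
have p0 n : 0 < \prod_(k < n) (1 - gamma k.+1).
  by apply: prodr_gt0 => k _; have /andP[g0 g1] := gamma01 k; rewrite subr_gt0.
(* One step multiplies the exponential by rho^2: one factor [rho] beats [1 - gamma], the other makes
   the ratio decay. *)
pose rho := expR (- (kappa / (2 * C))).
have kC : 0 < kappa / (2 * C) by rewrite divr_gt0 // mulr_gt0.
have rho01 : 0 < rho < 1 by rewrite expR_gt0 expR_lt1 oppr_lt0.
have [N1 h1] : exists N1, forall n, (N1 <= n)%N ->
    (gamma n.+1)^-1 - (gamma n)^-1 = C^-1 /\ gamma n.+1 < 1 - rho.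
  have r0 : 0 < 1 - rho by case/andP: rho01; rewrite subr_gt0.
  have [a _ ha] := gamma1V; have [b _ hb] := gamma_small r0.
  exists (a + b)%N => n abn; split; first by apply: ha; rewrite /= (leq_trans _ abn) // leq_addr.
  by apply: hb => /=; rewrite leqW // (leq_trans _ abn) // leq_addl.
pose u n := expR (- (kappa / gamma n)) / \prod_(k < n) (1 - gamma k.+1).
have uS n : (N1 <= n)%N -> u n.+1 <= rho * u n.
  move=> /h1[gV gr]; have gV' : (gamma n.+1)^-1 = (gamma n)^-1 + C^-1 by rewrite -gV addrC subrK.
  have h : - (kappa / gamma n.+1) = - (kappa / gamma n) + (- (kappa / (2 * C)) + - (kappa / (2 * C))).
    by rewrite gV'; move: (gamma n)^-1 => y; field; rewrite gt_eqF.
  have /andP[rho0 rho1] := rho01.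
  have g1 : 0 < 1 - gamma n.+1 by rewrite subr_gt0 (lt_trans gr) // gtrBl.
  rewrite /u h !expRD -/rho big_ord_recr /= invfM.
  set E := expR _; set p := (\prod_(k < n) _)^-1.
  rewrite (_ : _ * _ = rho * (E * p) * (rho / (1 - gamma n.+1))); last by ring.
  rewrite ler_piMr ?mulr_ge0 ?(ltW rho0) ?expR_ge0 ?invr_ge0 ?(ltW (p0 _)) //.
  by rewrite ler_pdivrMr // mul1r lerBrDr -lerBrDl ltW.
have u0 n : 0 <= u n by rewrite divr_ge0 ?expR_ge0 // ltW.
have uN j : u (j + (N1 + N))%N <= rho ^+ j * u (N1 + N)%N.
  elim: j => [|j IH]; first by rewrite mul1r.
  rewrite addSn exprS -mulrA; apply: le_trans (uS _ _) _.
    by rewrite addnCA leq_addr.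
  by rewrite ler_wpM2l // ltW //; case/andP: rho01.
have rho_norm : `|rho| < 1 by case/andP: rho01 => r0 r1; rewrite gtr0_norm.
have d0 : 0 < e / (u (N1 + N)%N + 1) by rewrite divr_gt0 // ltr_wpDl.
have [j _ hj] := cvgr_lt _ (cvg_expr rho_norm) _ d0.
exists (j + (N1 + N))%N; first by rewrite addnA leq_addl.
rewrite -ltr_pdivrMr //; apply: le_lt_trans (uN j) _.
have := hj j (leqnn j); rewrite /=.
rewrite ltr_pdivlMr ?ltr_wpDl // => h; apply: le_lt_trans h.
by rewrite ler_wpM2l ?lerDl // exprn_ge0 // ltW //; case/andP: rho01.
Qed.

(** The ratio prod / gamma is multiplied at each step by at most 1 - (1 - c) gamma <= exp (- (1 - c)
    gamma), and the sum of the gamma's diverges. *)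
Lemma prod_lt_scaled_gamma c kappa N : slow_growth c -> 0 < c < 1 -> 0 < kappa ->
  exists2 m, (N <= m)%N & \prod_(k < m) (1 - gamma k.+1) < kappa * gamma m.
Proof.
move=> [delta d0 [N0 _ hN]] /andP[c0 c1] k0.
have p0 n : 0 < \prod_(k < n) (1 - gamma k.+1).
  by apply: prodr_gt0 => k _; have /andP[g0 g1] := gamma01 k; rewrite subr_gt0.
pose A n := \sum_(k < n) gamma k.+1.
pose r n := (\prod_(k < n.+1) (1 - gamma k.+1)) / gamma n.+1.
have r0 n : 0 < r n by have /andP[g0 _] := gamma01 n; rewrite divr_gt0.
pose t n := r n * expR ((1 - c) * A n).
have tS n : (N0 <= n)%N -> t n.+1 <= t n.
  move=> Nn; have := hN n.+1 (leqW Nn).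
  have /andP[g0 g1] := gamma01 n; have /andP[h0 h1] := gamma01 n.+1.
  have AS : expR ((1 - c) * A n.+1) = expR ((1 - c) * A n) * expR ((1 - c) * gamma n.+1).
    by rewrite /A big_ord_recr /= mulrDr expRD.
  rewrite /t AS /r [X in X / _ * _ <= _]big_ord_recr /=.
  set p := \prod_(k < _) _; set g := gamma n.+1 in g0 g1 *; set h := gamma n.+2 in h0 h1 *.
  set E := expR _ => hg; have pp : 0 < p by exact: p0.
  have E0 : 0 < E by exact: expR_gt0.
  rewrite (_ : p * (1 - h) / h * (E * expR ((1 - c) * g)) = p * E * ((h^-1 - 1) * expR ((1 - c) * g))); last first.
    by field; rewrite gt_eqF.
  rewrite (_ : p / g * E = p * E * g^-1); last by ring.
  rewrite ler_pM2l ?mulr_gt0 //.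
  have cg : 0 <= (1 - c) * g by rewrite mulr_ge0 ?(ltW g0) // subr_ge0 ltW.
  have e1 : expR (- ((1 - c) * g)) * g^-1 >= h^-1 - 1.
    have := expR_ge1Dx (- ((1 - c) * g)) => e2.
    have gV : 0 < g^-1 by rewrite invr_gt0.
    have gg : g * g^-1 = 1 by rewrite divff // gt_eqF.
    have : (1 - (1 - c) * g) * g^-1 <= expR (- ((1 - c) * g)) * g^-1 by rewrite ler_pM2r.
    rewrite mulrBl mul1r -mulrA gg mulr1; move: hg d0; lra.
  rewrite -ler_pdivlMr ?expR_gt0 // -expRN mulrC //.
have tN j : t (j + N0)%N <= t N0.
  elim: j => // j IH; rewrite addSn; apply: le_trans IH; apply: tS; exact: leq_addl.
have c1' : 0 < 1 - c by rewrite subr_gt0.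
have Amono i j : A i <= A (j + i)%N.
  elim: j => // j IH; rewrite addSn /A big_ord_recr /= (le_trans IH) // lerDl.
  by have /andP[/ltW] := gamma01 (j + i)%N.
(* The threshold serves twice: [A n] exceeds [A (N0 + N)], which forces n to be large, and it makes
   [kappa * expR ((1 - c) * A n)] exceed [t N0]. *)
have [n hn] := gamma_sum_unbounded (`|t N0 / kappa / (1 - c)| + `|A (N0 + N)%N| + 1).
rewrite -/(A n) in hn.
have nN : (N0 + N <= n)%N.
  rewrite leqNgt; apply/negP => lt; have := Amono n (N0 + N - n)%N.
  rewrite subnK ?(ltnW lt) // => h.
  have := ler_norm (A (N0 + N)%N); have := normr_ge0 (t N0 / kappa / (1 - c)); lra.
exists n.+1; first by rewrite leqW // (leq_trans _ nN) // leq_addl.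
have /andP[g0 _] := gamma01 n.
rewrite -ltr_pdivrMr // -/(r n).
have := tN (n - N0)%N; rewrite subnK ?(leq_trans (leq_addr _ _) nN) // => tn.
have : t n < kappa * expR ((1 - c) * A n).
  apply: (le_lt_trans tn); rewrite mulrC -ltr_pdivrMr //.
  apply: lt_le_trans (expR_ge1Dx _).
  have : t N0 / kappa / (1 - c) <= A n.
    have := ler_norm (t N0 / kappa / (1 - c)); have := normr_ge0 (A (N0 + N)%N); lra.
  rewrite ler_pdivrMr // mulrC; lra.
by rewrite /t ltr_pM2r // expR_gt0.
Qed.

End StepSizes.

(** * Supermartingales of histories *)

Lemma le_measure_bigcup (R : realType) d (T : measurableType d)
    (P : probability T R) (F : nat -> set T) (c : \bar R) :
  (forall n, measurable (F n)) -> {homo F : n m / (n <= m)%N >-> n `<=` m} ->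
  (forall n, (P (F n) <= c)%E) -> (P (\bigcup_n F n) <= c)%E.
Proof.
move=> mF hF le_c.
have mU : measurable (\bigcup_n F n) by exact: bigcupT_measurable.
have h := @nondecreasing_cvg_mu _ _ _ P F mF mU.
have {}h : P \o F @ \oo --> P (\bigcup_n F n).
  by apply: h => n m nm; apply/subsetPset; exact: hF.
rewrite -(cvg_lim _ h) //; apply: lime_le; first by apply/cvg_ex; exists (P (\bigcup_n F n)).
by near=> n; exact: le_c.
Unshelve. all: by end_near. Qed.

Lemma le_of_forall_divr (R : realFieldType) (p c : R) : 0 <= c ->
  (forall e, 0 < e < 1 -> p <= c / e) -> p <= c.
Proof.
move=> c0 h; rewrite leNgt; apply/negP => cp.
have p0 : 0 < p by exact: le_lt_trans cp.
have p2 : 0 < 2 * p by lra.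
have e01 : 0 < (c + p) / (2 * p) < 1.
  by rewrite divr_gt0 //= ?ltr_pdivrMr //; lra.
have := h _ e01; rewrite ler_pdivlMr; last by case/andP: e01.
rewrite [X in X <= _](_ : _ = (c + p) / 2); last by field; rewrite gt_eqF.
lra.
Qed.

(** On a grid of mesh 1 / (k + 1) no cell is crossed infinitely often, so [u] is eventually confined
    to two adjacent cells. The last hypothesis excludes divergence to infinity. *)
Lemma cvgn_no_crossing (R : realType) (u : nat -> R) :
  (forall n, 0 <= u n) ->
  (forall k i, ~ ((forall n, exists2 m, (n <= m)%N & u m <= i%:R / k.+1%:R) /\
     (forall n, exists2 m, (n <= m)%N & i.+1%:R / k.+1%:R <= u m))) ->
  (exists K : nat, forall n, exists2 m, (n <= m)%N & u m < K%:R) ->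
  cvgn u.
Proof.
move=> u0 nocross [K uK].
have ev i k : (forall n, exists2 m, (n <= m)%N & u m <= i%:R / k.+1%:R) ->
    exists n, forall m, (n <= m)%N -> u m < i.+1%:R / k.+1%:R.
  move=> io; apply: contrapT => /forallNP h; apply: (nocross k i); split=> // n.
  by have /existsNP[m /not_implyP[nm /negP]] := h n; rewrite -leNgt => ?; exists m.
have [n0 un0] : exists n, forall m, (n <= m)%N -> u m < K.+1%:R.
  have [|n hn] := ev K 0%N.
    by move=> n; have [m nm um] := uK n; exists m => //; rewrite divr1 ltW.
  by exists n => m /hn; rewrite divr1.
apply/cauchy_cvgP; apply: cauchy_exP => e e0.
pose k := (Num.trunc e^-1).
have ke : k.+1%:R^-1 < e.
  by rewrite invf_plt ?posrE // /k; exact: truncnS_gt.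
(* For the least [i] with [S i], minimality makes [u] reach i / (k + 1) infinitely often, so
   [nocross] keeps it eventually above (i - 1) / (k + 1). *)
pose S i := `[< exists n, forall m, (n <= m)%N -> u m < i.+1%:R / k.+1%:R >] : bool.
have exS : exists i, S i.
  exists (K.+1 * k.+1)%N; apply/asboolP; exists n0 => m /un0 h.
  apply: (lt_le_trans h); rewrite ler_pdivlMr ?ltr0n // -natrM ler_nat; exact: leqnSn.
have [i /asboolP[n1 hn1] imin] := ex_minnP exS.
exists (i%:R / k.+1%:R).
have [n2 hn2] : exists n, forall m, (n <= m)%N -> (i%:R - 1) / k.+1%:R < u m.
  case: i imin {hn1} => [|i] imin.
    exists 0%N => m _; apply: lt_le_trans (u0 m).
    by rewrite sub0r mulN1r oppr_lt0 invr_gt0 ltr0n.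
  have nSi : ~ exists n, forall m, (n <= m)%N -> u m < i.+1%:R / k.+1%:R.
    by move=> /asboolP /imin; rewrite ltnn.
  apply: contrapT => h; apply: (nocross k i); split=> n.
    apply: contrapT => h1; apply: h; exists n => m nm.
    rewrite -natr1 addrK ltNge; apply/negP => umi; apply: h1; by exists m.
  apply: contrapT => h1; apply: nSi; exists n => m nm.
  by rewrite ltNge; apply/negP => umi; apply: h1; exists m.
suff : \forall m \near \oo, ball (i%:R / k.+1%:R : R) e (u m) by [].
near=> m; rewrite /ball /= ltr_distlC; apply/andP; split.
  apply: (@le_lt_trans _ _ ((i%:R - 1) / k.+1%:R)); last by apply: hn2; near: m; exact: nbhs_infty_ge.
  by rewrite mulrBl mul1r lerD2l lerN2 ltW.
apply: (@lt_le_trans _ _ (i.+1%:R / k.+1%:R)); first by apply: hn1; near: m; exact: nbhs_infty_ge.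
by rewrite -natr1 mulrDl mul1r lerD2l ltW.
Unshelve. all: by end_near. Qed.

(* Doob's upcrossing argument: [gain] is the gain of the strategy that holds the
   asset [Z] from each passage below [a] to the next passage above [b]. *)
Section Crossings.
Variables (R : realType) (gamma : nat -> R) (q : bool -> R) (x : R).
Variables (Z : seq (bool * bool) -> R) (a b : R).

Fixpoint holding (w : seq (bool * bool)) : bool :=
  if w is l :: w' then if holding w' then Z w < b else Z w <= a
  else Z [::] <= a.

Fixpoint crossings (w : seq (bool * bool)) : nat :=
  if w is l :: w' then (crossings w' + (holding w' && (b <= Z w)%R))%N else 0%N.

Fixpoint gain (w : seq (bool * bool)) : R :=
  if w is l :: w' then gain w' + (holding w')%:R * (Z w - Z w') else 0.

Hypothesis ab : a < b.
Hypothesis Z0 : forall w, 0 <= Z w.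

(** A completed crossing earns at least b - a. An open position was bought at a price at most a,
    hence the term [Z w - a], which is at least -a. *)
Lemma gain_ge w :
  (b - a) * (crossings w)%:R + (holding w)%:R * (Z w - a) <= gain w.
Proof.
elim: w => [|l w IH] /=.
  by case: (leP (Z [::]) a) => ? /=; rewrite mulr0 add0r ?mul1r ?mul0r // subr_le0.
case hw: (holding w) IH => /= IH; last first.
  rewrite addn0 mul0r addr0; move: IH; rewrite mul0r addr0 => IH.
  apply: le_trans IH; rewrite gerDl; case: (leP (Z _) a) => ? /=; rewrite ?mul1r ?mul0r //.
  by rewrite subr_le0.
move: IH; rewrite !mul1r => IH.
case: (ltP (Z _) b) => h /=; first by rewrite addn0 mul1r; lra.
rewrite addn1 -natr1 mulrDr mulr1 mul0r addr0.
by have := h; lra.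
Qed.

Hypothesis x01 : 0 <= x <= 1.
Hypothesis gamma01 : forall n, 0 < gamma n.+1 < 1.
Hypothesis q01 : forall s, 0 < q s < 1.
Hypothesis superZ : forall w, step gamma q x Z w <= Z w.
Hypothesis a0 : 0 <= a.

Lemma gain_addr_ge w : (b - a) * (crossings w)%:R <= gain w + a.
Proof.
have := gain_ge w; have := Z0 w.
case: (holding w) => /=; rewrite ?mul1r ?mul0r => h1 h2.
  by lra.
by move: h2; rewrite addr0 => /le_trans; apply; rewrite lerDl.
Qed.

Lemma step_gain w : step gamma q x (fun v => gain v + a) w <= gain w + a.
Proof.
have -> : step gamma q x (fun v => gain v + a) w =
    (gain w + a - (holding w)%:R * Z w) + (holding w)%:R * step gamma q x Z w.
  rewrite -(step_cst gamma q x (gain w + a - (holding w)%:R * Z w) w).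
  rewrite -stepZ -stepD; apply: eq_step => l /=; ring.
have := superZ w; case: (holding w) => /=; rewrite ?mul1r ?mul0r; lra.
Qed.

Variables (v : nat -> seq (bool * bool)).
Hypothesis vS : forall n, exists l, v n.+1 = l :: v n.

Lemma crossings_homo n m : (n <= m)%N -> (crossings (v n) <= crossings (v m))%N.
Proof.
move=> /subnK <-; elim: (m - n)%N => // k IH; rewrite addSn.
by have [l ->] := vS (k + n); rewrite /= (leq_trans IH) // leq_addr.
Qed.

Lemma crossings_unbounded :
  (forall n, exists2 m, (n <= m)%N & Z (v m) <= a) ->
  (forall n, exists2 m, (n <= m)%N & b <= Z (v m)) ->
  forall K, exists n, (K <= crossings (v n))%N.
Proof.
move=> lo hi; elim=> [|K [n Kn]]; first by exists 0%N.
have [i ni Zi] := lo n.+1; have [j ij Zj] := hi i.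
have holdi : holding (v i).
  case: i ni Zi {ij} => // i _ Zi; have [l vl] := vS i; rewrite vl /= -vl Zi.
  by case: ifP => // _; exact: le_lt_trans ab.
have ij' : (i < j)%N.
  rewrite ltn_neqAle ij andbT; apply/eqP => ij'; move: Zj Zi; rewrite -ij'.
  by move=> /le_trans/[apply]; rewrite leNgt ab.
have nholdj : ~~ holding (v j).
  case: j Zj {ij} ij' => // j Zj _; have [l vl] := vS j; rewrite vl /= -vl.
  by case: ifP => _; rewrite -?leNgt -?ltNge //; exact: lt_le_trans ab Zj.
exists j; apply: (leq_ltn_trans Kn); apply: (leq_ltn_trans (crossings_homo (ltnW ni))).
(* If no crossing were counted between i and j, the position open at i would still be open at j. *)
rewrite ltnNge; apply: contra nholdj; move: ij => /subnK <-.
elim: (j - i)%N => // k IH; rewrite addSn.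
have [l vl] := vS (k + i); rewrite vl /= -vl => h.
have h' := leq_trans (leq_addr _ _) h.
rewrite (IH h') in h *; rewrite /= in h; rewrite ltNge; apply/negP => bZ.
rewrite bZ addn1 in h; have := crossings_homo (leq_addl k i).
by move=> /(leq_trans h); rewrite ltnn.
Qed.

End Crossings.

(** * Doob convergence and a zero-one law along the random history *)

Section Process.
Context (R : realType) d (T : measurableType d) (P : probability T R).
Variables (gamma : nat -> R) (q : bool -> R) (x : R).
Variable (word : nat -> T -> seq (bool * bool)).
Hypothesis x01 : 0 <= x <= 1.
Hypothesis gamma01 : forall n, 0 < gamma n.+1 < 1.
Hypothesis q01 : forall s, 0 < q s < 1.
Hypothesis size_word : forall n t, size (word n t) = n.
Hypothesis wordS : forall n t, exists l, word n.+1 t = l :: word n t.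
Hypothesis measurable_word : forall n (Q : set (seq (bool * bool))),
  measurable [set t | Q (word n t)].
(** The Markov property: conditionally on the history [w], expectations [k] letters later are
    computed by iterating [step]. *)
Hypothesis word_law : forall w k (Q : set (seq (bool * bool))),
  P ([set t | word (size w) t = w] `&` [set t | Q (word (size w + k) t)]) =
  (weight gamma q x w *
    iter k (step gamma q x) (fun v => (`[< Q v >] : bool)%:R) w)%:E.

Local Notation cylinder w := [set t | word (size w) t = w].
Local Notation weight := (weight gamma q x).
Local Notation step := (step gamma q x).

Lemma measurable_prefix w : measurable (cylinder w).
Proof. exact: measurable_word (size w) [set w]. Qed.

Lemma weight_ge0 w : 0 <= weight w.
Proof.
elim: w => //= l w IH; rewrite mulr_ge0 // mulr_ge0 //.
  by have /andP[] := state01 x01 gamma01 l.1 w.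
by have /andP[? ?] := q01 l.1; case: ifP => _; lra.
Qed.

Lemma cylinder_markov (f : seq (bool * bool) -> R) w k c : (forall v, 0 <= f v) ->
  (forall v, (size w <= size v)%N -> step f v <= f v) -> 0 < c ->
  (P (cylinder w `&` [set t | (c <= f (word (size w + k) t))%R]) <=
   (weight w * (f w / c))%:E)%E.
Proof.
move=> f0 fs c0; have -> := word_law w k [set v | c <= f v].
rewrite lee_fin ler_wpM2l ?weight_ge0 //.
apply: (@le_trans _ _ (iter k step (fun v => c^-1 * f v) w)).
  apply: ler_iter_step => // v _; case: asboolP => /= h.
    by rewrite mulrC ler_pdivlMr // mul1r.
  by rewrite mulr_ge0 // invr_ge0 ltW.
rewrite iter_stepZ // mulrC ler_pM2r ?invr_gt0 //.
exact: iter_step_super x01 gamma01 q01 (size w) _ _ _ fs (leqnn _).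
Qed.

(** The events where [f] stays above [c] from time n on increase with n, and each is contained in
    the event at the single time n; Markov's inequality at a fixed time therefore suffices. *)
Lemma cylinder_eventually_ge (f : seq (bool * bool) -> R) w c : (forall v, 0 <= f v) ->
  (forall v, (size w <= size v)%N -> step f v <= f v) -> 0 < c ->
  (P (cylinder w `&` [set t | exists n, forall k, (n <= k)%N -> (c <= f (word k t))%R]) <=
   (weight w * (f w / c))%:E)%E.
Proof.
move=> f0 fs c0.
rewrite (_ : _ `&` _ = \bigcup_n (cylinder w `&`
    \bigcap_(k in [set k | (n <= k)%N]) [set t | c <= f (word (size w + k) t)])); last first.
  apply/seteqP; split => t /=.
    move=> [wt [n hn]]; exists n => //; split=> // k /= nk; apply: hn.
    by rewrite (leq_trans nk) // leq_addl.
  move=> [n _ [wt hn]]; split=> //; exists (size w + n)%N => k wk.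
  have -> : k = (size w + (k - size w))%N by rewrite subnKC // (leq_trans _ wk) // leq_addr.
  by apply: hn; rewrite /= leq_subRL // (leq_trans _ wk) // leq_addr.
have mF n : measurable (\bigcap_(k in [set k | (n <= k)%N]) [set t | c <= f (word (size w + k) t)]).
  apply: bigcap_measurable; first by exists n; rewrite /=.
  by move=> k _; exact: (measurable_word (size w + k) [set v | c <= f v]).
apply: le_measure_bigcup => [n|n m nm|n].
- by apply: measurableI => //; exact: measurable_prefix.
- move=> t [wt ht]; split=> // k mk; apply: ht; exact: leq_trans mk.
- apply: le_trans (cylinder_markov n f0 fs c0); apply: le_measure; rewrite ?inE.
  + by apply: measurableI => //; exact: measurable_prefix.
  + apply: measurableI => //; first exact: measurable_prefix.
    exact: (measurable_word (size w + n) [set v | c <= f v]).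
  + by apply: setIS => t; apply => /=.
Qed.

(** The form in which supermartingales bound conditional probabilities: P (G | w) <= f w as soon as
    the lower limit of [f] is at least 1 on [G]. *)
Lemma cylinder_limit (f : seq (bool * bool) -> R) w (G : set T) : (forall v, 0 <= f v) ->
  (forall v, (size w <= size v)%N -> step f v <= f v) -> measurable G ->
  (forall t, G t -> forall c, c < 1 -> exists n, forall k, (n <= k)%N -> c <= f (word k t)) ->
  (P (cylinder w `&` G) <= (weight w * f w)%:E)%E.
Proof.
move=> f0 fs mG hG.
have mwG : measurable (cylinder w `&` G) by apply: measurableI => //; exact: measurable_prefix.
have fin : P (cylinder w `&` G) \is a fin_num by exact: fin_num_measure.
rewrite -(fineK fin) lee_fin; apply: le_of_forall_divr => [|e /andP[e0 e1]].
  by rewrite mulr_ge0 // weight_ge0.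
rewrite -lee_fin fineK // -mulrA; apply: le_trans (cylinder_eventually_ge f0 fs e0).
apply: le_measure; rewrite ?inE //; last first.
  by move=> t [wt Gt]; split => //; exact: hG.
apply: measurableI; first exact: measurable_prefix.
rewrite (_ : [set t | _] = \bigcup_n \bigcap_(k in [set k | (n <= k)%N]) [set t | e <= f (word k t)]).
  apply: bigcup_measurable => n _; apply: bigcap_measurable; [by exists n; rewrite /=|move=> k _].
  exact: (measurable_word k [set v | e <= f v]).
by apply/seteqP; split => t /= [n]; [move=> h; exists n|move=> _ h; exists n].
Qed.

Lemma ae_le0 (S : nat -> set T) (c : R) : (forall i, measurable (S i)) ->
  (forall i, (P (S i) <= (c / i.+1%:R)%:E)%E) ->
  {ae P, forall t, exists i, ~ S i t}.
Proof.
move=> mS leS; exists (\bigcap_i S i); split.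
- exact: bigcapT_measurable.
- apply/eqP; rewrite eq_le measure_ge0 andbT.
  have mI : measurable (\bigcap_i S i) by exact: bigcapT_measurable.
  have fin : P (\bigcap_i S i) \is a fin_num by exact: fin_num_measure.
  have hi i : fine (P (\bigcap_i S i)) <= c / i.+1%:R.
    rewrite -lee_fin fineK //; apply: le_trans (leS i); apply: le_measure; rewrite ?inE //.
    by apply: bigcap_inf.
  rewrite -(fineK fin) lee_fin; apply/ler_addgt0Pr => e e0; rewrite add0r.
  have := hi (Num.trunc (c / e)); move=> /le_trans; apply.
  rewrite ler_pdivrMr ?ltr0n // mulrC -ler_pdivrMr // ltW //.
  exact: truncnS_gt.
- move=> t /forallNP h i _; apply: contrapT; exact: h.
Qed.

Lemma cylinder_nil : cylinder ([::] : seq (bool * bool)) = setT.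
Proof.
apply/seteqP; split => t //= _.
by have := size_word 0 t; case: (word 0 t).
Qed.

Lemma supermartingale_cvg (Z : seq (bool * bool) -> R) : (forall v, 0 <= Z v) ->
  (forall v, step Z v <= Z v) -> {ae P, forall t, cvgn (fun n => Z (word n t))}.
Proof.
move=> Z0 Zs.
have nocross : {ae P, forall t, forall k i,
    ~ ((forall n, exists2 m, (n <= m)%N & Z (word m t) <= i%:R / k.+1%:R) /\
    (forall n, exists2 m, (n <= m)%N & i.+1%:R / k.+1%:R <= Z (word m t)))}.
  apply: ae_foralln => k; apply: ae_foralln => i.
  set a := i%:R / _; set b := i.+1%:R / _.
  have a0 : 0 <= a by rewrite divr_ge0.
  have ab : a < b by rewrite ltr_pM2r ?invr_gt0 ?ltr0n // ltr_nat.
  (* Adding [a] makes the gain nonnegative. It starts at [a], so Markov's inequality from the empty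
     history bounds the probability of K + 1 crossings by a / ((b - a) (K + 1)). *)
  pose f w := gain Z a b w + a.
  have fge w : (b - a) * (crossings Z a b w)%:R <= f w by exact: gain_addr_ge.
  have f0 w : 0 <= f w by apply: le_trans (fge w); rewrite mulr_ge0 // subr_ge0 ltW.
  have fs v : step f v <= f v by exact: step_gain.
  pose S K := \bigcup_n [set t | (K.+1 <= crossings Z a b (word n t))%N].
  have mS K : measurable (S K).
    apply: bigcupT_measurable => n.
    exact: (measurable_word n [set v | (K.+1 <= crossings Z a b v)%N]).
  have leS K : (P (S K) <= (a / (b - a) / K.+1%:R)%:E)%E.
    apply: le_measure_bigcup => [n|n m nm t|n].
    - exact: (measurable_word n [set v | (K.+1 <= crossings Z a b v)%N]).
    - by move=> /= /leq_trans; apply; exact: (crossings_homo _ _ _ (fun n => wordS n t)).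
    - have cK : 0 < (b - a) * K.+1%:R by rewrite mulr_gt0 ?subr_gt0.
      have := @cylinder_markov f [::] n _ f0 (fun v _ => fs v) cK.
      rewrite cylinder_nil setTI add0n /= mul1r {2}/f /= add0r.
      rewrite -mulrA -invfM; apply: le_trans; apply: le_measure; rewrite ?inE.
      + exact: (measurable_word n [set v | (K.+1 <= crossings Z a b v)%N]).
      + exact: (measurable_word n [set v | (b - a) * K.+1%:R <= f v]).
      + move=> t /= Kt; apply: le_trans (fge _); rewrite ler_pM2l ?subr_gt0 //.
        by rewrite ler_nat.
  apply: filterS (ae_le0 mS leS) => t [K nK] [lo hi].
  apply: nK; have [n Kn] := crossings_unbounded ab (fun n => wordS n t) lo hi K.+1.
  by exists n.
(* Markov's inequality again, to exclude divergence to infinity. *)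
have fin : {ae P, forall t, exists K, ~ exists n, forall k, (n <= k)%N -> K.+1%:R <= Z (word k t)}.
  apply: (@ae_le0 (fun K => [set t | exists n, forall k, (n <= k)%N -> K.+1%:R <= Z (word k t)]) (Z [::])) => K.
    rewrite (_ : [set t | _] = \bigcup_n \bigcap_(k in [set k | (n <= k)%N]) [set t | K.+1%:R <= Z (word k t)]).
      apply: bigcup_measurable => n _; apply: bigcap_measurable; [by exists n; rewrite /=|move=> k _].
      exact: (measurable_word k [set v | K.+1%:R <= Z v]).
    by apply/seteqP; split => t /= [n]; [move=> h; exists n|move=> _ h; exists n].
  have := @cylinder_eventually_ge Z [::] K.+1%:R Z0 (fun v _ => Zs v).
  by rewrite ltr0n cylinder_nil setTI /= mul1r; apply.
apply: filterS2 nocross fin => t nocross [K hK].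
apply: cvgn_no_crossing => //; exists K.+1 => n; apply: contrapT => h; apply: hK.
exists n => k nk; rewrite leNgt; apply/negP => ZK; apply: h; by exists k.
Qed.


Lemma le_measure_bigcup_restr (F : nat -> set T) (G : set T) (kappa : R) :
  0 <= kappa -> (forall i, measurable (F i)) -> trivIset setT F -> measurable G ->
  (forall i, (P (F i `&` G) <= kappa%:E * P (F i))%E) ->
  (P ((\bigcup_i F i) `&` G) <= kappa%:E * P (\bigcup_i F i))%E.
Proof.
move=> k0 mF tF mG h; rewrite setI_bigcupl !measure_bigcup //; last 2 first.
- by move=> i _; exact: measurableI.
- exact: trivIset_setIr.
rewrite -nneseriesZl //.
apply: lee_nneseries; first by move=> i _ _; exact: measure_ge0.
by move=> i _; exact: h.
Qed.

Section FirstHit.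
Variables (r : pred (seq (bool * bool))).

(** Looks at strict prefixes only: the cylinders of the words that satisfy [r] but not [hit_before]
    partition the event of a hit according to the history at the first hit. *)
Fixpoint hit_before (w : seq (bool * bool)) : bool :=
  if w is l :: w' then r w' || hit_before w' else false.

Lemma hit_beforeP t n m : (m < n)%N -> r (word m t) -> hit_before (word n t).
Proof.
elim: n => // n IH; rewrite ltnS leq_eqVlt => /orP[/eqP->|mn] rm.
  by have [l ->] := wordS n t; rewrite /= rm.
by have [l ->] := wordS n t; rewrite /= IH ?orbT.
Qed.

Lemma le_measure_hit (G : set T) kappa : 0 <= kappa -> measurable G ->
  (forall w, r w -> (P (cylinder w `&` G) <= kappa%:E * P (cylinder w))%E) ->
  (P ([set t | exists n, r (word n t)] `&` G) <=
   kappa%:E * P [set t | exists n, r (word n t)])%E.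
Proof.
move=> k0 mG hG.
(* Histories are enumerated by their codes to obtain a sequence of disjoint sets; codes of no
   first-hit history give the empty set. *)
pose F i : set T := if @pickle_inv (seq (bool * bool)) i is Some w then
  if r w && ~~ hit_before w then cylinder w else set0 else set0.
have -> : [set t | exists n, r (word n t)] = \bigcup_i F i.
  apply/seteqP; split => t /=.
    move=> ex; have [n rn nmin] := ex_minnP ex.
    exists (choice.pickle (word n t)) => //; rewrite /F pickleK_inv rn /=.
    have -> : hit_before (word n t) = false.
      elim: n nmin {rn} => [|n IH] nmin.
        by have := size_word 0 t; case: (word 0 t).
      have [l ->] := wordS n t; rewrite /= (_ : r _ = false).
        by apply: IH => m rm; rewrite ltnW // nmin.
      by apply/negP => /nmin; rewrite ltnn.
    by rewrite /= size_word.
  move=> [i _]; rewrite /F; case: pickle_inv => // w.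
  by case: ifP => // /andP[rw _] /= wt; exists (size w); rewrite wt.
apply: le_measure_bigcup_restr => // [i|i j _ _ [t []]|i].
- rewrite /F; case: pickle_inv => // w; case: ifP => // _; exact: measurable_prefix.
- rewrite /F; case ui: (pickle_inv i) => [w|//]; case: ifP => // /andP[rw nw] /= wt.
  case uj: (pickle_inv j) => [v|//]; case: ifP => // /andP[rv nv] /= vt.
  have wv : size w = size v.
    have [lt|lt|//] := ltngtP (size w) (size v).
      by have := @hit_beforeP t _ _ lt; rewrite vt wt rw (negbTE nv) => /(_ isT).
    by have := @hit_beforeP t _ _ lt; rewrite vt wt rv (negbTE nw) => /(_ isT).
  have eq_wv : w = v by rewrite -wt wv vt.
  have := @pickle_invK (seq (bool * bool)) i; have := @pickle_invK (seq (bool * bool)) j.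
  by rewrite ui uj /= eq_wv => -> ->.
- rewrite /F; case: pickle_inv => [w|]; last by rewrite set0I measure0 mule0.
  by case: ifP => [/andP[rw _]|_]; [exact: hG|rewrite set0I measure0 mule0].
Qed.
End FirstHit.

(* Levy's zero-one law in elementary form. [G] is the event [S -> 0], so the
   decreasing events {some hit after time [j] while [S < 1 / (j + 1)]}
   approximate {[G] and infinitely many hits}; conditioning at the first hit
   gives probability at most [kappa] times itself to the latter. *)
Lemma ae_not_infinitely_often (hit : pred (seq (bool * bool)))
    (S : seq (bool * bool) -> R) (G : set T) kappa n0 :
  0 <= kappa < 1 -> measurable G ->
  (forall w, (n0 <= size w)%N -> hit w ->
     (P (cylinder w `&` G) <= kappa%:E * P (cylinder w))%E) ->
  (forall t, G t -> forall e, 0 < e -> exists n, forall k, (n <= k)%N -> S (word k t) < e) ->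
  {ae P, forall t, (forall j, exists2 n, (j <= n)%N & S (word n t) < j.+1%:R^-1) -> G t} ->
  {ae P, forall t, G t -> exists n, forall k, (n <= k)%N -> ~~ hit (word k t)}.
Proof.
move=> /andP[k0 k1] mG hG GS SG.
pose r j : pred (seq (bool * bool)) :=
  fun w => [&& (n0 + j <= size w)%N, hit w & S w < j.+1%:R^-1].
pose H j : set T := [set t | exists n, r j (word n t)].
have mH j : measurable (H j).
  rewrite (_ : H j = \bigcup_n [set t | r j (word n t)]).
    by apply: bigcupT_measurable => n; exact: (measurable_word n [set w | r j w]).
  by apply/seteqP; split => t /= [n]; [move=> ?; exists n|move=> _ ?; exists n].
have HG j : (P (H j `&` G) <= kappa%:E * P (H j))%E.
  apply: le_measure_hit => // w /and3P[nw hw _]; apply: hG => //.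
  by rewrite (leq_trans _ nw) // leq_addr.
have hH : {homo H : n m / (n <= m)%N >-> (m <= n)%O}.
  move=> i j ij; apply/subsetPset => t [n /and3P[jn hn Sn]]; exists n.
  apply/and3P; split => //; first by rewrite (leq_trans _ jn) // leq_add2l.
  by rewrite (lt_le_trans Sn) // lef_pV2 ?posrE ?ltr0n // ler_nat.
set D := \bigcap_j H j.
have mD : measurable D by exact: bigcapT_measurable.
have cvgH : P \o H @ \oo --> P D.
  apply: nonincreasing_cvg_mu => //.
  by rewrite ltey_eq (fin_num_measure P).
have DG : (P (D `&` G) <= kappa%:E * P D)%E.
  have cvgkH : (fun j => kappa%:E * P (H j))%E @ \oo --> (kappa%:E * P D)%E.
    exact: cvgeZl.
  rewrite -(cvg_lim _ cvgkH) //; apply: lime_ge; first by apply/cvg_ex; eexists; exact: cvgkH.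
  near=> j; apply: le_trans (HG j); apply: le_measure; rewrite ?inE.
  - exact: measurableI.
  - exact: measurableI.
  - by apply: setSI; exact: bigcap_inf.
(* On [D] the values of [S] are small at arbitrarily late times, which by [SG] puts almost every
   such point in [G]. *)
have DsubG : P (D `\` G) = 0%E.
  apply: measure_negligible; first exact: measurableD.
  apply: negligibleS SG => t [Dt nGt] /= h; apply: nGt; apply: h => j.
  have [n /and3P[jn _ Sn]] := Dt j I; exists n => //.
  by rewrite size_word in jn; rewrite (leq_trans _ jn) // leq_addl.
have PD0 : P D = 0%E.
  have PDE : P D = (P (D `\` G) + P (D `&` G))%E by exact: measureDI.
  rewrite DsubG add0e in PDE.
  have fin : P D \is a fin_num by exact: fin_num_measure.
  move: DG; rewrite -PDE -(fineK fin) -EFinM lee_fin => h.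
  congr EFin; apply/eqP; rewrite eq_le fine_ge0 // andbT.
  by rewrite leNgt; apply/negP => p0; move: h; rewrite leNgt gtr_pMl // k1.
exists D; split => // t /= /not_implyP[Gt /forallNP io]; move=> j _.
have [n1 hn1] := GS t Gt (j.+1%:R^-1) ltac:(by rewrite invr_gt0 ltr0n).
have /existsNP[k /not_implyP[nk /negP/negPn hk]] := io (n0 + j + n1)%N.
exists k; apply/and3P; split => //.
  by rewrite size_word (leq_trans _ nk) // leq_addr.
by apply: hn1; rewrite (leq_trans _ nk) // leq_addl.
Unshelve. all: by end_near. Qed.

End Process.

(** * Paths *)

Lemma sum_bounded_near (R : realType) (e f : nat -> R) c :
  (forall k, 0 <= e k) -> (forall k, 0 <= f k) -> 0 <= c ->
  (\forall k \near \oo, e k <= c * f k) ->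
  (exists M, forall n, \sum_(k < n) f k <= M) ->
  exists M, forall n, \sum_(k < n) e k <= M.
Proof.
move=> e0 f0 c0 [N _ ef] [M fM].
have M0 : 0 <= M by have := fM 0%N; rewrite big_ord0.
exists (\sum_(k < N) e k + c * M) => n.
apply: (@le_trans _ _ (\sum_(k < N) e k + c * \sum_(k < n) f k)); last first.
  by rewrite lerD2l ler_wpM2l.
elim: n => [|n IH].
  by rewrite !big_ord0 mulr0 addr0 sumr_ge0.
have [nN|Nn] := leqP n.+1 N.
  rewrite -[leLHS]addr0 lerD //; last by rewrite mulr_ge0 // sumr_ge0.
  rewrite -(subnK nN); elim: (N - n.+1)%N => // j IHj.
  by rewrite addSn [leRHS]big_ord_recr /= (le_trans IHj) // lerDl.
rewrite !big_ord_recr /= mulrDr.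
by have := ef n Nn; move: IH; lra.
Qed.

Section Path.
Variables (R : realType) (gamma : nat -> R) (q : bool -> R) (x : R).
Hypothesis x01 : 0 <= x <= 1.
Hypothesis gamma01 : forall n, 0 < gamma n.+1 < 1.
Hypothesis q01 : forall s, 0 < q s < 1.
Variable v : nat -> seq (bool * bool).
Hypothesis size_v : forall n, size (v n) = n.
Hypothesis vS : forall n, exists l, v n.+1 = l :: v n.

Local Notation state := (state gamma x).
Local Notation shrink := (shrink gamma x).
Local Notation swell := (swell gamma x).
Local Notation downfall := (downfall gamma).

Let v0 : v 0%N = [::]. Proof. by have := size_v 0; case: (v 0%N). Qed.

Lemma shrinkE c s n :
  shrink c s (v n) = \prod_(k < n) (1 - c * gamma k.+1 * state s (v k)).
Proof.
elim: n => [|n IH]; first by rewrite v0 big_ord0.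
by have [l ->] := vS n; rewrite /= size_v big_ord_recr /= IH.
Qed.

Lemma swellE c s n : swell c s (v n) =
  \prod_(k < n) (1 + c * (gamma k.+1 / (1 - gamma k.+1)) * state s (v k)).
Proof.
elim: n => [|n IH]; first by rewrite v0 big_ord0.
by have [l ->] := vS n; rewrite /= size_v big_ord_recr /= IH.
Qed.

Hypothesis gamma_small : forall e : R, 0 < e -> \forall n \near \oo, gamma n < e.

Lemma gammaS_small e : 0 < e -> \forall n \near \oo, gamma n.+1 < e.
Proof. by move=> /gamma_small [N _ h]; exists N => // n /= Nn; apply: h; exact: leqW. Qed.

(* The two given limits multiply to the inverse of a convergent infinite
   product, so neither of them vanishes. *)
Lemma downfall_shrink_cvg_to_pos s :
  (exists M, forall n, \sum_(k < n) gamma k.+1 ^+ 2 <= M) ->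
  cvgn (fun n => downfall s (v n) / shrink (q (~~ s)) (~~ s) (v n)) ->
  cvgn (fun n => (downfall s (v n) * swell (q (~~ s)) (~~ s) (v n))^-1) ->
  cvg_to_pos (fun n => downfall s (v n) / shrink (q (~~ s)) (~~ s) (v n)).
Proof.
move=> gM c1 c2; set u := (fun n => _) in c1 *; set w := (fun n => _) in c2.
pose r k := q (~~ s) * state (~~ s) (v k).
have r01 k : 0 <= r k <= 1.
  have /andP[q0 q1] := q01 (~~ s); have /andP[z0 z1] := state01 x01 gamma01 (~~ s) (v k).
  by rewrite /r; apply/andP; split; [apply: mulr_ge0 => //; exact: ltW|apply: mulr_ile1 => //; exact: ltW].
(* From (1 - g r) (1 + g r / (1 - g)) = 1 + g^2 r (1 - r) / (1 - g): the product of the two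
   compensators differs from 1 to second order only. *)
pose e k := gamma k.+1 ^+ 2 / (1 - gamma k.+1) * (r k * (1 - r k)).
have e0 k : 0 <= e k.
  have /andP[r0 r1] := r01 k; have /andP[g0 g1] := gamma01 k.
  rewrite /e; apply: mulr_ge0; last by rewrite mulr_ge0 // subr_ge0.
  by rewrite divr_ge0 ?sqr_ge0 // subr_ge0 ltW.
have [M eM] : exists M, forall n, \sum_(k < n) e k <= M.
  apply: (@sum_bounded_near R e (fun k => gamma k.+1 ^+ 2) 2) => // [k|]; first exact: sqr_ge0.
  have h2 : 0 < 2^-1 :> R by rewrite invr_gt0.
  apply: filterS (gammaS_small h2) => k gk.
  have /andP[r0 r1] := r01 k; have /andP[g0 g1] := gamma01 k.
  rewrite /e -mulrA [2 * _]mulrC ler_wpM2l ?sqr_ge0 // mulrC ler_pdivrMr ?subr_gt0 //.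
  by apply: (@le_trans _ _ 1); nra.
have pos := prod_cvg_to_pos e0 eM.
have [l l0 uwl] := cvg_to_posV pos.
have uw : u n * w n @[n --> \oo] --> l.
  apply: cvg_trans uwl; apply: near_eq_cvg; near=> n.
  have d0 : downfall s (v n) != 0 by rewrite gt_eqF // downfall_gt0.
  have s0 := shrink_gt0 x01 gamma01 (~~ s) (v n) (q01W q01 (~~ s)).
  have w0 : 0 < swell (q (~~ s)) (~~ s) (v n).
    by apply: swell_gt0 => //; have /andP[/ltW] := q01 (~~ s).
  rewrite /u /w invfM mulrACA divff // mul1r -invfM shrinkE swellE -big_split /=.
  congr (_^-1); apply: eq_bigr => k _; rewrite /e /r.
  have /andP[g0 g1] := gamma01 k; field.
  by rewrite subr_eq0 gt_eqF.
have u_ge0 : 0 <= limn u.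
  apply: limr_ge => //; near=> n; rewrite divr_ge0 ?ltW ?downfall_gt0 //.
  by apply: shrink_gt0 => //; exact: q01W.
exists (limn u) => //; rewrite lt_neqAle u_ge0 andbT eq_sym; apply/eqP => u0.
have h : u n * w n @[n --> \oo] --> limn u * limn w by exact: cvgM.
have := cvg_unique (@norm_hausdorff _ _) uw h.
by rewrite u0 mul0r => le0; rewrite le0 ltxx in l0.
Unshelve. all: by end_near. Qed.

(** As [state (~~ s)] is 1 - [state s], the quotient of the factors is 1 + c gamma [state s] / (1 -
    c gamma), so the random compensator is comparable to a deterministic product. *)
Lemma shrink_ratio_cvg_to_pos c s : 0 < c < 1 ->
  (exists M, forall n, \sum_(k < n) gamma k.+1 * state s (v k) <= M) ->
  cvg_to_pos (fun n => shrink c (~~ s) (v n) / \prod_(k < n) (1 - c * gamma k.+1)).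
Proof.
move=> /andP[c0 c1] zM.
have cg k : 0 < c * gamma k.+1 < 1.
  by have /andP[g0 g1] := gamma01 k; apply/andP; split; nra.
pose e k := c * gamma k.+1 * state s (v k) / (1 - c * gamma k.+1).
have z0 k : 0 <= state s (v k) by have /andP[] := state01 x01 gamma01 s (v k).
have e0 k : 0 <= e k.
  have /andP[g0 g1] := cg k.
  by rewrite /e divr_ge0 ?subr_ge0 ?(ltW g1) // mulr_ge0 // ltW.
have [M eM] : exists M, forall n, \sum_(k < n) e k <= M.
  apply: (@sum_bounded_near R e (fun k => gamma k.+1 * state s (v k)) 2) => // [k|].
    by rewrite mulr_ge0 //; have /andP[/ltW] := gamma01 k.
  have h2 : 0 < 2^-1 :> R by rewrite invr_gt0.
  apply: filterS (gammaS_small h2) => k gk.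
  have /andP[g0 g1] := gamma01 k; have /andP[cg0 cg1] := cg k.
  rewrite /e ler_pdivrMr ?subr_gt0 //.
  have gz : 0 <= gamma k.+1 * state s (v k) by rewrite mulr_ge0 // ltW.
  rewrite [leLHS](_ : _ = gamma k.+1 * state s (v k) * c); last by ring.
  rewrite [leRHS](_ : _ = gamma k.+1 * state s (v k) * (2 * (1 - c * gamma k.+1))); last by ring.
  rewrite ler_wpM2l //.
  have : c * gamma k.+1 <= gamma k.+1 by rewrite ler_piMl // ltW.
  by lra.
apply: cvg_to_pos_near (prod_cvg_to_pos e0 eM); near=> n.
rewrite shrinkE -prodf_div; apply: eq_bigr => k _.
have /andP[cg0 cg1] := cg k.
by rewrite /e stateN; field; rewrite subr_eq0 gt_eqF.
Unshelve. all: by end_near. Qed.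

Definition no_up_from s m := forall n, (m <= n)%N -> v n.+1 <> (s, true) :: v n.

Lemma no_up_fromE s m n : no_up_from s m -> (m <= n)%N ->
  state s (v n) = state s (v m) / downfall s (v m) * downfall s (v n).
Proof.
move=> nu /subnK <-; elim: (n - m)%N => [|k IH].
  by rewrite divfK // gt_eqF // downfall_gt0.
rewrite addSn; have [[u h] vl] := vS (k + m); have := nu _ (leq_addl k m).
rewrite vl /= size_v xpair_eqE; case: h {vl}; rewrite /= ?andbF ?mulr1 //.
case: u s {nu} IH => -[] IH // _ /=; rewrite IH; ring.
Qed.

Lemma no_up_from_small s m :
  (forall n, (m <= n)%N -> state s (v n.+1) < gamma n.+1) -> no_up_from s m.
Proof.
move=> zg n mn vn; have := zg n mn; rewrite vn /= eqxx size_v ltNge.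
have /andP[g0 g1] := gamma01 n; have /andP[z0 z1] := state01 x01 gamma01 s (v n).
have : 0 <= state s (v n) * (1 - gamma n.+1) by rewrite mulr_ge0 // subr_ge0 ltW.
by move=> h /negP; apply; lra.
Qed.

(** A limit strictly between 0 and 1 would bound X (1 - X) away from 0 and make the last sum diverge
    with that of the gamma's. *)
Lemma state_limit01 : sum_unbounded (fun k => gamma k.+1) ->
  cvgn (fun n => state true (v n)) ->
  (exists M, forall n, \sum_(k < n) gamma k.+1 * (state true (v k) * state false (v k)) <= M) ->
  limn (fun n => state true (v n)) = 0 \/ limn (fun n => state true (v n)) = 1.
Proof.
move=> gU c [M hM]; set l := limn _.
have zl : state true (v n) * state false (v n) @[n --> \oo] --> l * (1 - l).
  have h : 1 - state true (v n) @[n --> \oo] --> 1 - l.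
    by apply: cvgB => //; exact: cvg_cst.
  apply: cvgM => //; apply: cvg_trans h; apply: near_eq_cvg.
  by near=> n; rewrite -stateN.
have zz k : 0 <= state true (v k) * state false (v k).
  have /andP[? _] := state01 x01 gamma01 true (v k).
  by have /andP[? _] := state01 x01 gamma01 false (v k); rewrite mulr_ge0.
have ll : 0 <= l * (1 - l).
  rewrite -(cvg_lim (@norm_hausdorff _ _) zl); apply: limr_ge.
    by apply/cvg_ex; eexists; exact: zl.
  by near=> n.
have [/eqP|ll0] := eqVneq (l * (1 - l)) 0.
  by rewrite mulf_eq0 subr_eq0 => /orP[/eqP ->|/eqP <-]; [left|right].
have lpos : 0 < l * (1 - l) by rewrite lt_neqAle eq_sym ll0.
have [N _ hN] : \forall k \near \oo, l * (1 - l) / 2 <= state true (v k) * state false (v k).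
  by apply: (cvgr_ge _ zl); rewrite ltr_pdivrMr // ltr_pMr // ltr1n.
have g0 k : 0 <= gamma k.+1 by have /andP[/ltW] := gamma01 k.
have [n hn] := @sum_unbounded_scale R (fun k => gamma k.+1)
  (fun k => gamma k.+1 * (state true (v k) * state false (v k))) (l * (1 - l) / 2) N
  ltac:(by rewrite divr_gt0) g0 (fun k => mulr_ge0 (g0 k) (zz k))
  (fun k Nk => ltac:(by rewrite mulrC ler_wpM2l //; exact: hN)) gU (M + 1).
by have := hM n; have := hn; lra.
Unshelve. all: by end_near. Qed.

Lemma sum_gamma_state_bounded s :
  state s (v n) @[n --> \oo] --> 0 ->
  (exists M, forall n, \sum_(k < n) gamma k.+1 * (state true (v k) * state false (v k)) <= M) ->
  exists M, forall n, \sum_(k < n) gamma k.+1 * state s (v k) <= M.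
Proof.
move=> z0; have g0 k : 0 <= gamma k.+1 by have /andP[/ltW] := gamma01 k.
have zp s' k : 0 <= state s' (v k) by have /andP[] := state01 x01 gamma01 s' (v k).
apply: (@sum_bounded_near R (fun k => gamma k.+1 * state s (v k))
  (fun k => gamma k.+1 * (state true (v k) * state false (v k))) 2) => // [k|k|].
- by rewrite mulr_ge0.
- by rewrite mulr_ge0 // mulr_ge0.
- have h2 : 0 < 2^-1 :> R by rewrite invr_gt0.
  apply: filterS (cvgr_lt _ z0 _ h2) => k zk.
  rewrite [X in _ <= _ * (_ * X)](_ : _ = state s (v k) * (1 - state s (v k))).
    rewrite mulrCA ler_wpM2l // mulrCA ler_peMr //; lra.
  by rewrite -stateN; case: (s) => //=; rewrite mulrC.
Qed.

(** From time [m] on, [state s] is a constant times (downfall / shrink) (shrink / prod) prod, and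
    each of these factors has a known order. *)
Lemma no_up_powR_cvg C s m c : 0 < C -> 0 < c < 1 -> c = q (~~ s) ->
  0 < state s [::] -> no_up_from s m ->
  cvg_to_pos (fun n => n%:R `^ (C * c) * \prod_(k < n) (1 - c * gamma k.+1)) ->
  (exists M, forall n, \sum_(k < n) gamma k.+1 * state s (v k) <= M) ->
  cvg_to_pos (fun n => downfall s (v n) / shrink (q (~~ s)) (~~ s) (v n)) ->
  cvg_to_pos (fun n => n%:R `^ (C * c) * state s (v n)).
Proof.
move=> C0 c01 cq z0 nu h1 h2 h3.
have h4 := shrink_ratio_cvg_to_pos c01 h2.
have k0 : 0 < state s (v m) / downfall s (v m).
  by rewrite divr_gt0 ?downfall_gt0 // state_gt0.
have := cvg_to_posM (cvg_to_posM (cvg_to_pos_cst k0) h1) (cvg_to_posM h3 h4).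
apply: cvg_to_pos_near; near=> n.
rewrite (@no_up_fromE s m n nu); last by near: n; exact: nbhs_infty_ge.
have c01' : 0 <= c <= 1 by case/andP: c01 => /ltW -> /ltW.
have s0 := lt0r_neq0 (shrink_gt0 x01 gamma01 (~~ s) (v n) c01').
have p0 : \prod_(k < n) (1 - c * gamma k.+1) != 0.
  apply/prodf_neq0 => k _; have /andP[g0 g1] := gamma01 k.
  by case/andP: c01 => ? ?; rewrite subr_eq0 gt_eqF //; nra.
have d0 := lt0r_neq0 (downfall_gt0 gamma01 s (v m)).
rewrite -cq; field.
by rewrite d0 p0 s0.
Unshelve. all: by end_near. Qed.

(** With p_k the product, p_k / (delta gamma_k) drops at step k by p_k (c - increment of 1 / gamma)
    / delta >= p_k. The absolute value covers [gamma 0], whose sign is arbitrary. *)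
Lemma prod_slow_growth_bounded c : slow_growth gamma c -> 0 < c < 1 ->
  exists M, forall n, \sum_(k < n) \prod_(j < k) (1 - c * gamma j.+1) <= M.
Proof.
move=> [delta d0 [N _ hN]] /andP[c0 c1].
have p0 k : 0 < \prod_(j < k) (1 - c * gamma j.+1).
  by apply: prodr_gt0 => j _; have /andP[g0 g1] := gamma01 j; rewrite subr_gt0; nra.
apply: (@sum_telescope_bounded R (fun k => \prod_(j < k) (1 - c * gamma j.+1)) (fun k => `|gamma k|^-1 / delta *
   \prod_(j < k) (1 - c * gamma j.+1)) N.+1) => [k|k|k Nk].
- exact: ltW.
- by rewrite mulr_ge0 ?(ltW (p0 k)) // divr_ge0 ?invr_ge0 // ltW.
- rewrite big_ord_recr /=; have /andP[g0 g1] := gamma01 k.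
  case: k Nk g0 g1 => // k Nk g0 g1; have /andP[h0 h1] := gamma01 k.
  rewrite !gtr0_norm // -subr_ge0.
  have := hN k.+1 (ltnW Nk); set a := gamma k.+1 in h0 h1 *; set b := gamma k.+2 in g0 g1 *.
  move=> ab; set p := \prod_(j < _) _.
  rewrite [leRHS](_ : _ = p / delta * (c - delta - (b^-1 - a^-1))).
    by rewrite mulr_ge0 ?subr_ge0 // divr_ge0 ?(ltW d0) // ltW // p0.
  by field; rewrite !gt_eqF.
Qed.

(** Only an upper bound on downfall / shrink enters, and its limit may vanish; positivity would
    require the sum of gamma^2 to be finite, which fails for alpha <= 1/2. *)
Lemma no_up_sum_bounded s m c : 0 < c < 1 -> c = q (~~ s) -> slow_growth gamma c ->
  no_up_from s m ->
  (exists M, forall n, \sum_(k < n) gamma k.+1 * state s (v k) <= M) ->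
  cvgn (fun n => downfall s (v n) / shrink (q (~~ s)) (~~ s) (v n)) ->
  exists M, forall n, \sum_(k < n) state s (v k) <= M.
Proof.
move=> c01 cq sg nu h2 h3.
have [l4 l40 h4] := shrink_ratio_cvg_to_pos c01 h2.
set l3 := limn _ in h3.
have zp k : 0 <= state s (v k) by have /andP[] := state01 x01 gamma01 s (v k).
pose k0 := state s (v m) / downfall s (v m).
have k00 : 0 <= k0 by rewrite divr_ge0 // ltW // downfall_gt0.
have p0 k : 0 < \prod_(j < k) (1 - c * gamma j.+1).
  case/andP: c01 => ? ?.
  by apply: prodr_gt0 => j _; have /andP[g0 g1] := gamma01 j; rewrite subr_gt0; nra.
have c01' : 0 <= c <= 1 by case/andP: c01 => /ltW -> /ltW.
have l30 : 0 <= l3.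
  apply: limr_ge => //; near=> n; rewrite divr_ge0 ?ltW ?downfall_gt0 //.
  by apply: shrink_gt0 => //; rewrite -cq.
apply: (@sum_bounded_near R (fun k => state s (v k)) (fun k => \prod_(j < k) (1 - c * gamma j.+1))
  (k0 * (l3 + 1) * (l4 + 1))) => //.
- by move=> k; exact: ltW.
- by apply: mulr_ge0; [apply: mulr_ge0 => //|]; rewrite addr_ge0 // ltW.
- near=> n.
  rewrite (@no_up_fromE s m n nu); last by near: n; exact: nbhs_infty_ge.
  have s0 := shrink_gt0 x01 gamma01 (~~ s) (v n) c01'.
  have a3 : downfall s (v n) / shrink c (~~ s) (v n) <= l3 + 1.
    rewrite cq; near: n; apply: (cvgr_le l3 h3); by rewrite ltrDl.
  have a4 : shrink c (~~ s) (v n) / \prod_(j < n) (1 - c * gamma j.+1) <= l4 + 1.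
    near: n; apply: (cvgr_le l4 h4); by rewrite ltrDl.
  rewrite -/k0 -[k0 * _ * _]mulrA -[k0 * _ * _]mulrA ler_wpM2l // -mulrA.
  rewrite ler_pdivrMr // in a3; rewrite ler_pdivrMr // in a4.
  apply: (le_trans a3); rewrite ler_wpM2l //.
  by rewrite addr_ge0.
- exact: prod_slow_growth_bounded.
Unshelve. all: by end_near. Qed.

(* Each letter pushing [state s] up makes the convergent sequence jump by a
   quantity bounded from below. *)
Lemma no_up_of_powR_cvg a s kappa : 1 <= a -> 0 < kappa ->
  (\forall n \near \oo, kappa <= n%:R * gamma n.+1) ->
  state s (v n) @[n --> \oo] --> 0 ->
  cvgn (fun n => n%:R `^ a * state s (v n)) -> exists m, no_up_from s m.
Proof.
move=> a1 k0 gk z0 uc; set u := (fun n => _) in uc.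
have duc : u n.+1 - u n @[n --> \oo] --> 0.
  have h : u n.+1 @[n --> \oo] --> limn u by rewrite (cvg_shiftS u); exact: uc.
  by rewrite -(subrr (limn u)); exact: cvgB.
have [N _ hN] : \forall n \near \oo, v n.+1 <> (s, true) :: v n; last by exists N.
near=> n => vn.
have : u n.+1 - u n < kappa / 2.
  by near: n; apply: (cvgr_lt _ duc); rewrite divr_gt0.
apply/negP; rewrite -leNgt.
have n0 : (0 < n)%N by near: n; exact: nbhs_infty_gt.
have n1 : 1 <= n%:R :> R by rewrite ler1n.
have zn : state s (v n) < 2^-1 by near: n; apply: (cvgr_lt _ z0); rewrite invr_gt0.
have /andP[zp _] := state01 x01 gamma01 s (v n).
have /andP[g0 g1] := gamma01 n.
have kn : kappa <= n%:R * gamma n.+1 by near: n.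
have na : n%:R <= n%:R `^ a by exact: le1r_powR.
have na1 : n%:R `^ a <= n.+1%:R `^ a.
  apply: ge0_ler_powR; rewrite ?nnegrE ?ler0n // ?ler_nat //.
  exact: le_trans a1.
have zE : state s (v n.+1) = state s (v n) + gamma n.+1 * (1 - state s (v n)).
  by rewrite vn /= eqxx size_v.
rewrite /u zE.
have z' : 0 <= state s (v n) + gamma n.+1 * (1 - state s (v n)).
  by rewrite addr_ge0 // mulr_ge0 ?(ltW g0) //; lra.
apply: (@le_trans _ _ (n%:R `^ a * (gamma n.+1 * (1 - state s (v n))))); last first.
  have := ler_wpM2r z' na1; set b := n%:R `^ a; set b' := n.+1%:R `^ a.
  by rewrite mulrDr; lra.
apply: (@le_trans _ _ (n%:R * gamma n.+1 * (1 - state s (v n)))).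
  by apply: ler_pM => //; rewrite ?invr_ge0 //; [exact: ltW|lra].
rewrite mulrA ler_wpM2r //; first by lra.
by rewrite ler_wpM2r // ltW.
Unshelve. all: by end_near. Qed.

End Path.

(** * Almost sure limits *)

Lemma ge_measure_bigcap (R : realType) d (T : measurableType d)
    (P : probability T R) (F : nat -> set T) (c : \bar R) :
  (forall n, measurable (F n)) -> {homo F : n m / (n <= m)%N >-> m `<=` n} ->
  (forall n, (c <= P (F n))%E) -> (c <= P (\bigcap_n F n))%E.
Proof.
move=> mF hF ge_c.
have mI : measurable (\bigcap_n F n) by exact: bigcapT_measurable.
have h : P \o F @ \oo --> P (\bigcap_n F n).
  apply: nonincreasing_cvg_mu => //; first by rewrite ltey_eq (fin_num_measure P).
  by move=> n m nm; apply/subsetPset; exact: hF.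
rewrite -(cvg_lim _ h) //; apply: lime_ge; first by apply/cvg_ex; eexists; exact: h.
by near=> n; exact: ge_c.
Unshelve. all: by end_near. Qed.

Section Convergence.
Context (R : realType) d (T : measurableType d) (P : probability T R).
Variables (gamma : nat -> R) (q : bool -> R) (x : R).
Variable (word : nat -> T -> seq (bool * bool)).
Hypothesis x01 : 0 <= x <= 1.
Hypothesis gamma01 : forall n, 0 < gamma n.+1 < 1.
Hypothesis q01 : forall s, 0 < q s < 1.
Hypothesis size_word : forall n t, size (word n t) = n.
Hypothesis wordS : forall n t, exists l, word n.+1 t = l :: word n t.
Hypothesis measurable_word : forall n (Q : set (seq (bool * bool))),
  measurable [set t | Q (word n t)].
Hypothesis word_law : forall w k (Q : set (seq (bool * bool))),
  P ([set t | word (size w) t = w] `&` [set t | Q (word (size w + k) t)]) =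
  (weight gamma q x w *
    iter k (step gamma q x) (fun v => (`[< Q v >] : bool)%:R) w)%:E.
Hypothesis q_lt : q false < q true.

Local Notation cylinder w := [set t | word (size w) t = w].
Local Notation weight := (weight gamma q x).
Local Notation state := (state gamma x).
Local Notation step := (step gamma q x).
Local Notation shrink := (shrink gamma x).
Local Notation swell := (swell gamma x).
Local Notation downfall := (downfall gamma).

Let drift_coef01 : 0 < q true - q false < 1.
Proof.
have /andP[_ h1] := q01 true; have /andP[h2 _] := q01 false.
by rewrite subr_gt0 q_lt (lt_trans _ h1) // gtrBl.
Qed.

Lemma cylinder_weight w : P (cylinder w) = (weight w)%:E.
Proof.
have := word_law w 0 setT; rewrite setIT /= => ->.
by rewrite asboolT // mulr1.
Qed.

Lemma ae_state_cvg :
  {ae P, forall t, cvgn (fun n => state true (word n t)) /\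
                   cvgn (fun n => state false (word n t))}.
Proof.
have super v : step (state false) v <= state false v.
  rewrite step_state /= gerDl; have /andP[g0 g1] := gamma01 (size v).
  rewrite -mulrA mulr_ge0_le0 ?(ltW g0) // mulr_le0_ge0 ?subr_le0 ?(ltW q_lt) //.
  have /andP[? _] := state01 x01 gamma01 true v.
  by have /andP[? _] := state01 x01 gamma01 false v; rewrite mulr_ge0.
have state_ge0 v : 0 <= state false v by have /andP[] := state01 x01 gamma01 false v.
apply: filterS (supermartingale_cvg x01 gamma01 q01 size_word wordS measurable_word word_law
  state_ge0 super) => t c.
split=> //; rewrite (_ : (fun n => _) = (fun n => 1 - state false (word n t))).
  by apply: is_cvgB => //; exact: is_cvg_cst.
by apply/funext => n; rewrite -stateN.
Qed.

Fixpoint drift (w : seq (bool * bool)) : R :=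
  if w is _ :: w' then
    drift w' + gamma (size w').+1 * (state true w' * state false w')
  else 0.

(** Doob's decomposition: adding (q true - q false) [drift] to [state false] gives a nonnegative
    martingale, and both it and [state false] converge. *)
Lemma ae_drift_bounded : {ae P, forall t, exists M, forall n,
  \sum_(k < n) gamma k.+1 * (state true (word k t) * state false (word k t)) <= M}.
Proof.
have zz v : 0 <= state true v * state false v.
  have /andP[? _] := state01 x01 gamma01 true v.
  by have /andP[? _] := state01 x01 gamma01 false v; rewrite mulr_ge0.
have /andP[p0 p1] := drift_coef01.
have drift0 v : 0 <= drift v.
  elim: v => //= l v IH; rewrite addr_ge0 // mulr_ge0 //.
  by have /andP[/ltW] := gamma01 (size v).
pose Z v := state false v + (q true - q false) * drift v.
have Z0 v : 0 <= Z v.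
  rewrite /Z addr_ge0 //; first by have /andP[] := state01 x01 gamma01 false v.
  by rewrite mulr_ge0 // ltW.
have super v : step Z v <= Z v.
  rewrite /Z stepD step_state stepZ -[X in _ + _ * X <= _]/(step drift v).
  have -> : step drift v = drift v + gamma (size v).+1 * (state true v * state false v).
    by rewrite (@eq_step _ _ _ _ _ (fun=> drift v + gamma (size v).+1 * (state true v * state false v))) ?step_cst.
  by rewrite /=; lra.
apply: filterS2 ae_state_cvg (supermartingale_cvg x01 gamma01 q01 size_word wordS measurable_word word_law
  Z0 super) => t [_ c] cZ.
have sumE n : \sum_(k < n) gamma k.+1 * (state true (word k t) * state false (word k t)) = drift (word n t).
  elim: n => [|n IH].
    by rewrite big_ord0; have := size_word 0 t; case: (word 0 t).
  by rewrite big_ord_recr /= IH; have [l ->] := wordS n t; rewrite /= size_word.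
have driftc : cvgn (fun n => drift (word n t)).
  rewrite (_ : (fun n => _) = (fun n => (q true - q false)^-1 * (Z (word n t) - state false (word n t)))).
    by apply: is_cvgMl_tmp; exact: is_cvgB.
  apply/funext => n; rewrite /Z addrAC subrr add0r mulKf // gt_eqF //.
exists (limn (fun n => drift (word n t))) => n; rewrite sumE.
apply: nondecreasing_cvgn_le driftc n.
apply: homo_leq => // [y z u|n]; first exact: le_trans.
have [l ->] := wordS n t; rewrite /= lerDl mulr_ge0 //.
by have /andP[/ltW] := gamma01 (size (word n t)).
Qed.

Lemma ae_downfall_cvg s : {ae P, forall t,
  cvgn (fun n => downfall s (word n t) / shrink (q (~~ s)) (~~ s) (word n t)) /\
  cvgn (fun n => (downfall s (word n t) * swell (q (~~ s)) (~~ s) (word n t))^-1)}.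
Proof.
have cvg_of := supermartingale_cvg x01 gamma01 q01 size_word wordS measurable_word word_law.
have /andP[q0 q1] := q01W q01 (~~ s).
have h1 : {ae P, forall t, cvgn (fun n => downfall s (word n t) / shrink (q (~~ s)) (~~ s) (word n t))}.
  apply: (cvg_of (fun v => downfall s v / shrink (q (~~ s)) (~~ s) v)) => v.
    by rewrite divr_ge0 // ltW ?downfall_gt0 // shrink_gt0 // q0.
  by rewrite step_downfall_shrink.
have h2 : {ae P, forall t, cvgn (fun n => (downfall s (word n t) * swell (q (~~ s)) (~~ s) (word n t))^-1)}.
  apply: (cvg_of (fun v => (downfall s v * swell (q (~~ s)) (~~ s) v)^-1)) => v.
    by rewrite invr_ge0 mulr_ge0 // ltW ?downfall_gt0 // swell_gt0.
  by rewrite step_downfall_swell.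
by apply: filterS2 h1 h2 => t; split.
Qed.

Lemma ae_state_shrink_cvg : {ae P, forall t,
  cvgn (fun n => state false (word n t) / shrink (q true - q false) true (word n t))}.
Proof.
have /andP[p0 p1] := drift_coef01.
have p01 : 0 <= q true - q false <= 1 by rewrite !ltW.
apply: (supermartingale_cvg x01 gamma01 q01 size_word wordS measurable_word word_law
  (Z := fun v => state false v / shrink (q true - q false) true v)) => v.
  rewrite divr_ge0 //; first by have /andP[] := state01 x01 gamma01 false v.
  by rewrite ltW // shrink_gt0.
by rewrite (step_ratio_shrink x01 gamma01 (s := false)).
Qed.

(** Countably many thresholds make the event measurable. For nonnegative [S] it is convergence to
    0. *)
Definition vanishes (S : seq (bool * bool) -> R) : set T :=
  [set t | forall i, exists n, forall k, (n <= k)%N -> S (word k t) < i.+1%:R^-1].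

Lemma measurable_vanishes S : measurable (vanishes S).
Proof.
rewrite (_ : vanishes S = \bigcap_i \bigcup_n
    \bigcap_(k in [set k | (n <= k)%N]) [set t | S (word k t) < i.+1%:R^-1]).
  apply: bigcapT_measurable => i; apply: bigcupT_measurable => n.
  apply: bigcap_measurable; [by exists n; rewrite /=|move=> k _].
  exact: (measurable_word k [set v | S v < i.+1%:R^-1]).
apply/seteqP; split => t /= h i; first by move=> _; have [n hn] := h i; exists n.
by have [n _ hn] := h i I; exists n.
Qed.

Lemma vanishesP S t : vanishes S t -> forall e, 0 < e ->
  exists n, forall k, (n <= k)%N -> S (word k t) < e.
Proof.
move=> h e e0; have [n hn] := h (Num.trunc e^-1); exists n => k nk.
apply: (lt_trans (hn k nk)); rewrite invf_plt ?posrE //; exact: truncnS_gt.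
Qed.

Lemma vanishes_cvg S t : (forall v, 0 <= S v) ->
  vanishes S t <-> S (word n t) @[n --> \oo] --> 0.
Proof.
move=> S0; split=> [h|h i].
  apply/cvgrPdist_lt => e e0; have [n hn] := vanishesP h e0.
  by exists n => // k /= nk; rewrite sub0r normrN ger0_norm // hn.
have e0 : 0 < i.+1%:R^-1 :> R by rewrite invr_gt0.
by have [n _ hn] := cvgr_lt _ h _ e0; exists n => k nk; exact: hn.
Qed.

Lemma vanishes_of_cvg (S : seq (bool * bool) -> R) t : (forall v, 0 <= S v) -> cvgn (fun n => S (word n t)) ->
  (forall j, exists2 n, (j <= n)%N & S (word n t) < j.+1%:R^-1) -> vanishes S t.
Proof.
move=> S0 ct h; apply/vanishes_cvg => //.
suff -> : 0 = limn (fun n => S (word n t)) by [].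
apply/eqP; rewrite eq_le; apply/andP; split; first by apply: limr_ge => //; near=> n.
rewrite leNgt; apply/negP => l0.
have l2 : limn (fun n => S (word n t)) / 2 < limn (fun n => S (word n t)).
  by rewrite ltr_pdivrMr // ltr_pMr // ltr1n.
have [n1 _ hn1] := cvgr_gt _ ct _ l2.
set l := limn _ in l0 l2 hn1.
pose j := (n1 + Num.trunc (l / 2)^-1)%N.
have [n jn zn] := h j.
have := hn1 n (leq_trans (leq_addr _ _) jn); rewrite /= => /lt_trans - /(_ _ zn).
apply/negP; rewrite -leNgt.
rewrite -[leRHS]invrK lef_pV2 ?posrE ?invr_gt0 ?divr_gt0 // ltW //.
by apply: (lt_le_trans (truncnS_gt _)); rewrite ler_nat ltnS leq_addl.
Unshelve. all: by end_near. Qed.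

(* [f] plays the role of [expR (- lambda * state s)]: a supermartingale that
   starts below [expR (- c * state s / gamma)] and tends to [1] on the event. *)
Lemma ae_vanishes_fast s S c n0 : 0 < c ->
  (forall n, (n0 <= n)%N -> 0 < gamma n) ->
  (forall w, (n0 <= size w)%N -> exists f : seq (bool * bool) -> R,
    [/\ forall v, 0 <= f v,
        forall v, (size w <= size v)%N -> step f v <= f v,
        f w <= expR (- (c * (state s w / gamma (size w)))) &
        forall t, vanishes S t -> forall r, r < 1 ->
          exists n, forall k, (n <= k)%N -> r <= f (word k t)]) ->
  {ae P, forall t, (forall j, exists2 n, (j <= n)%N & S (word n t) < j.+1%:R^-1) ->
     vanishes S t} ->
  {ae P, forall t, vanishes S t -> forall e, 0 < e ->
     exists n, forall k, (n <= k)%N -> state s (word k t) < e * gamma k}.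
Proof.
move=> c0 g0 hf hS.
(* At a hit, [f w] is at most exp (- c / (j + 1)) < 1, so the zero-one law forbids infinitely many
   hits; the countably many levels j give every e. *)
have io (j : nat) : {ae P, forall t, vanishes S t ->
    exists n, forall k, (n <= k)%N -> ~~ (gamma (size (word k t)) / j.+1%:R <= state s (word k t))}.
  apply: (ae_not_infinitely_often size_word wordS measurable_word
    (hit := fun w => gamma (size w) / j.+1%:R <= state s w)
    (S := S) (G := vanishes S) (kappa := expR (- (c / j.+1%:R))) (n0 := n0)).
  - by rewrite expR_ge0 expR_lt1 oppr_lt0 divr_gt0.
  - exact: measurable_vanishes.
  - move=> w nw hw; have [f [f0 fs fw fG]] := hf w nw.
    apply: le_trans (cylinder_limit x01 gamma01 q01 measurable_word word_law f0 fs
      (measurable_vanishes S) fG) _.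
    rewrite cylinder_weight -EFinM lee_fin mulrC ler_wpM2r ?(weight_ge0 x01 gamma01 q01) //.
    apply: (le_trans fw); rewrite ler_expR lerN2 ler_pM2l //.
    by rewrite ler_pdivlMr ?g0 // mulrC.
  - by move=> t /vanishesP.
  - exact: hS.
apply: filterS (ae_foralln io) => t ht vt e e0.
have [n hn] := ht (Num.trunc e^-1) vt; exists (n + n0)%N => k nk.
have := hn k (leq_trans (leq_addr _ _) nk); rewrite -ltNge size_word => /lt_trans; apply.
rewrite mulrC ltr_pM2r; last by rewrite g0 // (leq_trans _ nk) // leq_addl.
by rewrite invf_plt ?posrE //; exact: truncnS_gt.
Qed.

Lemma ae_state_true_vanishes_fast :
  (\forall n \near \oo, 0 < gamma n.+1 <= gamma n) ->
  {ae P, forall t, state true (word n t) @[n --> \oo] --> 0 -> forall e, 0 < e ->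
     exists n, forall k, (n <= k)%N -> state true (word k t) < e * gamma k}.
Proof.
move=> [N _ gN]; have /andP[p0 p1] := drift_coef01.
have gmono n k : (N <= n)%N -> (n <= k)%N -> gamma k <= gamma n.
  move=> Nn /subnK <-; elim: (k - n)%N => // j IH; rewrite addSn.
  apply: le_trans IH.
  by have /andP[] := gN (j + n)%N (leq_trans Nn (leq_addl j n)).
have gpos n : (N.+1 <= n)%N -> 0 < gamma n.
  by case: n => // n _; have /andP[] := gamma01 n.
(* As gamma is nonincreasing, lam gamma stays below [c]. Hence lam gamma <= 1/2, and the quadratic
   term 3 (lam gamma)^2 is at most half of the favourable drift. *)
pose c := (q true - q false) / 6.
have c0 : 0 < c by rewrite divr_gt0.
have z0 v : 0 <= state true v by have /andP[] := state01 x01 gamma01 true v.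
have z1 v : state true v <= 1 by have /andP[] := state01 x01 gamma01 true v.
have : {ae P, forall t, vanishes (state true) t -> forall e, 0 < e ->
     exists n, forall k, (n <= k)%N -> state true (word k t) < e * gamma k}.
  apply: (ae_vanishes_fast c0 gpos) => [w Nw|].
    have gw : 0 < gamma (size w) by exact: gpos.
    exists (fun v => expR (- (c / gamma (size w) * state true v))); split.
    - by move=> v; exact: expR_ge0.
    - move=> v wv; have /andP[g0 g1] := gamma01 (size v).
      have gg : gamma (size v).+1 <= gamma (size w).
        by apply: gmono => //; [exact: ltnW|exact: leqW].
      set lam := c / gamma (size w); have lam0 : 0 <= lam by rewrite divr_ge0 // ltW.
      have lg : lam * gamma (size v).+1 <= c.
        by rewrite /lam mulrAC ler_pdivrMr // ler_wpM2l // ltW.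
      have lg0 : 0 <= lam * gamma (size v).+1 by rewrite mulr_ge0 // ltW.
      apply: le_trans (step_exp x01 gamma01 q01 true (w := v) lam0 _) _.
        by apply: le_trans lg _; rewrite /c; lra.
      rewrite ler_expR gerDl mulr_ge0_le0 //.
        by rewrite mulr_ge0 // subr_ge0.
      set y := lam * _ in lg lg0 *.
      rewrite /= [leLHS](_ : _ = y * (3 * y - (q true - q false))); last by ring.
      by rewrite mulr_ge0_le0 //; rewrite /c in lg; lra.
    - by rewrite mulrAC mulrA.
    - move=> t vt r r1; set lam := c / _; have lam0 : 0 < lam by rewrite divr_gt0.
      have e0 : 0 < (1 - r) / lam by rewrite divr_gt0 ?subr_gt0.
      have [n hn] := vanishesP vt e0; exists n => k nk.
      apply: le_trans (expR_ge1Dx _); have := hn k nk; rewrite ltr_pdivlMr // mulrC; lra.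
  by apply: filterS ae_state_cvg => t [ct _]; exact: vanishes_of_cvg.
by apply: filterS => t h zt; apply: h; apply/vanishes_cvg.
Qed.

Lemma ae_state_limit : sum_unbounded (fun k => gamma k.+1) -> {ae P, forall t,
  (state true (word n t) @[n --> \oo] --> (0 : R) /\
   state false (word n t) @[n --> \oo] --> (1 : R)) \/
  (state true (word n t) @[n --> \oo] --> (1 : R) /\
   state false (word n t) @[n --> \oo] --> (0 : R))}.
Proof.
move=> gU; apply: filterS2 ae_state_cvg ae_drift_bounded => t [ct cf] dM.
have fE : limn (fun n => state false (word n t)) = 1 - limn (fun n => state true (word n t)).
  have h : 1 - state true (word n t) @[n --> \oo] --> 1 - limn (fun n => state true (word n t)).
    by apply: cvgB => //; exact: cvg_cst.
  apply: cvg_lim => //; apply: cvg_trans h; apply: near_eq_cvg.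
  by near=> n; rewrite -stateN.
have [l|l] := state_limit01 x01 gamma01 gU ct dM.
  left; split; first by rewrite -l.
  by rewrite l subr0 in fE; rewrite -fE.
right; split; first by rewrite -l.
by rewrite l subrr in fE; rewrite -fE.
Unshelve. all: by end_near. Qed.

(** * Exponential supermartingales near 1, against the drift *)

Section FalseSide.
Let pi := q true - q false.
Let Pi n := \prod_(k < n) (1 - pi * gamma k.+1).

Let Pi_gt0 n : 0 < Pi n.
Proof.
have /andP[p0 p1] := drift_coef01.
apply: prodr_gt0 => k _; have /andP[g0 g1] := gamma01 k; rewrite subr_gt0.
by rewrite (lt_trans _ g1) // gtr_pMl.
Qed.

Let Pi_le1 n : Pi n <= 1.
Proof.
have /andP[p0 p1] := drift_coef01.
apply: prodr_ile1 => k _; have /andP[g0 g1] := gamma01 k; rewrite lerBlDr lerDl.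
by rewrite subr_ge0 (le_trans _ (ltW g1)) ?ler_piMl ?ltW ?mulr_gt0.
Qed.

Lemma scaled_state_cvg t :
  (exists M, forall n, \sum_(k < n) gamma k.+1 * state false (word k t) <= M) ->
  (forall e : R, 0 < e -> \forall n \near \oo, gamma n < e) ->
  cvgn (fun n => state false (word n t) / shrink pi true (word n t)) ->
  cvgn (fun n => state false (word n t) / Pi n).
Proof.
move=> zM gs c1; have p01 := drift_coef01.
have [l _ h] := shrink_ratio_cvg_to_pos x01 gamma01 (v := word ^~ t)
  (fun n => size_word n t) (fun n => wordS n t) gs p01 zM.
set m := limn _ in c1.
have {}h : state false (word n t) / shrink pi true (word n t) *
  (shrink pi true (word n t) / Pi n) @[n --> \oo] --> m * l by exact: cvgM.
apply/cvg_ex; exists (m * l); apply: cvg_trans h; apply: near_eq_cvg; near=> n => /=.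
have p01' : 0 <= pi <= 1 by case/andP: p01 => /ltW -> /ltW.
have s0 := lt0r_neq0 (shrink_gt0 x01 gamma01 true (word n t) p01').
by rewrite mulrA divfK.
Unshelve. all: by end_near. Qed.

Variable eta : R.
Hypothesis eta0 : 0 < eta.
Hypothesis gamma_decr : \forall n \near \oo,
  eta * gamma n.+1 ^+ 2 <= gamma n * (1 - pi * gamma n.+1) - gamma n.+1.
Hypothesis gamma_small : forall e : R, 0 < e -> \forall n \near \oo, gamma n < e.

Let S v := state false v / Pi (size v).

(* [lam k] solves [lam (k + 1) * (1 - pi * gamma (k + 1)) >= lam k] with enough
   room for the second-order term, yet stays of order [1 / Pi k]. *)
Lemma exp_supermartingale_false : exists2 c : R, 0 < c & exists N, forall w,
  (N <= size w)%N -> exists f : seq (bool * bool) -> R,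
    [/\ forall v, 0 <= f v,
        forall v, (size w <= size v)%N -> step f v <= f v,
        f w <= expR (- (c * (state false w / gamma (size w)))) &
        forall t, vanishes S t -> forall r, r < 1 ->
          exists n, forall k, (n <= k)%N -> r <= f (word k t)].
Proof.
have /andP[p0 p1] := drift_coef01; have eta_gt0 := eta0.
rewrite -/pi in p0 p1.
have z0 v : 0 <= state false v by have /andP[] := state01 x01 gamma01 false v.
have z1 v : state false v <= 1 by have /andP[] := state01 x01 gamma01 false v.
have S0 v : 0 <= S v by rewrite divr_ge0 // ltW.
have gpos n : (1 <= n)%N -> 0 < gamma n.
  by case: n => // n _; have /andP[] := gamma01 n.
have [N Ngood] : exists N, forall n, (N <= n)%N ->
    eta * gamma n.+1 ^+ 2 <= gamma n * (1 - pi * gamma n.+1) - gamma n.+1 /\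
    gamma n.+1 <= 2^-1.
  have h2 : 0 < 2^-1 :> R by rewrite invr_gt0.
  have [N1 _ h1] := gamma_decr; have [N2 _ h2'] := gamma_small h2.
  exists (N1 + N2)%N => n Nn; split; first by apply: h1; rewrite /= (leq_trans _ Nn) // leq_addr.
  by apply: ltW; apply: h2' => /=; rewrite leqW // (leq_trans _ Nn) // leq_addl.
pose a n := gamma n / Pi n.
have aS n : (N <= n)%N -> a n - a n.+1 >= eta * gamma n.+1 * a n.+1 /\
    2^-1 <= 1 - pi * gamma n.+1.
  move=> /Ngood[h1 h2]; have /andP[g0 g1] := gamma01 n.
  have pg : 2^-1 <= 1 - pi * gamma n.+1.
    have : pi * gamma n.+1 <= gamma n.+1 by rewrite ler_piMl // ltW.
    by lra.
  split=> //; have pg0 : 0 < 1 - pi * gamma n.+1 by lra.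
  have PE : Pi n.+1 = Pi n * (1 - pi * gamma n.+1) by rewrite /Pi big_ord_recr.
  have -> : a n - a n.+1 = (gamma n * (1 - pi * gamma n.+1) - gamma n.+1) / Pi n.+1.
    by rewrite /a PE; field; rewrite !gt_eqF.
  have P0 : 0 <= (Pi n.+1)^-1 by rewrite invr_ge0 ltW.
  by rewrite /a mulrA ler_wpM2r // -mulrA -expr2.
have a0 n : (1 <= n)%N -> 0 < a n by move=> n1; rewrite divr_gt0 ?gpos.
have amono n k : (N <= n)%N -> (n <= k)%N -> a k <= a n.
  move=> Nn /subnK <-; elim: (k - n)%N => // j IH; rewrite addSn.
  apply: le_trans IH; have [h _] := aS (j + n)%N (leq_trans Nn (leq_addl j n)).
  rewrite -subr_ge0; apply: le_trans h; rewrite mulr_ge0 ?(ltW (a0 _ _)) // mulr_ge0 ?(ltW eta0) //.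
  by rewrite ltW // gpos.
(* [c4] ensures lam gamma <= 2 c <= 1/2 for [step_exp]. In [c24], 24 = 3 * 4 * 2: the coefficient of
   the quadratic term, b^2 <= 4, and gamma_(k+1) / Pi_(k+1) <= 2 gamma_(k+1) / Pi_k. *)
pose c := eta / (24 + 4 * eta).
have d0 : 0 < 24 + 4 * eta by lra.
have c0 : 0 < c by rewrite divr_gt0.
have c4 : c <= 4^-1 by rewrite /c ler_pdivrMr //; lra.
have c24 : 24 * c <= eta by rewrite /c mulrA ler_pdivrMr // mulrC ler_pM2l //; lra.
have gposN n : (N.+1 <= n)%N -> 0 < gamma n by move=> Nn; rewrite gpos // (leq_trans _ Nn).
exists c => //; exists N.+1 => w Nw.
have a0w := a0 _ (leq_trans (ltn0Sn N) Nw); set A := a (size w) in a0w.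
(* [b] rises from 1 towards at most 2 as [a] decreases; its increments pay for the quadratic terms.
   At [size w] it equals 1, where c / A / Pi is c / gamma. *)
pose b k := 2 - a k / A.
pose lam k := c / A / Pi k * b k.
have b12 k : (size w <= k)%N -> 1 <= b k <= 2.
  move=> wk; have h1 : a k / A <= 1 by rewrite ler_pdivrMr // mul1r amono // ltnW.
  have h2 : 0 <= a k / A by rewrite divr_ge0 ?ltW // a0 // (leq_trans _ wk) // (leq_trans _ Nw).
  by rewrite /b; apply/andP; split; lra.
have cA0 : 0 < c / A by rewrite divr_gt0.
have lam0 k : (size w <= k)%N -> 0 <= lam k.
  move=> /b12/andP[b1 _]; rewrite /lam; apply: mulr_ge0; last exact: le_trans b1.
  by rewrite divr_ge0 ?(ltW cA0) ?(ltW (Pi_gt0 _)).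
exists (fun v => expR (- (lam (size v) * state false v))); split.
- by move=> v; exact: expR_ge0.
- move=> v wv; rewrite (@eq_step _ _ _ _ _
    (fun u => expR (- (lam (size v).+1 * state false u)))) //.
  have /andP[g0 g1] := gamma01 (size v).
  have wv' := leqW wv; have /andP[b1 b2] := b12 _ wv.
  have /andP[b1' b2'] := b12 _ wv'.
  have Nv := leq_trans (ltnW Nw) wv.
  have [adec pg] := aS _ Nv; set g := gamma _ in g0 g1 adec pg *.
  have a'0 : 0 < a (size v).+1 by exact: a0.
  have a'A : a (size v).+1 <= A by rewrite amono // ltnW.
  have PE : Pi (size v).+1 = Pi (size v) * (1 - pi * g) by rewrite /Pi big_ord_recr.
  have pg0 : 0 < 1 - pi * g by lra.
  have PV : (Pi (size v).+1)^-1 * (1 - pi * g) = (Pi (size v))^-1.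
    by rewrite PE invfM mulfVK // gt_eqF.
  have lgE : lam (size v).+1 * g = c / A * a (size v).+1 * b (size v).+1.
    by rewrite /lam /a -/g; ring.
  have lg0 : 0 <= lam (size v).+1 * g by rewrite mulr_ge0 ?lam0 // ltW.
  have lg : lam (size v).+1 * g <= 2^-1.
    rewrite lgE; apply: (@le_trans _ _ (c * 2)); last first.
      by apply: (@le_trans _ _ (4^-1 * 2)); [rewrite ler_pM2r|lra].
    rewrite [X in X * _](_ : _ = c * (a (size v).+1 / A)); last by ring.
    rewrite -mulrA ler_pM2l //; apply: (@le_trans _ _ (1 * 2)); last by rewrite mul1r.
    apply: ler_pM => //.
    - by rewrite divr_ge0 ?(ltW a'0) ?(ltW a0w).
    - exact: le_trans b1'.
    - by rewrite ler_pdivrMr // mul1r.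
  apply: le_trans (step_exp x01 gamma01 q01 false (w := v) (lam0 _ wv') lg) _.
  rewrite ler_expR /= -/pi -/g.
  set L := lam (size v).+1; set z := state false v.
  (* The factor 1 / Pi of [lam] cancels the linear term exactly, leaving the increment of [b]
     against the quadratic one. *)
  have key : lam (size v) <= L - (L * g * pi + 3 * (L * g) ^+ 2).
    have -> : L - (L * g * pi + 3 * (L * g) ^+ 2) =
        c / A * b (size v).+1 / Pi (size v) - 3 * (L * g) ^+ 2.
      by rewrite -PV /L /lam; ring.
    rewrite lgE /lam -subr_ge0.
    have bb : b (size v).+1 - b (size v) = (a (size v) - a (size v).+1) / A.
      by rewrite /b; ring.
    rewrite [leRHS](_ : _ = c / A / Pi (size v) * (b (size v).+1 - b (size v)) -
       3 * (c / A * a (size v).+1 * b (size v).+1) ^+ 2); last by ring.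
    rewrite bb subr_ge0.
    apply: (@le_trans _ _ (c / A / Pi (size v) * (eta * g * a (size v).+1 / A))); last first.
      have k1 : 0 <= c / A / Pi (size v) by rewrite ltW // divr_gt0.
      have k2 : 0 <= A^-1 by rewrite ltW // invr_gt0.
      exact: ler_wpM2l k1 _ _ (ler_wpM2r k2 adec).
    rewrite [leRHS](_ : _ = (c / A ^+ 2 * a (size v).+1) * (eta * (g / Pi (size v)))); last first.
      by field; rewrite !gt_eqF.
    rewrite [leLHS](_ : _ = (c / A ^+ 2 * a (size v).+1) *
        (3 * b (size v).+1 ^+ 2 * c * a (size v).+1)); last by field; rewrite gt_eqF.
    have k3 : 0 <= c / A ^+ 2 * a (size v).+1.
      by rewrite ltW // mulr_gt0 // divr_gt0 // exprn_gt0.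
    apply: (ler_wpM2l k3).
    have aP : a (size v).+1 <= 2 * (g / Pi (size v)).
      rewrite /a -/g -PV.
      have : 0 < g / Pi (size v).+1 by rewrite divr_gt0.
      set y := g / _ => y0; rewrite [leRHS](_ : _ = y * (2 * (1 - pi * g))); last by rewrite /y; ring.
      by rewrite ler_peMr ?(ltW y0) //; lra.
    have bsq : b (size v).+1 ^+ 2 <= 4 by nra.
    have y0 : 0 <= g / Pi (size v) by rewrite divr_ge0 ?(ltW g0) // ltW.
    apply: (@le_trans _ _ (12 * c * a (size v).+1)).
      rewrite ler_wpM2r ?(ltW a'0) // ler_wpM2r ?(ltW c0) //; lra.
    apply: (@le_trans _ _ (12 * c * (2 * (g / Pi (size v))))).
      by rewrite ler_wpM2l // mulr_ge0 // ltW.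
    rewrite [leLHS](_ : _ = 24 * c * (g / Pi (size v))); last by ring.
    exact: (ler_wpM2r y0 c24).
  have B0 : 0 <= L * g * pi + 3 * (L * g) ^+ 2.
    apply: addr_ge0; last by rewrite mulr_ge0 // sqr_ge0.
    by apply: mulr_ge0 => //; exact: ltW.
  have zz0 : 0 <= z by exact: z0.
  have zz1 : z <= 1 by exact: z1.
  have := ler_wpM2l zz0 key.
  have : 0 <= z ^+ 2 * (L * g * pi + 3 * (L * g) ^+ 2) by rewrite mulr_ge0 ?sqr_ge0.
  set B := L * g * pi + 3 * (L * g) ^+ 2; set l' := lam _.
  rewrite [z * (L - B)]mulrBr => h1 h2.
  rewrite (_ : z * (1 - z) * B = z * B - z ^+ 2 * B); last by ring.
  by rewrite [L * z]mulrC [l' * z]mulrC; lra.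
- have gw := gposN _ Nw.
  rewrite /lam /b divff ?gt_eqF // (_ : 2 - 1 = 1 :> R); last by ring.
  rewrite ler_expR lerN2 /A /a mulr1.
  rewrite [leRHS](_ : _ = c * (state false w / gamma (size w))) //; field.
  by rewrite !gt_eqF.
- move=> t vt r r1.
  have e0 : 0 < (1 - r) / (c / A * 2) by apply: divr_gt0; [rewrite subr_gt0|apply: mulr_gt0].
  have [n hn] := vanishesP vt e0; exists (n + size w)%N => k nk.
  apply: le_trans (expR_ge1Dx _); rewrite size_word.
  have := hn k (leq_trans (leq_addr _ _) nk); rewrite /S size_word ltr_pdivlMr; last exact: mulr_gt0.
  move=> h.
  have /andP[bk1 bk2] := b12 k (leq_trans (leq_addl _ _) nk).
  have : lam k * state false (word k t) <= state false (word k t) / Pi k * (c / A * 2).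
    rewrite [leLHS](_ : _ = state false (word k t) / Pi k * (c / A * b k)); last first.
      by rewrite /lam; ring.
    by rewrite ler_wpM2l ?divr_ge0 ?(ltW (Pi_gt0 _)) // ler_pM2l.
  by lra.
Qed.

Lemma ae_state_false_vanishes_fast : sum_unbounded (fun k => gamma k.+1) ->
  {ae P, forall t, vanishes S t -> forall e, 0 < e ->
     exists n, forall k, (n <= k)%N -> state false (word k t) < e * gamma k}.
Proof.
move=> gU; have z0 v : 0 <= state false v by have /andP[] := state01 x01 gamma01 false v.
have S0 v : 0 <= S v by rewrite divr_ge0 // ltW.
have [c c0 [N hf]] := exp_supermartingale_false.
have gposN n : (N.+1 <= n)%N -> 0 < gamma n.
  by case: n => // n _; have /andP[] := gamma01 n.
apply: (ae_vanishes_fast c0 gposN) => [w Nw|]; first exact: (hf w (ltnW Nw)).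
apply: filterS3 (ae_state_limit gU) ae_drift_bounded ae_state_shrink_cvg => t + dM sc h.
case=> [[_ zf1]|[_ zf0]].
  (* In this case [S] is eventually above 1/2, because [Pi] is at most 1, and cannot be small at
     late times. *)
  exfalso; have h2 : 2^-1 < 1 :> R by rewrite invf_lt1 // ltr1n.
  have [n1 _ hn1] := cvgr_gt _ zf1 _ h2.
  have [n jn] := h n1.+1; apply/negP; rewrite -leNgt.
  have := hn1 n (ltnW jn); rewrite /= => /ltW zn.
  apply: (@le_trans _ _ 2^-1); first by rewrite lef_pV2 ?posrE ?ltr0n // ler_nat.
  apply: (le_trans zn); by rewrite /S ler_pdivlMr // ler_piMr // Pi_le1.
apply: vanishes_of_cvg => //; rewrite /S.
rewrite (_ : (fun n => _) = (fun n => state false (word n t) / Pi n)); last first.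
  by apply/funext => n; rewrite size_word.
apply: scaled_state_cvg => //.
exact: (sum_gamma_state_bounded x01 gamma01 zf0 dM).
Qed.

End FalseSide.

Lemma gt0_measure_ae (E F : set T) : measurable E -> measurable F -> (0 < P E)%E ->
  {ae P, forall t, E t -> F t} -> (0 < P F)%E.
Proof.
move=> mE mF E0 EF; rewrite lt0e measure_ge0 andbT; apply/eqP => F0.
have EF0 : P (E `\` F) = 0%E.
  apply: measure_negligible; first exact: measurableD.
  by apply: negligibleS EF => t [Et nFt] /= h; apply: nFt; exact: h.
have : (P E <= P (E `\` F) + P F)%E.
  apply: (@le_trans _ _ (P ((E `\` F) `|` F))).
    apply: le_measure; rewrite ?inE //; first by apply: measurableU => //; exact: measurableD.
    by move=> t Et; have [Ft|nFt] := pselect (F t); [right|left].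
  by apply: measureU2 => //; exact: measurableD.
by rewrite EF0 F0 adde0 leNgt E0.
Qed.

Lemma state_all_down s m : state s (nseq m (~~ s, true)) =
  state s [::] * \prod_(k < m) (1 - gamma k.+1).
Proof.
elim: m => [|m IH]; first by rewrite big_ord0 mulr1.
rewrite /= negb_eqF /= size_nseq IH big_ord_recr /=; ring.
Qed.

Lemma weight_all_down_gt0 s m : state s [::] < 1 -> 0 < weight (nseq m (~~ s, true)).
Proof.
move=> z1; elim: m => //= m IH; rewrite mulr_gt0 // mulr_gt0 //; last first.
  by have /andP[] := q01 (~~ s).
rewrite stateN state_all_down subr_gt0; apply: le_lt_trans z1.
rewrite ler_piMr //; first by have /andP[] := state01 x01 gamma01 s [::].
apply: prodr_ile1 => k _; have /andP[g0 g1] := gamma01 k.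
by rewrite subr_ge0 (ltW g1) gerBl ltW.
Qed.

(** A run of down letters makes [state s] smaller than delta gamma_m, after which [iter_step_no_up]
    gives a lower bound uniform in the horizon. *)
Lemma survival_gt0 s :
  (forall e : R, 0 < e -> \forall n \near \oo, gamma n < e) ->
  slow_growth gamma (q (~~ s)) ->
  (forall kappa N, 0 < kappa -> exists2 m, (N <= m)%N &
    \prod_(k < m) (1 - gamma k.+1) < kappa * gamma m) ->
  state s [::] < 1 ->
  exists E : set T, [/\ measurable E, (0 < P E)%E & forall t, E t ->
    exists m, no_up_from (word ^~ t) s m /\ state s (word m t) < 1].
Proof.
move=> gs [delta d0 [N1 _ hN1]] hprod z1.
have /andP[qs0 qs1] := q01 s; have /andP[qn0 qn1] := q01 (~~ s).
have [N2 _ hN2] := gs _ qs0.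
have z0 : 0 <= state s [::] by have /andP[] := state01 x01 gamma01 s [::].
have [m Nm hm] := hprod delta (N1 + N2 + 1)%N d0.
set w0 := nseq m (~~ s, true); have w0m : size w0 = m by rewrite size_nseq.
(* For this choice [sigmaS] is exactly the bound q (~~ s) - delta on the increment of 1 / gamma. *)
pose sigma n := (gamma n)^-1 / delta.
have gpos n : (m <= n)%N -> 0 < gamma n.
  move=> mn; have : (0 < n)%N by rewrite (leq_trans _ mn) // (leq_trans _ Nm) // addn1.
  by case: n {mn} => // n _; have /andP[] := gamma01 n.
have sigma0 n : (m <= n)%N -> 0 <= sigma n.
  by move=> mn; rewrite divr_ge0 ?(ltW d0) // invr_ge0 ltW // gpos.
have sigmaS n : (m <= n)%N -> 1 + (1 - gamma n.+1 * q (~~ s)) * sigma n.+1 <= sigma n.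
  move=> mn; have h : (gamma n.+1)^-1 - (gamma n)^-1 <= q (~~ s) - delta.
    by apply: hN1; rewrite /= (leq_trans _ mn) // (leq_trans _ Nm) // -addnA leq_addr.
  have g0 := gpos n mn; have /andP[g0' _] := gamma01 n.
  rewrite -subr_ge0 /sigma.
  rewrite [leRHS](_ : _ = (q (~~ s) - delta - ((gamma n.+1)^-1 - (gamma n)^-1)) / delta).
    by rewrite divr_ge0 ?(ltW d0) // subr_ge0.
  by field; rewrite !gt_eqF.
have gq n : (m <= n)%N -> gamma n.+1 * q (~~ s) <= q s.
  move=> mn; have /andP[g0 g1] := gamma01 n; apply: (@le_trans _ _ (gamma n.+1)).
    by rewrite ler_piMr ?ltW.
  apply: ltW; apply: hN2 => /=; rewrite leqW // (leq_trans _ mn) // (leq_trans _ Nm) //.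
  by rewrite addn1 ltnW // ltnS leq_addl.
have small : sigma m * state s w0 < 1.
  have gm := gpos m (leqnn m).
  rewrite state_all_down /sigma.
  apply: (@le_lt_trans _ _ ((gamma m)^-1 / delta * \prod_(k < m) (1 - gamma k.+1))).
    rewrite ler_wpM2l ?divr_ge0 ?invr_ge0 ?(ltW d0) ?(ltW gm) // ler_piMl // ?(ltW z1) //.
    by apply: prodr_ge0 => k _; have /andP[_ /ltW] := gamma01 k; rewrite subr_ge0.
  by rewrite -invfM mulrC ltr_pdivrMr ?mulr_gt0 // mul1r [gamma m * _]mulrC.
have w00 : 0 < weight w0 by exact: weight_all_down_gt0.
pose F k := cylinder w0 `&` [set t | no_up s m (word (m + k) t)].
have mF k : measurable (F k).
  apply: measurableI; first exact: (measurable_word (size w0) [set w0]).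
  exact: (measurable_word (m + k) [set v | no_up s m v]).
have FE k : P (F k) = (weight w0 * iter k step (fun v => (no_up s m v)%:R) w0)%:E.
  transitivity (P (cylinder w0 `&` [set t | no_up s m (word (size w0 + k) t)])).
    by rewrite /F w0m.
  rewrite (word_law w0 k [set v | no_up s m v]); congr (_ * _)%:E; congr (iter _ _ _ _).
  by apply/funext => v /=; rewrite asboolb.
exists (\bigcap_k F k); split.
- exact: bigcapT_measurable.
- apply: (@lt_le_trans _ _ (weight w0 * (1 - sigma m * state s w0))%:E).
    by rewrite lte_fin mulr_gt0 // subr_gt0.
  apply: ge_measure_bigcap => // [i j ij t [wt nt]|k].
    split => //; move: nt; rewrite /= -(subnK ij) addnCA; elim: (j - i)%N => // k IH.
    by rewrite addSn; have [l ->] := wordS (k + (m + i)) t => /= /andP[_ /IH].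
  rewrite FE lee_fin ler_wpM2l ?(ltW w00) //.
  exact: (iter_step_no_up x01 gamma01 q01 k sigma0 sigmaS gq w0m).
- move=> t Et; exists m; have [wt _] := Et 0%N I.
  split=> [n mn vn|].
    have [_ /=] := Et (n.+1 - m)%N I; rewrite subnKC; last exact: leqW.
    by rewrite vn /= size_word ltnNge mn eqxx.
  rewrite -w0m wt state_all_down; apply: le_lt_trans z1; rewrite ler_piMr //.
  apply: prodr_ile1 => k _; have /andP[g0 g1] := gamma01 k.
  by rewrite subr_ge0 (ltW g1) gerBl ltW.
Qed.

(** After m losses, the two vanishing events have conditional probability at most 1 - X_m and exp (-
    c (1 - x) / gamma_m), since 1 - X_m >= 1 - x. The second is smaller than X_m = x prod (1 -
    gamma_k) for a suitable m, so the two do not exhaust the cylinder. *)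
Lemma not_vanishes_both_gt0 eta (pi := q true - q false) : 0 < eta ->
  (\forall n \near \oo, eta * gamma n.+1 ^+ 2 <= gamma n * (1 - pi * gamma n.+1) - gamma n.+1) ->
  (forall e : R, 0 < e -> \forall n \near \oo, gamma n < e) ->
  (forall kappa e N, 0 < kappa -> 0 < e -> exists2 m, (N <= m)%N &
    expR (- (kappa / gamma m)) < e * \prod_(k < m) (1 - gamma k.+1)) ->
  0 < x < 1 ->
  (0 < P (~` vanishes (state true) `&`
     ~` vanishes (fun v => (state false v / \prod_(k < size v) (1 - pi * gamma k.+1))%R)))%E.
Proof.
move=> eta0 gdecr gs hexp /andP[x0 x1]; set S := (fun v => _).
have [c c0 [N hf]] := exp_supermartingale_false eta0 gdecr gs.
have cx : 0 < c * (1 - x) by rewrite mulr_gt0 // subr_gt0.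
have [m Nm hm] := hexp _ _ N.+1 cx x0.
set w0 := nseq m (false, true); have w0m : size w0 = m by rewrite size_nseq.
have w00 : 0 < weight w0 by exact: (@weight_all_down_gt0 true m).
have st : state true w0 = x * \prod_(k < m) (1 - gamma k.+1) by exact: (state_all_down true m).
have gm : 0 < gamma m by case: (m) Nm => // k _; have /andP[] := gamma01 k.
have sf : 1 - x <= state false w0.
  rewrite (stateN _ _ true) lerD2l lerN2 st ler_piMr ?(ltW x0) //.
  apply: prodr_ile1 => k _; have /andP[g0 g1] := gamma01 k.
  by rewrite subr_ge0 (ltW g1) gerBl ltW.
have hT : (P (cylinder w0 `&` vanishes (state true)) <= (weight w0 * (1 - state true w0))%:E)%E.
  rewrite -(stateN _ _ true) /=.
  apply: (cylinder_limit x01 gamma01 q01 measurable_word word_law) => [v|v _||t vt r r1].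
  - by have /andP[] := state01 x01 gamma01 false v.
  - rewrite step_state /= gerDl; have /andP[g0 g1] := gamma01 (size v).
    rewrite -mulrA mulr_ge0_le0 ?(ltW g0) // mulr_le0_ge0 ?subr_le0 ?(ltW q_lt) //.
    have /andP[? _] := state01 x01 gamma01 true v.
    by have /andP[? _] := state01 x01 gamma01 false v; rewrite mulr_ge0.
  - exact: measurable_vanishes.
  - have r0 : 0 < 1 - r by rewrite subr_gt0.
    have [n hn] := vanishesP vt r0; exists n => k /hn.
    by rewrite (stateN _ _ true) ltrBrDr -ltrBrDl => /ltW.
have hS : (P (cylinder w0 `&` vanishes S) <= (weight w0 * expR (- (c * (1 - x) / gamma m)))%:E)%E.
  have Nw : (N <= size w0)%N by rewrite w0m ltnW.
  have [f [f0 fs fw fG]] := hf w0 Nw.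
  apply: le_trans (cylinder_limit x01 gamma01 q01 measurable_word word_law f0 fs
      (measurable_vanishes S) fG) _.
  rewrite lee_fin ler_wpM2l ?(ltW w00) // (le_trans fw) // ler_expR lerN2 w0m.
  by rewrite -mulrA ler_pM2l // ler_pM2r // invr_gt0.
have mT := measurable_vanishes (state true); have mS := measurable_vanishes S.
have mc : measurable (cylinder w0) by exact: (measurable_word (size w0) [set w0]).
rewrite lt0e measure_ge0 andbT; apply/eqP => E0.
have mE : measurable (~` vanishes (state true) `&` ~` vanishes S).
  by apply: measurableI; exact: measurableC.
have m1 : measurable (cylinder w0 `&` vanishes (state true)) by exact: measurableI.
have m2 : measurable (cylinder w0 `&` vanishes S) by exact: measurableI.
have sub : cylinder w0 `<=` (cylinder w0 `&` vanishes (state true)) `|`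
    ((cylinder w0 `&` vanishes S) `|` (~` vanishes (state true) `&` ~` vanishes S)).
  move=> t wt; have [?|?] := pselect (vanishes (state true) t); first by left.
  by right; have [?|?] := pselect (vanishes S t); [left|right].
move: E0 mE m1 m2 sub hT hS; set A1 := cylinder w0 `&` _; set A2 := cylinder w0 `&` _.
set A3 := _ `&` _ => E0 mE m1 m2 sub hT hS.
have m23 : measurable (A2 `|` A3) by exact: measurableU.
have : (P (cylinder w0) <= P A1 + (P A2 + P A3))%E.
  apply: (@le_trans _ _ (P (A1 `|` (A2 `|` A3)))).
    by apply: le_measure; rewrite ?inE //; exact: measurableU.
  apply: (@le_trans _ _ (P A1 + P (A2 `|` A3))%E); first exact: measureU2.
  by apply: leeD => //; exact: measureU2.
rewrite E0 adde0 cylinder_weight => h.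
have := le_trans h (leeD hT hS); rewrite -EFinD lee_fin -mulrDr.
rewrite -[leLHS]mulr1 ler_pM2l // -addrA lerDl addrC subr_ge0 st leNgt.
by rewrite hm.
Qed.

End Convergence.

(** * Rates of convergence *)

Section Rates.
Context (R : realType) d (T : measurableType d) (P : probability T R).
Variables (gamma : nat -> R) (q : bool -> R) (x : R) (alpha C C' : R).
Variable (word : nat -> T -> seq (bool * bool)).
Hypothesis x01 : 0 <= x <= 1.
Hypothesis gamma01 : forall n, 0 < gamma n.+1 < 1.
Hypothesis q01 : forall s, 0 < q s < 1.
Hypothesis size_word : forall n t, size (word n t) = n.
Hypothesis wordS : forall n t, exists l, word n.+1 t = l :: word n t.
Hypothesis measurable_word : forall n (Q : set (seq (bool * bool))),
  measurable [set t | Q (word n t)].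
Hypothesis word_law : forall w k (Q : set (seq (bool * bool))),
  P ([set t | word (size w) t = w] `&` [set t | Q (word (size w + k) t)]) =
  (weight gamma q x w *
    iter k (step gamma q x) (fun v => (`[< Q v >] : bool)%:R) w)%:E.
Hypothesis q_lt : q false < q true.
Hypothesis alpha01 : 0 < alpha <= 1.
Hypothesis C_gt0 : 0 < C.
Hypothesis C'_gt0 : 0 < C'.
Hypothesis gammaE : \forall n \near \oo, gamma n = (C / (C' + n%:R)) `^ alpha.

Local Notation state := (state gamma x).
Local Notation vanishes := (vanishes word).

Let gs : forall e : R, 0 < e -> \forall n \near \oo, gamma n < e.
Proof. by move=> e; exact: (gamma_small alpha01 C_gt0 C'_gt0 gammaE). Qed.

Let gU := gamma_sum_unbounded alpha01 C_gt0 C'_gt0 gamma01 gammaE.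

Let size_v t n : size (word n t) = n. Proof. exact: size_word. Qed.

Let vS t n : exists l, word n.+1 t = l :: word n t. Proof. exact: wordS. Qed.

Let state_ge0 s v : 0 <= state s v.
Proof. by have /andP[] := state01 x01 gamma01 s v. Qed.

Lemma ae_limit : {ae P, forall t,
  (state true (word n t) @[n --> \oo] --> (0 : R) /\
   state false (word n t) @[n --> \oo] --> (1 : R)) \/
  (state true (word n t) @[n --> \oo] --> (1 : R) /\
   state false (word n t) @[n --> \oo] --> (0 : R))}.
Proof.
exact: (ae_state_limit x01 gamma01 q01 size_word wordS measurable_word word_law q_lt gU).
Qed.

Let fast s t := forall e : R, 0 < e ->
  exists n, forall k, (n <= k)%N -> state s (word k t) < e * gamma k.

Lemma fast_no_up s t : fast s t -> exists m, no_up_from (word ^~ t) s m.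
Proof.
move=> /(_ 1 ltr01)[m hm]; exists m.
apply: (no_up_from_small x01 gamma01 (size_v t)) => n mn.
by have := hm n.+1 (leqW mn); rewrite mul1r.
Qed.

Lemma ae_true_fast : {ae P, forall t,
  state true (word n t) @[n --> \oo] --> 0 -> fast true t}.
Proof.
exact: (ae_state_true_vanishes_fast x01 gamma01 q01 size_word wordS measurable_word
  word_law q_lt (gamma_nonincreasing alpha01 C_gt0 C'_gt0 gammaE)).
Qed.

Lemma ae_sum_gamma_bounded s : {ae P, forall t, state s (word n t) @[n --> \oo] --> 0 ->
  exists M, forall n, \sum_(k < n) gamma k.+1 * state s (word k t) <= M}.
Proof.
apply: filterS (ae_drift_bounded x01 gamma01 q01 size_word wordS measurable_word word_law q_lt).
by move=> t dM zt; exact: (sum_gamma_state_bounded x01 gamma01 zt dM).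
Qed.

Lemma ae_true_summable : slow_growth gamma (q false) ->
  {ae P, forall t, state true (word n t) @[n --> \oo] --> 0 ->
    exists M, forall n, \sum_(k < n) state true (word k t) <= M}.
Proof.
move=> sg; apply: filterS3 ae_true_fast (ae_sum_gamma_bounded true)
  (ae_downfall_cvg x01 gamma01 q01 size_word wordS measurable_word word_law true).
move=> t ht hM [c1 _] zt; have [m nu] := fast_no_up (ht zt).
exact: (no_up_sum_bounded x01 gamma01 (q := q) (s := true) (size_v t) (vS t) gs (q01 false) erefl
  sg nu (hM zt) c1).
Qed.

(** Since n ^ a <= n and n gamma_n <= C, the state would be at least a constant times gamma_n. *)
Lemma powR_cvg_not_fast a s t : alpha = 1 -> a <= 1 ->
  cvg_to_pos (fun n => n%:R `^ a * state s (word n t)) -> ~ fast s t.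
Proof.
move=> alpha1 a1 /cvg_to_pos_ge[c c0 [N1 _ h1]].
have [N2 _ h2] := gamma1_upper C_gt0 C'_gt0 gammaE alpha1.
have e0 : 0 < c / C by rewrite divr_gt0.
move=> /(_ _ e0)[n hn]; pose k := (N1 + N2 + n).+1.
have k1 : 1 <= k%:R :> R by rewrite ler1n.
have := h1 k; rewrite /= => /(_ (leqW _)) h3.
have {}h3 : c <= k%:R `^ a * state s (word k t).
  by apply: h3; rewrite -addnA leq_addr.
have h4 : k%:R * gamma k <= C.
  by apply: h2; rewrite /= leqW // addnAC leq_addl.
have h5 : state s (word k t) < c / C * gamma k by apply: hn; rewrite leqW // leq_addl.
have k0 : 0 < k%:R :> R by rewrite ltr0n.
have ka : k%:R `^ a <= k%:R by exact: ler1_powR.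
have : k%:R `^ a * state s (word k t) <= k%:R * state s (word k t) by rewrite ler_wpM2r.
have : k%:R * state s (word k t) < k%:R * (c / C * gamma k) by rewrite ltr_pM2l.
rewrite [k%:R * (_ * _)]mulrCA.
have : c / C * (k%:R * gamma k) <= c / C * C by rewrite ler_pM2l.
rewrite divfK ?gt_eqF //; move: h3; lra.
Qed.

Lemma ae_no_up_rate s : alpha = 1 -> 0 < state s [::] ->
  {ae P, forall t, state s (word n t) @[n --> \oo] --> 0 ->
    (exists m, no_up_from (word ^~ t) s m) ->
    cvg_to_pos (fun n => n%:R `^ (C * q (~~ s)) * state s (word n t))}.
Proof.
move=> alpha1 z0; apply: filterS2 (ae_sum_gamma_bounded s)
  (ae_downfall_cvg x01 gamma01 q01 size_word wordS measurable_word word_law s).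
move=> t hM [c1 c2] zt [m nu].
have c01 : 0 < q (~~ s) <= 1 by have /andP[-> /ltW] := q01 (~~ s).
apply: (no_up_powR_cvg x01 gamma01 (q := q) (size_v t) (vS t) gs C_gt0 (q01 _) erefl z0 nu _ (hM zt)).
  exact: (gamma_prod_cvg_to_pos C_gt0 C'_gt0 gamma01 gammaE alpha1 c01).
apply: (downfall_shrink_cvg_to_pos x01 gamma01 q01 (size_v t) (vS t) gs _ c1 c2).
exact: (gamma_sqr_bounded C_gt0 C'_gt0 gammaE alpha1).
Qed.

Lemma ae_true_rate : alpha = 1 -> 0 < x ->
  {ae P, forall t, state true (word n t) @[n --> \oo] --> 0 ->
    cvg_to_pos (fun n => n%:R `^ (C * q false) * state true (word n t))}.
Proof.
move=> alpha1 x0; apply: filterS2 ae_true_fast (@ae_no_up_rate true alpha1 x0).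
by move=> t hf hr zt; apply: hr => //; exact: fast_no_up (hf zt).
Qed.

Lemma ae_infallible : alpha = 1 -> 0 < x -> C * q false <= 1 ->
  {ae P, forall t, ~ state true (word n t) @[n --> \oo] --> 0}.
Proof.
move=> alpha1 x0 Cq; apply: filterS2 ae_true_fast (ae_true_rate alpha1 x0).
move=> t hf hr zt; exact: (powR_cvg_not_fast alpha1 Cq (hr zt) (hf zt)).
Qed.

Let pi := q true - q false.

Let pi01 : 0 < pi < 1.
Proof.
have /andP[_ h1] := q01 true; have /andP[h2 _] := q01 false.
by rewrite subr_gt0 q_lt (lt_trans _ h1) // gtrBl.
Qed.

(** For alpha = 1 this is n ^ (C pi) (1 - X_n) up to a factor with a positive limit. Whether it
    vanishes separates the two rates near 1. *)
Definition scaled_false (v : seq (bool * bool)) : R :=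
  state false v / \prod_(k < size v) (1 - pi * gamma k.+1).

Let Pi_gt0 n : 0 < \prod_(k < n) (1 - pi * gamma k.+1).
Proof.
have /andP[p0 p1] := pi01.
apply: prodr_gt0 => k _; have /andP[g0 g1] := gamma01 k; rewrite subr_gt0.
by rewrite (lt_trans _ g1) // gtr_pMl.
Qed.

Lemma scaled_false_ge0 v : 0 <= scaled_false v.
Proof. by rewrite divr_ge0 // ltW. Qed.

Let Pi_rate : alpha = 1 ->
  cvg_to_pos (fun n => n%:R `^ (C * pi) * \prod_(k < n) (1 - pi * gamma k.+1)).
Proof.
move=> alpha1; apply: (gamma_prod_cvg_to_pos C_gt0 C'_gt0 gamma01 gammaE alpha1).
by have /andP[-> /ltW] := pi01.
Qed.

Lemma ae_scaled_false_cvg : {ae P, forall t, state false (word n t) @[n --> \oo] --> 0 ->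
  cvgn (fun n => scaled_false (word n t))}.
Proof.
apply: filterS2 (ae_sum_gamma_bounded false)
  (ae_state_shrink_cvg x01 gamma01 q01 size_word wordS measurable_word word_law q_lt).
move=> t hM c1 zt.
have := scaled_state_cvg x01 gamma01 q01 size_word wordS q_lt (hM zt) gs c1.
rewrite (_ : (fun n => _) = (fun n => scaled_false (word n t))) //.
by apply/funext => n; rewrite /scaled_false size_word.
Qed.

Lemma powR_scaled_false n t : n%:R `^ (C * pi) * state false (word n t) =
  n%:R `^ (C * pi) * \prod_(k < n) (1 - pi * gamma k.+1) * scaled_false (word n t).
Proof.
rewrite /scaled_false size_word -!mulrA; congr (_ * _).
by rewrite mulrC divfK // gt_eqF.
Qed.

Lemma ae_false_rate_large : alpha = 1 -> x < 1 -> 1 <= C * pi ->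
  {ae P, forall t, state false (word n t) @[n --> \oo] --> 0 ->
    cvg_to_pos (fun n => n%:R `^ (C * q true) * state false (word n t))}.
Proof.
move=> alpha1 x1 Cpi.
have x1' : 0 < state false [::] by rewrite /= subr_gt0.
apply: filterS2 ae_scaled_false_cvg (@ae_no_up_rate false alpha1 x1').
move=> t hc hr zt; apply: hr => //.
have C2 : 0 < C / 2 by rewrite divr_gt0.
apply: (no_up_of_powR_cvg x01 gamma01 (size_v t) Cpi C2
  (gamma1_lower C_gt0 C'_gt0 gammaE alpha1) zt).
have [l _ hl] := Pi_rate alpha1.
rewrite (_ : (fun n => _) = (fun n => n%:R `^ (C * pi) *
    \prod_(k < n) (1 - pi * gamma k.+1) * scaled_false (word n t))).
  by apply: is_cvgM; [apply/cvg_ex; exists l|exact: hc].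
by apply/funext => n; exact: powR_scaled_false.
Qed.

Lemma ae_false_rate_regular : alpha = 1 ->
  {ae P, forall t, state false (word n t) @[n --> \oo] --> 0 -> ~ vanishes scaled_false t ->
    cvg_to_pos (fun n => n%:R `^ (C * pi) * state false (word n t))}.
Proof.
move=> alpha1; apply: filterS ae_scaled_false_cvg => t hc zt nv.
have c := hc zt.
have pos : cvg_to_pos (fun n => scaled_false (word n t)).
  exists (limn (fun n => scaled_false (word n t))) => //.
  rewrite lt_neqAle; apply/andP; split; last first.
    by apply: limr_ge => //; near=> n; exact: scaled_false_ge0.
  apply/eqP => l0; apply: nv; apply/vanishes_cvg; first exact: scaled_false_ge0.
  by rewrite l0.
apply: cvg_to_pos_near (cvg_to_posM (Pi_rate alpha1) pos).
by near=> n; rewrite powR_scaled_false.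
Unshelve. all: by end_near. Qed.

Lemma ae_scaled_false_fast : alpha = 1 -> C * pi < 1 ->
  {ae P, forall t, vanishes scaled_false t -> fast false t}.
Proof.
move=> alpha1 Cpi.
have [eta0 decr] := gamma1_decr alpha01 C_gt0 C'_gt0 gammaE alpha1 Cpi.
exact: (ae_state_false_vanishes_fast x01 gamma01 q01 size_word wordS measurable_word
  word_law q_lt eta0 decr gs gU).
Qed.

Lemma vanishes_scaled_false t : vanishes scaled_false t ->
  state false (word n t) @[n --> \oo] --> 0.
Proof.
move=> vt; apply/vanishes_cvg => // i.
have [n hn] := vt i; exists n => k /hn; apply: le_lt_trans.
rewrite /scaled_false ler_pdivlMr // ler_piMr //.
have /andP[p0 p1] := pi01.
apply: prodr_ile1 => j _; have /andP[g0 g1] := gamma01 j.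
by rewrite subr_ge0 (le_trans _ (ltW g1)) ?ler_piMl ?ltW //= gtrBl mulr_gt0.
Qed.

Lemma ae_false_rate_vanishing : alpha = 1 -> x < 1 -> C * pi < 1 ->
  {ae P, forall t, vanishes scaled_false t ->
    cvg_to_pos (fun n => n%:R `^ (C * q true) * state false (word n t))}.
Proof.
move=> alpha1 x1 Cpi.
have x1' : 0 < state false [::] by rewrite /= subr_gt0.
apply: filterS2 (ae_scaled_false_fast alpha1 Cpi) (@ae_no_up_rate false alpha1 x1').
move=> t hf hr vt; apply: hr; first exact: vanishes_scaled_false.
exact: fast_no_up (hf vt).
Qed.

(** The mirror of [ae_infallible]: vanishing would force the rate n ^ (C pA), too slow for 1 - X_n
    to be negligible against gamma_n. *)
Lemma ae_not_vanishing : alpha = 1 -> x < 1 -> C * pi < 1 -> C * q true <= 1 ->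
  {ae P, forall t, ~ vanishes scaled_false t}.
Proof.
move=> alpha1 x1 Cpi Cq.
apply: filterS2 (ae_scaled_false_fast alpha1 Cpi) (ae_false_rate_vanishing alpha1 x1 Cpi).
move=> t hf hr vt; exact: (powR_cvg_not_fast alpha1 Cq (hr vt) (hf vt)).
Qed.

Lemma not_vanishing_gt0 : alpha = 1 -> 0 < x < 1 -> C * pi < 1 ->
  (0 < P (~` vanishes (state true) `&` ~` vanishes scaled_false))%E.
Proof.
move=> alpha1 x01' Cpi.
have [eta0 decr] := gamma1_decr alpha01 C_gt0 C'_gt0 gammaE alpha1 Cpi.
apply: (not_vanishes_both_gt0 x01 gamma01 q01 size_word measurable_word
  word_law q_lt eta0 decr gs) => // kappa e N.
exact: (expR_lt_prod alpha01 C_gt0 C'_gt0 gamma01 gammaE alpha1).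
Qed.

(* After an all-down prefix the state never goes up again, hence decreases. *)
Lemma survival s : slow_growth gamma (q (~~ s)) -> state s [::] < 1 ->
  exists E : set T, [/\ measurable E, (0 < P E)%E & {ae P, forall t, E t ->
    state s (word n t) @[n --> \oo] --> 0 /\
    exists m, no_up_from (word ^~ t) s m}].
Proof.
move=> sg z1.
have [|E [mE E0 hE]] := survival_gt0 x01 gamma01 q01 size_word wordS measurable_word word_law gs sg _ z1.
  move=> kappa N; exact: (prod_lt_scaled_gamma alpha01 C_gt0 C'_gt0 gamma01 gammaE N sg (q01 _)).
exists E; split => //; apply: filterS ae_limit => t lt Et.
have [m [nu zm]] := hE t Et; split; last by exists m.
have zle n : (m <= n)%N -> state s (word n t) <= state s (word m t).
  move=> mn; rewrite (no_up_fromE x gamma01 (size_v t) (vS t) nu mn).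
  have dm := downfall_gt0 gamma01 s (word m t).
  rewrite mulrAC ler_pdivrMr // ler_wpM2l // -(subnK mn).
  elim: (n - m)%N => [|k IH]; first by rewrite add0n.
  rewrite addSn; have [l ->] := wordS (k + m) t => /=; apply: le_trans IH.
  have /andP[g0 g1] := gamma01 (size (word (k + m) t)).
  have d0 := downfall_gt0 gamma01 s (word (k + m) t).
  by case: ifP => _; rewrite ?mulr1 // ler_piMr ?(ltW d0) // gerBl ltW.
have not1 : ~ state s (word n t) @[n --> \oo] --> (1 : R).
  move=> h; have [N _ hN] := cvgr_gt _ h _ zm.
  have := hN (N + m)%N (leq_addr _ _); rewrite /= ltNge => /negP; apply.
  by apply: zle; exact: leq_addl.
by case: s {sg z1 E0 hE nu zle zm} not1 => not1; case: lt => -[].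
Qed.

End Rates.

(** * The law of the history *)

Lemma uniform_prob01_le (R : realType) (z : R) : 0 <= z <= 1 ->
  uniform_prob (@ltr01 R) `]-oo, z] = z%:E.
Proof.
move=> /andP[z0 z1]; rewrite /uniform_prob integral_uniform_pdf.
have -> : `]-oo, z] `&` `[(0 : R), 1] = [set` `[0, z]].
  apply/seteqP; split => y /=; rewrite !in_itv /=.
    by move=> [yz /andP[y0 _]]; rewrite y0 yz.
  by move=> /andP[y0 yz]; rewrite yz y0 (le_trans yz z1).
rewrite (eq_integral (fun=> 1%:E)); last first.
  move=> y; rewrite inE/= in_itv/= /uniform_pdf => /andP[y0 yz].
  by rewrite y0 (le_trans yz z1) subr0 invr1.
rewrite integral_cst//= mul1e lebesgue_measure_itv/= lte_fin.
case: ltP => [_|z0']; first by rewrite sube0.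
by congr EFin; apply/eqP; rewrite eq_le z0 z0'.
Qed.

Lemma independent_family_initial d d' (T : measurableType d)
    (T' : measurableType d') (R : realType) (P : probability T R)
    (Y : nat -> T -> T') (E : nat -> set T') n :
  independent_family P Y -> (forall i, measurable (E i)) ->
  P [set t | forall i, (i < n)%N -> E i (Y i t)] =
  (\prod_(0 <= i < n) P (Y i @^-1` E i))%E.
Proof.
move=> indY mE; have := indY [fset i in iota 0 n]%fset E (fun i _ => mE i).
have -> : \bigcap_(i in [set` [fset i in iota 0 n]%fset]) Y i @^-1` E i =
    [set t | forall i, (i < n)%N -> E i (Y i t)].
  apply/seteqP; split => t h i /=.
    by move=> ilt; apply: h; rewrite /= inE /= mem_iota add0n.
  by rewrite inE /= mem_iota add0n => ilt; exact: h.
move=> ->; rewrite (perm_big (iota 0 n)) /=; first by rewrite /index_iota subn0.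
apply: uniq_perm; rewrite ?iota_uniq ?fset_uniq // => i.
by rewrite !inE.
Qed.

Lemma sigma_family_initial d d' (T : measurableType d)
    (T' : measurableType d') (Y : nat -> T -> T') (E : nat -> set T') n :
  (forall i, measurable (E i)) ->
  sigma_family Y [set t | forall i, (i < n)%N -> E i (Y i t)].
Proof.
move=> mE; rewrite /sigma_family; set G := \bigcup_i _.
have -> : [set t | forall i, (i < n)%N -> E i (Y i t)] =
    \bigcap_(i in `I_n) (Y i @^-1` E i).
  by apply/seteqP; split => t h i /= ilt; exact: h.
have := @fin_bigcap_measurable _ (g_sigma_algebraType G) _ `I_n
  (fun i => Y i @^-1` E i) (finite_II n); apply => i _.
apply: sub_gen_smallest; exists i => //.
by exists (E i); [exact: mE|rewrite setTI].
Qed.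

(** * The algorithm read as a random history *)

Section Link.
Context (R : realType) d (T : measurableType d) (P : probability T R).
Variables (pA pB : R) (gamma : nat -> R).
Variables (U : nat -> {RV P >-> R}) (A B : nat -> set T) (x : R).

Definition hit (s : bool) : R := if s then pA else pB.

Local Notation state := (state gamma x).
Local Notation weight := (weight gamma hit x).

(** Each letter reads one of [A] and [B] only, so the law of the history involves just their
    marginal probabilities. *)
Fixpoint word (n : nat) (t : T) : seq (bool * bool) :=
  if n is m.+1 then
    let u := U m.+1 t <= state true (word m t) in
    (u, t \in (if u then A m.+1 else B m.+1)) :: word m t
  else [::].

Lemma size_word n t : size (word n t) = n.
Proof. by elim: n => //= n ->. Qed.

Lemma banditE n t :
  bandit gamma (fun n => U n : T -> R) A B x n t = state true (word n t).
Proof.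
elim: n => //= n IH; rewrite size_word !indicE !in_setI IH /=.
have -> : (t \in [set v | U n.+1 v <=
    bandit gamma (fun n => U n : T -> R) A B x n v]) =
    (U n.+1 t <= state true (word n t)).
  by apply/idP/idP; rewrite inE /= IH.
have -> : (t \in [set v | U n.+1 v >
    bandit gamma (fun n => U n : T -> R) A B x n v]) =
    ~~ (U n.+1 t <= state true (word n t)).
  by rewrite -ltNge; apply/idP/idP; rewrite inE /= IH.
case: (U n.+1 t <= _) => /=.
  by case: (t \in A _) => /=; ring.
by case: (t \in B _) => /=; ring.
Qed.

Definition cylinder w : set T := [set t | word (size w) t = w].

Local Notation AB := (fun n => indic_pair R (A n.+1) (B n.+1)).

(** The constraint that a letter following the history [w] puts on its uniform variable. The letter
    at position i, counted from 0 for the oldest, is drawn with index i + 1. *)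
Let EU1 (l : bool * bool) w : set R :=
  if l.1 then [set` `]-oo, state true w]] else ~` `]-oo, state true w].

Fixpoint EU w i : set R :=
  if w is l :: w' then if i == size w' then EU1 l w' else EU w' i else setT.

Let EAB1 (l : bool * bool) : set (R * R) :=
  [set ab | (if l.1 then ab.1 else ab.2) = l.2%:R].

Fixpoint EAB w i : set (R * R) :=
  if w is l :: w' then if i == size w' then EAB1 l else EAB w' i else setT.

Lemma measurable_EU w i : measurable (EU w i).
Proof.
elim: w => //= l w IH; case: ifP => // _; rewrite /EU1.
by case: ifP => _; [exact: measurable_itv|apply: measurableC; exact: measurable_itv].
Qed.

Lemma measurable_EAB w i : measurable (EAB w i).
Proof.
elim: w => //= l w IH; case: ifP => // _; rewrite /EAB1; case: l.1.
  rewrite [X in measurable X](_ : _ = fst @^-1` [set l.2%:R]) //.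
  by rewrite -[X in measurable X]setTI; exact: measurable_fst.
rewrite [X in measurable X](_ : _ = snd @^-1` [set l.2%:R]) //.
by rewrite -[X in measurable X]setTI; exact: measurable_snd.
Qed.

(** Once the prefix is known to be [w], the threshold for the next uniform variable is the number
    [state true w]; the constraints thus bear on each variable separately. *)
Lemma cylinderE w : cylinder w =
  [set t | forall i, (i < size w)%N -> EAB w i (AB i t)] `&`
  [set t | forall i, (i < size w)%N -> EU w i (U i.+1 t)].
Proof.
rewrite /cylinder; elim: w => [|l w IH]; first by apply/seteqP; split => t.
have {}IH t : word (size w) t = w <->
  (forall i, (i < size w)%N -> EAB w i (AB i t)) /\
  (forall i, (i < size w)%N -> EU w i (U i.+1 t)).
  by move: IH => /seteqP[h1 h2]; split => [/h1|/h2].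
have ind (S : set T) (t : T) (b : bool) : (\1_S t = b%:R :> R) <-> ((t \in S) = b).
  rewrite indicE; split => [|->] //; case: (t \in S) b => -[] //= /eqP.
    by rewrite oner_eq0.
  by rewrite eq_sym oner_eq0.
have EUE t : EU1 l w (U (size w).+1 t) <-> (U (size w).+1 t <= state true w) = l.1.
  rewrite /EU1; case: l.1 => /=; rewrite in_itv /=; first by split.
  by split => [/negP/negbTE //|->].
have EABE t : EAB1 l (AB (size w) t) <->
    (t \in (if l.1 then A (size w).+1 else B (size w).+1)) = l.2.
  by rewrite /EAB1 /=; case: l.1 => /=; rewrite ind.
apply/seteqP; split => t /=.
  case=> lE wE; rewrite wE in lE.
  have [h1 h2] := (IH t).1 wE.
  split=> i; rewrite ltnS leq_eqVlt; case: eqP => [-> _|_ /=]; rewrite ?eqxx.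
  - by apply/EABE; rewrite -lE.
  - by move=> /h1.
  - by apply/EUE; rewrite -lE.
  - by move=> /h2.
move=> [h1 h2].
have wE : word (size w) t = w.
  apply/IH; split => i ilt.
    by have := h1 i (ltnW ilt); rewrite (ltn_eqF ilt).
  by have := h2 i (ltnW ilt); rewrite (ltn_eqF ilt).
have := h1 (size w) (ltnSn _); have := h2 (size w) (ltnSn _).
rewrite eqxx wE => /EUE uE /EABE hE.
by rewrite uE hE; case: (l).
Qed.

Hypothesis x01 : 0 <= x <= 1.
Hypothesis gamma01 : forall n, 0 < gamma n.+1 < 1.
Hypothesis U_iid : iid_uniform01 (fun n => U n.+1).
Hypothesis mA : forall n, measurable (A n.+1).
Hypothesis mB : forall n, measurable (B n.+1).
Hypothesis PA : forall n, P (A n.+1) = pA%:E.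
Hypothesis PB : forall n, P (B n.+1) = pB%:E.
Hypothesis AB_indep : independent_family P AB.
Hypothesis AB_U_indep : independent_classes P
  (sigma_family AB) (sigma_family (fun n => U n.+1 : T -> R)).

Lemma measurable_cylinder w : measurable (cylinder w).
Proof.
have mind (S : set T) : measurable S -> measurable_fun setT (\1_S : T -> R).
  by move=> mS; exact: measurable_indic.
have mAB n : measurable_fun setT (AB n).
  by apply/measurable_fun_pairP; split; exact: mind.
rewrite cylinderE; apply: measurableI.
  rewrite [X in measurable X](_ : _ = \bigcap_(i in `I_(size w)) (AB i @^-1` EAB w i)).
    apply: fin_bigcap_measurable => // i _.
    by rewrite -[X in measurable X]setTI; apply: mAB => //; exact: measurable_EAB.
  by apply/seteqP; split => t h i /= ilt; exact: h.
rewrite [X in measurable X](_ : _ = \bigcap_(i in `I_(size w)) (U i.+1 @^-1` EU w i)).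
  apply: fin_bigcap_measurable => // i _.
  by rewrite -[X in measurable X]setTI; apply: measurable_funP => //; exact: measurable_EU.
by apply/seteqP; split => t h i /= ilt; exact: h.
Qed.

Lemma cylinder_prob w : P (cylinder w) = (weight w)%:E.
Proof.
rewrite cylinderE AB_U_indep; last 2 first.
- by apply: sigma_family_initial; exact: measurable_EAB.
- exact: (sigma_family_initial (Y := fun n => U n.+1 : T -> R) _ (measurable_EU w)).
rewrite (independent_family_initial _ AB_indep (measurable_EAB w)).
rewrite (independent_family_initial _ U_iid.2 (measurable_EU w)).
elim: w => [|l w IH]; first by rewrite !big_geq // mule1.
rewrite /= !big_nat_recr //= !eqxx.
rewrite (eq_big_nat _ _ (F2 := fun i => P (AB i @^-1` EAB w i))); last first.
  by move=> i /andP[_ ilt]; rewrite (ltn_eqF ilt).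
rewrite [X in (_ * (X * _))%E](eq_big_nat _ _ (F2 := fun i => P (U i.+1 @^-1` EU w i))); last first.
  by move=> i /andP[_ ilt]; rewrite (ltn_eqF ilt).
rewrite muleACA IH EFinM; congr *%E; rewrite muleC EFinM; congr *%E.
  have -> : P (U (size w).+1 @^-1` EU1 l w) =
      distribution P (U (size w).+1) (EU1 l w) by [].
  have z01 := state01 x01 gamma01 true w.
  have mI : measurable `]-oo, state true w] by exact: measurable_itv.
  have UE S : measurable S ->
      distribution P (U (size w).+1) S = uniform_prob (@ltr01 R) S.
    exact: (U_iid.1 (size w)).
  rewrite /EU1; case: l.1.
    by rewrite UE // uniform_prob01_le.
  transitivity (1 - distribution P (U (size w).+1) `]-oo, state true w])%E.
    exact: probability_setC.
  rewrite UE // uniform_prob01_le //.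
  by rewrite -EFinB -(stateN _ _ true).
have ind (S : set T) (b : bool) : measurable S ->
    P [set t | \1_S t = b%:R :> R] = if b then P S else (1 - P S)%E.
  case: b => mS.
    congr (P _); apply/seteqP; split => t /=; rewrite indicE.
      by case: (boolP (t \in S)) => [|_ /eqP]; [rewrite inE|rewrite eq_sym oner_eq0].
    by move=> St; rewrite mem_set.
  rewrite -probability_setC //; congr (P _); apply/seteqP; split => t /=; rewrite indicE.
    by move=> h /mem_set St; move: h; rewrite St => /eqP; rewrite oner_eq0.
  by move=> St; rewrite memNset.
case: l => [[] h] /=.
  rewrite -[X in P X]/[set t | \1_(A (size w).+1) t = h%:R :> R] ind //.
  by rewrite PA; case: h => //=; rewrite EFinB.
rewrite -[X in P X]/[set t | \1_(B (size w).+1) t = h%:R :> R] ind //.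
by rewrite PB; case: h => //=; rewrite EFinB.
Qed.

Lemma measurable_word n (Q : set (seq (bool * bool))) :
  measurable [set t | Q (word n t)].
Proof.
rewrite [X in measurable X](_ : _ =
  \bigcup_w (if `[< Q w /\ size w = n >] then cylinder w else set0)).
  apply: countable_bigcupT_measurable; first exact: countableP.
  by move=> w; case: ifP => // _; exact: measurable_cylinder.
apply/seteqP; split => t /=.
  move=> Qt; exists (word n t) => //.
  by rewrite asboolT ?size_word // /cylinder /= size_word.
by move=> [w _]; case: asboolP => // -[Qw <-]; rewrite /cylinder /= => ->.
Qed.

Lemma cylinder_cons w t : cylinder w t ->
  exists l, cylinder (l :: w) t.
Proof.
move=> wt; exists (head (true, true) (word (size w).+1 t)).
by move: wt; rewrite /cylinder /= => ->.
Qed.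

(** Induction on [k] for all [w] at once, splitting the cylinder according to its next letter. *)
Lemma cylinder_iter_step w k (Q : set (seq (bool * bool))) :
  P (cylinder w `&` [set t | Q (word (size w + k) t)]) =
  (weight w * iter k (step gamma hit x) (fun v => (`[< Q v >] : bool)%:R) w)%:E.
Proof.
elim: k w => [|k IH] w.
  rewrite addn0 /=; case: asboolP => Qw.
    rewrite mulr1 -cylinder_prob; congr (P _); apply/seteqP; split => t /=; first by case.
    by move=> wt; split => //; rewrite wt.
  rewrite mulr0; transitivity (P set0); last exact: measure0.
  congr (P _); apply/seteqP; split => t //=.
  by case; rewrite /cylinder /= => ->.
have mC (l : bool * bool) : measurable (cylinder (l :: w) `&` [set t | Q (word (size w + k.+1) t)]).
  by apply: measurableI; [exact: measurable_cylinder|exact: measurable_word].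
have dis (l l' : bool * bool) : l != l' ->
    cylinder (l :: w) `&` cylinder (l' :: w) = set0.
  move=> ll'; apply/seteqP; split => t //= [].
  by rewrite /cylinder /= => -> [] /eqP; rewrite (negbTE ll').
set V := [set t | _].
have VE (l : bool * bool) : P (cylinder (l :: w) `&` V) =
  (weight (l :: w) * iter k (step gamma hit x) (fun v => (`[< Q v >] : bool)%:R) (l :: w))%:E.
  by rewrite -IH /V addnS.
have -> : cylinder w `&` V =
  ((cylinder ((true, true) :: w) `&` V) `|` (cylinder ((true, false) :: w) `&` V)) `|`
  ((cylinder ((false, true) :: w) `&` V) `|` (cylinder ((false, false) :: w) `&` V)).
  apply/seteqP; split => t /=.
    move=> [/cylinder_cons[[[] []] h] Vt]; [left; left|left; right|right; left|right; right]; by split.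
  have sub l : cylinder (l :: w) t -> cylinder w t by rewrite /cylinder /= => -[].
  by move=> [[]|[]] [/sub].
have dis2 l l' : l != l' ->
    (cylinder (l :: w) `&` V) `&` (cylinder (l' :: w) `&` V) = set0.
  by move=> ll'; rewrite setIACA dis // set0I.
have PU (S S' : set T) : measurable S -> measurable S' -> S `&` S' = set0 ->
    P (S `|` S') = (P S + P S')%E.
  by move=> mS mS' SS'; rewrite -measureU.
rewrite !PU; try exact: mC; try exact: measurableU; try exact: dis2; last first.
  by rewrite setIUl !setIUr !dis2 // !setU0.
rewrite !VE -!EFinD; congr EFin => /=; rewrite /step /=; ring.
Qed.

End Link.

(** Shows that the two rates of 1 - X_n exclude each other, their quotient being n ^ (C pB). *)
Lemma powR_not_cvg_to_pos (R : realType) (b : R) : 0 < b ->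
  ~ cvg_to_pos (fun n => n%:R `^ b).
Proof.
move=> b0 [l l0 h]; have ll : l < l + 1 by rewrite ltrDl.
have [N _ hN] := cvgr_lt _ h _ ll.
pose K := (l + 1) `^ b^-1; pose n := (N + (Num.trunc K).+1)%N.
have := hN n (leq_addr _ _); rewrite /= ltNge => /negP; apply.
have l1 : 0 <= l + 1 by rewrite addr_ge0 // ltW.
have -> : l + 1 = K `^ b by rewrite /K -powRrM mulVf ?gt_eqF // powRr1.
apply: ge0_ler_powR; rewrite ?nnegrE ?powR_ge0 ?(ltW b0) //.
have hK : K < (Num.trunc K).+1%:R by exact: truncnS_gt.
by apply: (le_trans (ltW hK)); rewrite ler_nat leq_addl.
Qed.

Theorem mainTheorem1 (R : realType) (d : measure_display)
    (T : measurableType d) (P : probability T R)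
    (pA pB : R) (gamma : nat -> R)
    (U : nat -> {RV P >-> R}) (A B : nat -> set T)
    (alpha C C' : R)
    (pB_gt0 : 0 < pB) (pB_lt_pA : pB < pA) (pA_lt1 : pA < 1)
    (gamma01 : forall n, 0 < gamma n.+1 < 1)
    (U_iid : iid_uniform01 (fun n => U n.+1))
    (mA : forall n, measurable (A n.+1))
    (mB : forall n, measurable (B n.+1))
    (PA : forall n, P (A n.+1) = pA%:E)
    (PB : forall n, P (B n.+1) = pB%:E)
    (AB_indep :
       independent_family P (fun n => indic_pair R (A n.+1) (B n.+1)))
    (AB_U_indep : independent_classes P
       (sigma_family (fun n => indic_pair R (A n.+1) (B n.+1)))
       (sigma_family (fun n => U n.+1 : T -> R)))
    (alpha01 : 0 < alpha <= 1) (C_gt0 : 0 < C) (C'_gt0 : 0 < C')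
    (gammaE : \forall n \near \oo, gamma n = (C / (C' + n%:R)) `^ alpha) :
  let p := pA - pB in
  let X := bandit gamma (fun n => U n : T -> R) A B in
  exists Xoo : R -> {RV P >-> R},
  (* the random variable X_oo attached to each starting point x *)
  (forall x, 0 <= x <= 1 ->
     {ae P, forall w, X x n w @[n --> \oo] --> Xoo x w} /\
     {ae P, forall w, Xoo x w = 0 \/ Xoo x w = 1}) /\
  (* (1) *)
  (alpha < 1 \/ (alpha = 1 /\ 1 < C * pB) ->
     [/\ forall x, 0 <= x < 1 -> (0 < P [set w | Xoo x w = 0%R])%E,
         forall x, 0 < x < 1 -> (P [set w | Xoo x w = 0%R] < 1)%E,
         forall x, 0 <= x < 1 -> {ae P, forall w, Xoo x w = 0 ->
           (\sum_(0 <= n <oo) (X x n w)%:E < +oo)%E}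
       & alpha = 1 -> forall x, 0 < x < 1 -> {ae P, forall w, Xoo x w = 0 ->
           cvg_to_pos (fun n => n%:R `^ (C * pB) * X x n w)}]) /\
  (* (2) *)
  (alpha = 1 -> C <= 1 / pB ->
     forall x, 0 < x <= 1 -> P [set w | Xoo x w = 1%R] = 1%E) /\
  (* (3) *)
  (alpha = 1 -> 1 / p <= C ->
     forall x, 0 < x < 1 -> {ae P, forall w, Xoo x w = 1 ->
       cvg_to_pos (fun n => n%:R `^ (C * pA) * (1 - X x n w))}) /\
  (* (4) *)
  (alpha = 1 -> 1 / pA < C < 1 / p ->
     forall x, 0 < x < 1 -> exists E1 E2 : set T,
       [/\ measurable E1, measurable E2 & E1 `&` E2 = set0] /\
       {ae P, forall w, (E1 `|` E2) w <-> Xoo x w = 1} /\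
       ((0 < P E1)%E /\ (0 < P E2)%E) /\
       {ae P, forall w, E1 w ->
         cvg_to_pos (fun n => n%:R `^ (C * p) * (1 - X x n w))} /\
       {ae P, forall w, E2 w ->
         cvg_to_pos (fun n => n%:R `^ (C * pA) * (1 - X x n w))}) /\
  (* (5) *)
  (alpha = 1 -> C <= 1 / pA ->
     (forall x, 0 < x <= 1 -> P [set w | Xoo x w = 1%R] = 1%E) /\
     (forall x, 0 < x < 1 -> {ae P, forall w, Xoo x w = 1 ->
       cvg_to_pos (fun n => n%:R `^ (C * p) * (1 - X x n w))})).
Proof.
move=> p X; pose q := hit pA pB.
have q01 s : 0 < q s < 1.
  by case: s; rewrite /q /=; apply/andP; split=> //;
    [exact: lt_trans pB_lt_pA|exact: lt_trans pA_lt1].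
have q_lt : q false < q true by [].
pose W x := word gamma U A B x.
have sW x n t : size (W x n t) = n by exact: size_word.
have WS x n t : exists l, W x n.+1 t = l :: W x n t by eexists; reflexivity.
have mW x := measurable_word gamma U x mA mB.
have lawW (x : R) (x01 : 0 <= x <= 1) :=
  cylinder_iter_step x01 gamma01 U_iid mA mB PA PB AB_indep AB_U_indep.
have XE x n t : X x n t = state gamma x true (W x n t) by exact: banditE.
have XfE x n t : 1 - X x n t = state gamma x false (W x n t).
  by rewrite XE (stateN _ _ true).
pose V x := vanishes (W x) (state gamma x true).
have mV x : measurable (V x) by exact: (measurable_vanishes (mW x)).
(* An indicator is measurable with values 0 and 1 everywhere; it agrees with the limit off the null
   set where X_n has neither limit. *)
pose Xoo x : {RV P >-> R} := mindic R (measurableC (mV x)).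
have XooE x t : Xoo x t = (t \in ~` V x)%:R by rewrite /Xoo /= mindicE.
have Xoo1 x t : Xoo x t = 1 <-> ~ V x t.
  rewrite XooE; split=> [|nV]; last by rewrite mem_set.
  by have [/set_mem|] := boolP (t \in ~` V x) => // _ /eqP; rewrite eq_sym oner_eq0.
have Xoo0 x t : Xoo x t = 0 <-> V x t.
  rewrite XooE; split=> [|Vt].
    by have [|/negP h _] := boolP (t \in ~` V x);
      [move=> _ /eqP; rewrite oner_eq0|apply: contrapT => nV; apply: h; exact: mem_set].
  by rewrite memNset //= => /(_ Vt).
have VE (x : R) (x01 : 0 <= x <= 1) t :
    V x t <-> state gamma x true (W x n t) @[n --> \oo] --> 0.
  by apply: vanishes_cvg => v; have /andP[] := state01 x01 gamma01 true v.
have lim (x : R) (x01 : 0 <= x <= 1) := ae_limit x01 gamma01 q01 (sW x) (WS x) (mW x)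
  (lawW x x01) q_lt alpha01 C_gt0 C'_gt0 gammaE.
have limV (x : R) (x01 : 0 <= x <= 1) : {ae P, forall t,
    ~ V x t -> state gamma x false (W x n t) @[n --> \oo] --> 0}.
  by apply: filterS (lim x x01) => t [[h _] nV|[]//]; exfalso; apply: nV; apply/VE.
have setE0 x : [set w | Xoo x w = 0] = V x by apply/seteqP; split=> t /Xoo0.
have setE1 x : [set w | Xoo x w = 1] = ~` V x by apply/seteqP; split=> t /Xoo1.
have oo01 (x : R) : 0 < x < 1 -> 0 <= x <= 1 by case/andP => /ltW -> /ltW.
have infallible (x : R) : alpha = 1 -> C * pB <= 1 -> 0 < x <= 1 ->
    P [set w | Xoo x w = 1] = 1%E.
  move=> a1 CB /andP[x0 x1]; have x01 : 0 <= x <= 1 by rewrite x1 ltW.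
  have h := ae_infallible x01 gamma01 q01 (sW x) (WS x) (mW x) (lawW x x01) q_lt
    alpha01 C_gt0 C'_gt0 gammaE a1 x0 CB.
  rewrite setE1 probability_setC // (_ : P (V x) = 0%E) ?sube0 //.
  apply: measure_negligible => //; apply: negligibleS h => t Vt /= nV.
  by apply: nV; apply/VE.
have pA0 : 0 < pA by exact: lt_trans pB_lt_pA.
have p0 : 0 < p by rewrite subr_gt0.
exists Xoo; split=> [x x01|].
  split; last first.
    apply: aeW => t; have [Vt|nV] := pselect (V x t); first by left; apply/Xoo0.
    by right; apply/Xoo1.
  apply: filterS (lim x x01) => t h.
  rewrite (_ : (fun n => _) = (fun n => state gamma x true (W x n t))); last by apply/funext => n.
  have [Vt|nV] := pselect (V x t).
    by rewrite (Xoo0 x t).2 //; exact/VE.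
  by rewrite (Xoo1 x t).2 //; case: h => -[h _] //; exfalso; apply: nV; apply/VE.
split; [move=> hyp|split; [|split; [|split]]].
- have sg : slow_growth gamma (q false).
    case: hyp => [a1|[a1 CB]]; last exact: (slow_growth_eq1 C_gt0 C'_gt0 gammaE a1 CB).
    exact: (slow_growth_lt1 C_gt0 C'_gt0 gammaE a1 pB_gt0).
  split=> [x /andP[x0 x1]|x x01'|x /andP[x0 x1]|a1 x x01'].
  + have x01 : 0 <= x <= 1 by rewrite x0 ltW.
    have [E [mE E0 hE]] := survival (s := true) x01 gamma01 q01 (sW x) (WS x) (mW x)
      (lawW x x01) q_lt alpha01 C_gt0 C'_gt0 gammaE sg x1.
    rewrite setE0; apply: gt0_measure_ae E0 _ => //.
    by apply: filterS hE => t hE Et; apply/(VE x x01); exact: (hE Et).1.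
  + have x01 := oo01 x x01'; have /andP[x0 x1] := x01'.
    rewrite setE0.
    (* The supermartingale 1 - X_n starts at 1 - x and tends to 1 on [V x], so the probability of
       [V x] is at most 1 - x. *)
    have := @cylinder_limit _ _ _ P _ _ _ _ x01 gamma01 q01 (mW x) (lawW x x01)
      (state gamma x false) [::] (V x).
    rewrite (_ : [set t | _] = setT); last first.
      by apply/seteqP; split => t //= _; have := sW x 0 t; case: (W x 0 t).
    rewrite setTI /= mul1r => /(_ _ _ _ _)/le_lt_trans; apply => //.
    * by move=> v; have /andP[] := state01 x01 gamma01 false v.
    * move=> v _; rewrite step_state /= gerDl; have /andP[g0 g1] := gamma01 (size v).
      rewrite -mulrA mulr_ge0_le0 ?(ltW g0) // mulr_le0_ge0 ?subr_le0 ?(ltW q_lt) //.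
      have /andP[? _] := state01 x01 gamma01 true v.
      by have /andP[? _] := state01 x01 gamma01 false v; rewrite mulr_ge0.
    * move=> t Vt c c1; have c0 : 0 < 1 - c by rewrite subr_gt0.
      have [n hn] := vanishesP Vt c0; exists n => k /hn.
      by rewrite (stateN _ _ true) ltrBrDr -ltrBrDl => /ltW.
    * by rewrite lte_fin gtrBl.
  + have x01 : 0 <= x <= 1 by rewrite x0 ltW.
    have := ae_true_summable x01 gamma01 q01 (sW x) (WS x) (mW x) (lawW x x01) q_lt
      alpha01 C_gt0 C'_gt0 gammaE sg.
    apply: filterS => t h /Xoo0/(VE x x01)/h[M hM].
    apply: (@le_lt_trans _ _ M%:E); last exact: ltry.
    have z0 n : 0 <= X x n t by rewrite XE; have /andP[] := state01 x01 gamma01 true (W x n t).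
    apply: lime_le; first by apply: is_cvg_nneseries => n _ _; rewrite lee_fin.
    near=> n; rewrite big_mkord sumEFin lee_fin; apply: le_trans (hM n).
    by apply: ler_sum => k _; rewrite XE.
  + have x01 := oo01 x x01'; have /andP[x0 x1] := x01'.
    have := ae_true_rate x01 gamma01 q01 (sW x) (WS x) (mW x) (lawW x x01) q_lt
      alpha01 C_gt0 C'_gt0 gammaE a1 x0.
    apply: filterS => t h /Xoo0/(VE x x01)/h; apply: cvg_to_pos_near.
    by near=> n; rewrite XE.
- move=> a1 CB x x01; apply: infallible => //.
  by move: CB; rewrite ler_pdivlMr.
- move=> a1 Cp x x01'; have x01 := oo01 x x01'; have /andP[x0 x1] := x01'.
  have Cp' : 1 <= C * p by move: Cp; rewrite ler_pdivrMr.
  have := ae_false_rate_large x01 gamma01 q01 (sW x) (WS x) (mW x) (lawW x x01) q_lt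
    alpha01 C_gt0 C'_gt0 gammaE a1 x1 Cp'.
  apply: filterS2 (limV x x01) => t hV h /Xoo1/hV/h; apply: cvg_to_pos_near.
  by near=> n; rewrite XfE.
- move=> a1 /andP[CA Cp] x x01'; have x01 := oo01 x x01'; have /andP[x0 x1] := x01'.
  have CA' : 1 < C * pA by move: CA; rewrite ltr_pdivrMr.
  have Cp' : C * p < 1 by move: Cp; rewrite ltr_pdivlMr.
  (* This event carries the rate n ^ (C pA); its complement within X_oo = 1 carries n ^ (C p). *)
  pose S := vanishes (W x) (scaled_false gamma q x).
  have mS : measurable S by exact: (measurable_vanishes (mW x)).
  have SV : {ae P, forall t, S t -> ~ V x t}.
    apply: filterS (lim x x01) => t h St /(VE x x01) hT.
    have hF := vanishes_scaled_false x01 gamma01 q01 q_lt St.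
    case: h => [[_ h]|[h _]].
      have /eqP : (0 : R) = 1 by exact: (cvg_unique (@norm_hausdorff _ _) hF h).
      by rewrite eq_sym oner_eq0.
    have /eqP : (0 : R) = 1 by exact: (cvg_unique (@norm_hausdorff _ _) hT h).
      by rewrite eq_sym oner_eq0.
  exists (~` V x `&` ~` S), (~` V x `&` S); split; [|split; [|split; [|split]]].
  + split; [by apply: measurableI; exact: measurableC|apply: measurableI => //; exact: measurableC|].
    by apply/seteqP; split => t //= [[_ nS] [_ St]].
  + apply: aeW => t; rewrite Xoo1; split=> [[[]|[]]//|nV].
    by have [St|nS] := pselect (S t); [right|left].
  + split.
      exact: (not_vanishing_gt0 x01 gamma01 q01 (sW x) (mW x) (lawW x x01) q_lt
        alpha01 C_gt0 C'_gt0 gammaE a1 x01' Cp').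
    have sg : slow_growth gamma (q (~~ false)) by exact: (slow_growth_eq1 C_gt0 C'_gt0 gammaE a1 CA').
    have z1 : state gamma x false [::] < 1 by rewrite /= gtrBl.
    have [E [mE E0 hE]] := survival x01 gamma01 q01 (sW x) (WS x) (mW x)
      (lawW x x01) q_lt alpha01 C_gt0 C'_gt0 gammaE sg z1.
    have z0 : 0 < state gamma x false [::] by rewrite /= subr_gt0.
    have rate := ae_no_up_rate (s := false) x01 gamma01 q01 (sW x) (WS x) (mW x) (lawW x x01) q_lt
      alpha01 C_gt0 C'_gt0 gammaE a1 z0.
    apply: gt0_measure_ae E0 _ => //; first by apply: measurableI => //; exact: measurableC.
    have reg := ae_false_rate_regular x01 gamma01 q01 (sW x) (WS x) (mW x) (lawW x x01) q_lt
      alpha01 C_gt0 C'_gt0 gammaE a1.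
    apply: filterS3 (filterI hE SV) rate reg => t [hE' SVt] hr hg Et.
    have [hF nu] := hE' Et.
    suff St : S t by split => //; exact: SVt.
    (* Off [S] a surviving path would obey both rates, and their quotient n ^ (C pB) would have a
       finite limit. *)
    apply: contrapT => nS.
    have pos := cvg_to_posM (hr hF nu) (cvg_to_posV (hg hF nS)).
    apply: (@powR_not_cvg_to_pos R (C * pB)); first exact: mulr_gt0.
    apply: cvg_to_pos_near pos; near=> n.
    have n0 : 0 < n%:R :> R by rewrite ltr0n; near: n; exact: nbhs_infty_gt.
    have y0 := state_gt0 x01 gamma01 (W x n t) z0.
    rewrite invfM mulrACA divff ?mulr1 ?gt_eqF // -powRN -powRD; last first.
      by rewrite (gt_eqF n0) implybT.
    by congr (_ `^ _); rewrite /q /= /p; ring.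
  + have := ae_false_rate_regular x01 gamma01 q01 (sW x) (WS x) (mW x) (lawW x x01) q_lt
      alpha01 C_gt0 C'_gt0 gammaE a1.
    apply: filterS2 (limV x x01) => t hV h [/hV/h hh nS]; apply: cvg_to_pos_near (hh nS).
    by near=> n; rewrite XfE.
  + have := ae_false_rate_vanishing x01 gamma01 q01 (sW x) (WS x) (mW x) (lawW x x01) q_lt
      alpha01 C_gt0 C'_gt0 gammaE a1 x1 Cp'.
    apply: filterS => t h [_ /h]; apply: cvg_to_pos_near.
    by near=> n; rewrite XfE.
- move=> a1 CA; have CA' : C * pA <= 1 by move: CA; rewrite ler_pdivlMr.
  have CB : C * pB <= 1 by apply: le_trans CA'; rewrite ler_pM2l // ltW.
  have Cp : C * p < 1 by apply: lt_le_trans CA'; rewrite ltr_pM2l // gtrBl.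
  split=> [x x01|x x01']; first exact: infallible.
  have x01 := oo01 x x01'; have /andP[x0 x1] := x01'.
  have nv := ae_not_vanishing x01 gamma01 q01 (sW x) (WS x) (mW x) (lawW x x01) q_lt
    alpha01 C_gt0 C'_gt0 gammaE a1 x1 Cp CA'.
  have := ae_false_rate_regular x01 gamma01 q01 (sW x) (WS x) (mW x) (lawW x x01) q_lt
      alpha01 C_gt0 C'_gt0 gammaE a1.
  apply: filterS3 (limV x x01) nv => t hV nS h /Xoo1/hV/h hh; apply: cvg_to_pos_near (hh nS).
  by near=> n; rewrite XfE.
Unshelve. all: by end_near. Qed.
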